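(* Let $\sigma\in C([0,\infty);\mathbb{R}^{d\times r})$ and let $Y$ be the unique continuous adapted process obeying \[ dY(t)=-Y(t)\,dt+\sigma(t)\,dB(t),\quad t\ge 0;\quad Y(0)=0. \] Let $h>0$ and for $\epsilon>0$ define \[ S_h'(\epsilon)=\sum_{n=1}^\infty \sqrt{\int_{nh}^{(n+1)h}\|\sigma(s)\|_F^2\,ds}\cdot\exp\left(-\frac{\epsilon^2}{2\int_{nh}^{(n+1)h}\|\sigma(s)\|_F^2\,ds}\right). \] (A) If $S_h'(\epsilon)<+\infty$ for all $\epsilon>0$, then $\lim_{t\to\infty}Y(t)=0$ a.s. (B) If there exists $\epsilon'>0$ such that $S_h'(\epsilon)<+\infty$ for all $\epsilon>\epsilon'$ and $S_h'(\epsilon)=+\infty$ for all $0<\epsilon<\epsilon'$, then there exist deterministic $0<c_1\le c_2<+\infty$ such that \[ c_1\le\limsup_{t\to\infty}\|Y(t)\|\le c_2,\quad\text{a.s.} \] Moreover, \[ \liminf_{t\to\infty}\|Y(t)\|=0,\quad \lim_{t\to\infty}\frac1t\int_0^t\|Y(s)\|^2\,ds=0,\quad\text{a.s.} \] (C) If $S_h'(\epsilon)=+\infty$ for all $\epsilon>0$, then $\limsup_{t\to\infty}\|Y(t)\|=+\infty$ a.s.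
   Context: $d,r$ are positive integers, $B$ is an $r$-dimensional standard Brownian motion, $\sigma$ is deterministic, $\|\cdot\|$ is the Euclidean norm on $\mathbb{R}^d$, and $\|\cdot\|_F$ is the Frobenius norm on $\mathbb{R}^{d\times r}$. A term of $S_h'(\epsilon)$ for which $\int_{nh}^{(n+1)h}\|\sigma(s)\|_F^2\,ds=0$ is interpreted as $0$. *)

(* Defs.v *)
From HB Require Import structures.
From mathcomp Require Import all_boot all_order all_algebra.
From mathcomp Require Import all_classical all_reals all_analysis.

Set Implicit Arguments.
Unset Strict Implicit.
Unset Printing Implicit Defensive.

Import Order.TTheory GRing.Theory Num.Theory.
Import numFieldNormedType.Exports.

Local Open Scope classical_set_scope.
Local Open Scope ring_scope.

(* Time is R; only times t >= 0 are ever constrained. *)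

(* The library norm on matrices is the sup norm, hence these two norms. *)
Definition enorm (R : realType) (d : nat) (v : 'cV[R]_d) : R :=
  Num.sqrt (\sum_(i < d) v i ord0 ^+ 2).

Definition frobenius (R : realType) (d r : nat) (A : 'M[R]_(d, r)) : R :=
  Num.sqrt (\sum_(i < d) \sum_(j < r) A i j ^+ 2).

Definition filtration (R : realType) (disp : measure_display)
    (T : measurableType disp) (F : R -> set (set T)) : Prop :=
  [/\ forall t, 0 <= t -> sigma_algebra setT (F t),
      forall t, 0 <= t -> F t `<=` measurable &
      forall s t, 0 <= s -> s <= t -> F s `<=` F t].

Definition adapted (R : realType) (disp : measure_display)
    (T : measurableType disp) (F : R -> set (set T)) (d : nat)
    (X : R -> T -> 'cV[R]_d) : Prop :=
  forall t, 0 <= t -> forall (i : 'I_d) (E : set R), measurable E ->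
    F t ((fun w => X t w i ord0) @^-1` E).

Definition continuous_paths (R : realType) (disp : measure_display)
    (T : measurableType disp) (P : probability T R) (d : nat)
    (X : R -> T -> 'cV[R]_d) : Prop :=
  {ae P, forall w, {within `[0, +oo[, continuous (fun t => X t w)}}.

(* The event that the random vector Z lies in the box \prod_i E i. *)
Definition in_box (R : realType) (T : Type) (d : nat) (Z : T -> 'cV[R]_d)
    (E : 'I_d -> set R) : set T :=
  [set w | forall i, E i (Z w i ord0)].

(* Product rule over full families; subfamilies are covered by taking
   E i = setT. *)
Definition independent_components (R : realType) (disp : measure_display)
    (T : measurableType disp) (P : probability T R) (d : nat)
    (Z : T -> 'cV[R]_d) : Prop :=
  forall E : 'I_d -> set R, (forall i, measurable (E i)) ->
    P (in_box Z E) = (\prod_(i < d) P ((fun w => Z w i ord0) @^-1` E i))%E.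

(* Boxes form a pi-system generating the Borel sets of R^d. *)
Definition independent_of (R : realType) (disp : measure_display)
    (T : measurableType disp) (P : probability T R) (d : nat)
    (Z : T -> 'cV[R]_d) (G : set (set T)) : Prop :=
  forall (A : set T) (E : 'I_d -> set R), G A -> (forall i, measurable (E i)) ->
    P (A `&` in_box Z E) = (P A * P (in_box Z E))%E.

Record brownian_motion (R : realType) (disp : measure_display)
    (T : measurableType disp) (P : probability T R) (F : R -> set (set T))
    (r : nat) (B : R -> T -> 'cV[R]_r) : Prop := BrownianMotion {
  bm_adapted : adapted F B ;
  bm_start : {ae P, forall w, B 0 w = 0} ;
  bm_continuous : continuous_paths P B ;
  (* the second parameter of normal_prob is the standard deviation *)
  bm_gaussian : forall s t, 0 <= s -> s < t -> forall (j : 'I_r) (E : set R),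
    measurable E ->
    P ((fun w => (B t w - B s w) j ord0) @^-1` E) =
      normal_prob 0 (Num.sqrt (t - s)) E ;
  bm_components : forall s t, 0 <= s -> s < t ->
    independent_components P (fun w => B t w - B s w) ;
  bm_increments : forall s t, 0 <= s -> s < t ->
    independent_of P (fun w => B t w - B s w) (F s) }.

(* Deterministic step integrand \sum_(k < n) coef k * 1_]knot k, knot k.+1]
   on [0, a]. *)
Record step_integrand (R : realType) (d r : nat) (a : R) := StepIntegrand {
  step_size : nat ;
  step_knot : nat -> R ;
  step_coef : nat -> 'M[R]_(d, r) ;
  step_knot_first : step_knot 0%N = 0 ;
  step_knot_last : step_knot step_size = a ;
  step_knot_le : forall k l : nat, (k <= l)%N -> step_knot k <= step_knot l }.

Definition step_fun (R : realType) (d r : nat) (a : R)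
    (phi : step_integrand d r a) (s : R) : 'M[R]_(d, r) :=
  \sum_(k < step_size phi)
    \1_(`]step_knot phi k, step_knot phi k.+1]) s *: step_coef phi k.

Definition step_integral (R : realType) (T : Type) (d r : nat) (a : R)
    (B : R -> T -> 'cV[R]_r) (phi : step_integrand d r a) (w : T) :
    'cV[R]_d :=
  \sum_(k < step_size phi)
    step_coef phi k *m (B (step_knot phi k.+1) w - B (step_knot phi k) w).

(* I is (a version of) the Ito integral \int_0^a sigma dB of a deterministic
   integrand: the L^2(P)-limit of the integrals of step integrands that
   converge to sigma in L^2([0, a]). *)
Definition is_ito_integral (R : realType) (disp : measure_display)
    (T : measurableType disp) (P : probability T R) (d r : nat)
    (B : R -> T -> 'cV[R]_r) (sigma : R -> 'M[R]_(d, r)) (a : R)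
    (I : T -> 'cV[R]_d) : Prop :=
  (forall i : 'I_d, measurable_fun setT (fun w => I w i ord0)) /\
  exists phi : nat -> step_integrand d r a,
    ((\int[lebesgue_measure]_(s in `[0%R, a])
        (frobenius (step_fun (phi n) s - sigma s) ^+ 2)%:E)%E
       @[n --> \oo] --> 0%E) /\
    ('E_P[(fun w => enorm (step_integral B (phi n) w - I w) ^+ 2)%R]%E
       @[n --> \oo] --> 0%E).

(* Y is a continuous adapted solution of
     dY(t) = - Y(t) dt + sigma(t) dB(t), t >= 0,  Y(0) = 0. *)
Definition ou_solution (R : realType) (disp : measure_display)
    (T : measurableType disp) (P : probability T R) (F : R -> set (set T))
    (d r : nat) (B : R -> T -> 'cV[R]_r) (sigma : R -> 'M[R]_(d, r))
    (Y : R -> T -> 'cV[R]_d) : Prop :=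
  [/\ adapted F Y,
      continuous_paths P Y,
      {ae P, forall w, Y 0 w = 0} &
      exists M : R -> T -> 'cV[R]_d,
        (forall t, 0 <= t -> is_ito_integral P B sigma t (M t)) /\
        {ae P, forall w, forall t, 0 <= t -> forall i : 'I_d,
          Y t w i ord0 = Y 0 w i ord0
            - (\int[lebesgue_measure]_(s in `[0, t]) Y s w i ord0)
            + M t w i ord0}].

Definition energy (R : realType) (d r : nat) (sigma : R -> 'M[R]_(d, r))
    (h : R) (n : nat) : R :=
  \int[lebesgue_measure]_(s in `[n%:R * h, n.+1%:R * h])
    (frobenius (sigma s) ^+ 2).

(* A term with energy 0 is 0 because sqrt 0 = 0. *)
Definition S' (R : realType) (d r : nat) (sigma : R -> 'M[R]_(d, r))
    (h eps : R) : \bar R :=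
  (\sum_(1 <= n <oo)
     (Num.sqrt (energy sigma h n) *
      expR (- (eps ^+ 2 / (2 * energy sigma h n))))%:E)%E.

Definition limsup_infty (R : realType) (f : R -> R) : \bar R :=
  limf_esup (fun t => (f t)%:E) (pinfty_nbhs R).

Definition liminf_infty (R : realType) (f : R -> R) : \bar R :=
  limf_einf (fun t => (f t)%:E) (pinfty_nbhs R).

(* Main.v *)
Require Import Defs.
From HB Require Import structures.
From mathcomp Require Import all_boot all_order all_algebra.
From mathcomp Require Import all_classical all_reals all_analysis.
From mathcomp Require Import measurable_realfun lebesgue_measure.
From mathcomp Require Import ring lra.

Set Implicit Arguments.
Unset Strict Implicit.
Unset Printing Implicit Defensive.

Import Order.TTheory GRing.Theory Num.Theory.
Import numFieldNormedType.Exports.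

Local Open Scope classical_set_scope.
Local Open Scope ring_scope.

(** Let I n be the energy of the block [n h, (n + 1) h] and M the stochastic
    integral of sigma, so that each coordinate y of a path satisfies
    y(t) = y(0) - int_0^t y + m(t), with m the same coordinate of M.

    Pathwise, Y and the oscillations of M control each other. If m moves by at
    most del after time a, then |y(t)| <= exp(-(t - a)) |y(a)| + 2 del
    (forced_decay), so that |y| is eventually of the order of the oscillations
    of m in the blocks (eventually_le). Conversely the increment of m over a
    block is at most 2 + h times the supremum of |y| there (increment_le), so
    that a large increment of M makes Y large at some time of the block.

    Up to constants, the probability that M oscillates by more than eps in
    block n, and the conditional probability given the past that it moves by
    more than eps over the block, are both Gaussian tails exp(- C / I n) with C
    proportional to eps^2. Summability of these tails is comparable with
    convergence of S' (S'_lty_gtail, gtail_S'_lty). If S' converges everywhere,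
    the Borel-Cantelli lemma makes the oscillations eventually smaller than any
    eps, which is (A); if it converges at one point, they are eventually
    bounded by a constant, which is the upper bound in (B). If S' diverges at
    some point, the conditional Borel-Cantelli lemma (borel_cantelli2) yields
    infinitely many increments above a constant, which is the lower bound in
    (B); if it diverges everywhere the constant is arbitrary, which is (C).

    For the time average in (B), oscillations above a small eta may occur in
    infinitely many blocks, but some power of their probabilities is summable
    (bad_pow). This suffices for such blocks to have frequency 0 almost surely
    (ae_frequency0). In the other blocks y contracts up to an error of order
    eta, so that its time average is small (time_average), and then y is small
    at arbitrarily late times.

    The Gaussian tails all follow from one identity for the exponential
    moments of Brownian increments given the past (bm_expR). For finite sums of
    increments it gives a maximal inequality (walk_max), and a conditional lower
    bound by the second moment method (walk_gt). To reach M, which is defined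
    at each time as a limit of some step integrals, two step integrals are
    compared on a common refinement of their grids, where their difference is
    again a sum of increments (step_integral_tail). Hence Riemann sums on dyadic
    grids converge in probability to M, and they do so along one and the same
    sequence of processes for all times (ito_riemann), so that both estimates
    pass to M (bad_le, large_increments). *)

(** * Change of variables and Gaussian exponential moments *)

Section change_of_variable.
Import HBNNSimple.

(** A change of variables with weight: the hypothesis says that, up to the
    factor c, the image under V of the measure with density W is the law of
    V2. Indicators are covered by that hypothesis, simple functions by
    linearity, nonnegative functions by monotone convergence. It serves for
    laws with a density (W the density) and for independence (W the product of
    the other factors). *)
Lemma integral_mul_comp d1 d2 (T1 : measurableType d1) (T2 : measurableType d2)
    (R : realType) (mu1 : {measure set T1 -> \bar R})
    (mu2 : {measure set T2 -> \bar R}) (W V : T1 -> R) (V2 : T2 -> R) (f : R -> R) (c : R) :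
  (forall w, 0 <= W w) -> measurable_fun setT W -> measurable_fun setT V ->
  measurable_fun setT V2 ->
  (forall y, 0 <= f y) -> measurable_fun setT f -> 0 <= c ->
  (forall E, measurable E ->
     \int[mu1]_w (W w * \1_E (V w))%:E = c%:E * mu2 (V2 @^-1` E))%E ->
  (\int[mu1]_w (W w * f (V w))%:E = c%:E * \int[mu2]_w (f (V2 w))%:E)%E.
Proof.
move=> W0 mW mV mV2 f0 mf c0 WVE.
have mEf : measurable_fun [set: R] (EFin \o f) by exact/measurable_EFinP.
pose g := nnsfun_approx measurableT mEf.
have gf y : (g n y)%:E @[n --> \oo] --> (f y)%:E.
  by apply: (cvg_nnsfun_approx measurableT mEf) => // x _; rewrite lee_fin.
have mgV n : measurable_fun setT (fun w => g n (V w)) by exact: measurableT_comp.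
have mgV2 n : measurable_fun setT (fun w => g n (V2 w)) by exact: measurableT_comp.
have g0 n y : 0 <= g n y by [].
have ndg y m n : (m <= n)%N -> g m y <= g n y.
  by move=> mn; exact/lefP/nd_nnsfun_approx.
have step n : (\int[mu1]_w (W w * g n (V w))%:E = c%:E * \int[mu2]_w (g n (V2 w))%:E)%E.
  have mpre r : measurable (g n @^-1` [set r]) by exact: measurable_funPTI.
  have mind r : measurable_fun setT (fun w => \1_(g n @^-1` [set r]) (V w) : R).
    by apply: (measurableT_comp (measurable_indic (D:=setT) (mpre r)) mV).
  have mind2 r : measurable_fun setT (fun w => \1_(g n @^-1` [set r]) (V2 w) : R).
    by apply: (measurableT_comp (measurable_indic (D:=setT) (mpre r)) mV2).
  have decW w : ((W w * g n (V w))%:E = \sum_(r \in range (g n))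
      (r * (W w * \1_(g n @^-1` [set r]) (V w)))%:E)%E.
    rewrite {1}fimfunE fsumEFin// fsbig_finite//= fsbig_finite//= mulr_sumr.
    by congr EFin; apply: eq_bigr => i _; rewrite mulrCA.
  have dec1 w : ((g n (V2 w))%:E = \sum_(r \in range (g n))
      (r * (\1_(g n @^-1` [set r]) (V2 w)))%:E)%E.
    by rewrite {1}fimfunE fsumEFin.
  have pos r y : 0 <= r * (\1_(g n @^-1` [set r]) y).
    by have := nnfun_muleindic_ge0 (g n) r y; rewrite -EFinM lee_fin.
  under eq_integral do rewrite decW.
  under [X in _ = (c%:E * X)%E]eq_integral do rewrite dec1.
  rewrite !ge0_integral_fsum//; last 4 first.
  - by move=> r; apply/measurable_EFinP; exact: measurable_funM.
  - by move=> r x _; rewrite lee_fin.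
  - move=> r; apply/measurable_EFinP; apply: measurable_funM => //.
    exact: measurable_funM.
  - by move=> r x _; rewrite lee_fin mulrCA mulr_ge0// ?pos//.
  rewrite ge0_mule_fsumr; last first.
    by move=> r; apply: integral_ge0 => w _; rewrite lee_fin pos.
  apply: eq_fsbigr => r /[!inE]-[y _ <-].
  have E1 : (\int[mu2]_w (g n y * \1_(g n @^-1` [set g n y]) (V2 w))%:E =
    (g n y)%:E * mu2 (V2 @^-1` (g n @^-1` [set g n y])))%E.
    under eq_integral do rewrite EFinM.
    rewrite ge0_integralZl//; last 2 first.
    - exact/measurable_EFinP.
    - by rewrite lee_fin.
    have -> : (fun w => (\1_(g n @^-1` [set g n y]) (V2 w))%:E) =
       (fun w => (\1_(V2 @^-1` (g n @^-1` [set g n y])) w)%:E :> \bar R).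
      by apply/funext => w; rewrite !indicE.
    by rewrite integral_indic ?setIT// -[X in measurable X]setTI; exact: mV2.
  rewrite E1.
  under eq_integral do rewrite EFinM.
  rewrite ge0_integralZl//; last 3 first.
  - by apply/measurable_EFinP; exact: measurable_funM.
  - by move=> w _; rewrite lee_fin mulr_ge0.
  - by rewrite lee_fin.
  by rewrite WVE// muleCA.
have cW : (\int[mu1]_w (W w * g n (V w))%:E)%E @[n --> \oo] -->
    (\int[mu1]_w (W w * f (V w))%:E)%E.
  have -> : (\int[mu1]_w (W w * f (V w))%:E = \int[mu1]_w limn (fun n => (W w * g n (V w))%:E))%E.
    apply: eq_integral => w _; apply/esym/cvg_lim => //.
    have : ((W w)%:E * (g n (V w))%:E)%E @[n --> \oo] --> ((W w)%:E * (f (V w))%:E)%E.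
      exact: cvgeZl.
    exact.
  apply: cvg_monotone_convergence => //.
  - by move=> n; apply/measurable_EFinP; apply: measurable_funM.
  - by move=> n w _; rewrite lee_fin mulr_ge0.
  - by move=> w _ m n mn; rewrite lee_fin ler_wpM2l// ndg.
have cV : (\int[mu2]_w (g n (V2 w))%:E)%E @[n --> \oo] -->
    (\int[mu2]_w (f (V2 w))%:E)%E.
  have -> : (\int[mu2]_w (f (V2 w))%:E = \int[mu2]_w limn (fun n => (g n (V2 w))%:E))%E.
    by apply: eq_integral => w _; apply/esym/cvg_lim.
  apply: cvg_monotone_convergence => //.
  - by move=> n; apply/measurable_EFinP.
  - by move=> n w _; rewrite lee_fin.
  - by move=> w _ m n mn; rewrite lee_fin ndg.
rewrite -(cvg_lim _ cW)//; under eq_fun do rewrite step.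
by apply/cvg_lim => //; apply: cvgeZl.
Qed.
End change_of_variable.

(** Completing the square: multiplying the centred normal density by exp(c y)
    gives, up to a constant factor, the density with mean c s^2. *)
Lemma integral_expR_normal (R : realType) d (T : measurableType d)
    (P : probability T R) (X : T -> R) (s c : R) :
  0 < s -> measurable_fun setT X ->
  (forall E, measurable E -> P (X @^-1` E) = normal_prob 0 s E) ->
  (\int[P]_w (expR (c * X w))%:E = (expR (c ^+ 2 * s ^+ 2 / 2))%:E)%E.
Proof.
move=> s0 mX PX; have sn0 : s != 0 by rewrite gt_eqF.
have mexp : measurable_fun setT (fun y : R => expR (c * y)).
  by apply: measurableT_comp => //; exact: measurable_funM.
have := @integral_mul_comp _ _ _ _ R (@lebesgue_measure R) P
  (normal_pdf 0 s) id X (fun y => expR (c * y)) 1.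
rewrite mul1e => <- //; last 3 first.
- by move=> y; exact: normal_pdf_ge0.
- exact: measurable_normal_pdf.
- move=> E mE; rewrite mul1e; transitivity (normal_prob 0 s E); last exact/esym/PX.
  rewrite /normal_prob [RHS]integral_mkcond.
  apply: eq_integral => y _; rewrite patchE /=; case: ifPn => yE.
    by rewrite indicE yE mulr1.
  by rewrite indicE (negbTE yE) mulr0.
have -> : (fun y : R => (normal_pdf 0 s y * expR (c * y))%:E) =
    (fun y => (expR (c ^+ 2 * s ^+ 2 / 2))%:E *
              (normal_pdf (c * s ^+ 2) s y)%:E)%E.
  apply/funext => y; rewrite !normal_pdfE// -EFinM; congr EFin.
  rewrite /normal_fun -[LHS]mulrA -expRD [RHS]mulrCA -expRD; congr (_ * expR _).
  by field.
rewrite ge0_integralZl//; last 2 first.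
- by apply/measurable_EFinP; exact: measurable_normal_pdf.
- by move=> y _; rewrite lee_fin normal_pdf_ge0.
by rewrite integral_normal_pdf mule1.
Qed.

(** * Exponential moments of Brownian increments *)

Section independence.
Context d (T : measurableType d) (R : realType) (P : probability T R).

(** Independence is known for boxes only. Its extension to products of
    functions replaces one indicator at a time by an arbitrary nonnegative
    function, which is a change of variables weighted by all the other
    factors. *)
Lemma integral_prod_family (r : nat) (V : 'I_r -> T -> R) (A : set T) :
  measurable A -> (forall j, measurable_fun setT (V j)) ->
  (forall E : 'I_r -> set R, (forall j, measurable (E j)) ->
    P (A `&` [set w | forall j, E j (V j w)]) =
      (P A * \prod_(j < r) P (V j @^-1` E j))%E) ->
  forall (f : 'I_r -> R -> R) (m : 'I_r -> R),
  (forall j, measurable_fun setT (f j)) -> (forall j y, 0 <= f j y) ->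
  (forall j, \int[P]_w (f j (V j w))%:E = (m j)%:E)%E ->
  (\int[P]_w (\1_A w * \prod_(j < r) f j (V j w))%:E =
    P A * (\prod_(j < r) m j)%:E)%E.
Proof.
move=> mA mV indep.
(* The factors with index outside s are still indicators. *)
suff H (s : seq 'I_r) : uniq s -> forall (f : 'I_r -> R -> R) (m : 'I_r -> R),
  (forall j, measurable_fun setT (f j)) -> (forall j y, 0 <= f j y) ->
  (forall j, \int[P]_w (f j (V j w))%:E = (m j)%:E)%E ->
  (forall j, j \notin s -> exists2 E, measurable E & f j = \1_E) ->
  (\int[P]_w (\1_A w * \prod_(j < r) f j (V j w))%:E =
    P A * (\prod_(j < r) m j)%:E)%E.
  move=> f m mf f0 fm; apply: (H (enum 'I_r)) => //; first exact: enum_uniq.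
  by move=> j; rewrite mem_enum.
elim: s => [_|k s IH /andP[ks us]] f m mf f0 fm fE.
  have /choice[E EP] : forall j, exists E, measurable E /\ f j = \1_E.
    by move=> j; have [//|E mE ->] := fE j; exists E.
  have mE j : measurable (E j) by have [] := EP j.
  have -> : (fun w => (\1_A w * \prod_(j < r) f j (V j w))%:E) =
     (fun w => (\1_(A `&` [set w | forall j, E j (V j w)]) w)%:E : \bar R).
    apply/funext => w; congr EFin; rewrite indicI /=; congr (_ * _).
    rewrite indicE; case: (boolP (w \in _)) => [/set_mem/= wE|wE].
      by rewrite big1// => j _; have [_ ->] := EP j; rewrite indicE mem_set.
    have [j wj] : exists j, ~ E j (V j w).
      by apply/existsNP; apply: contraNnot wE => ?; rewrite inE.
    rewrite (bigD1 j)//=; have [_ ->] := EP j.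
    by rewrite indicE memNset// mul0r.
  have mbox : measurable [set w | forall j, E j (V j w)].
    rewrite (_ : [set w | _] = \bigcap_(j in [set: 'I_r]) (V j @^-1` E j)); last first.
      by apply/seteqP; split => w /= => [wE j _|wE j]; exact: wE.
    apply: fin_bigcap_measurable => // j _.
    by rewrite -[X in measurable X]setTI; exact: mV.
  rewrite integral_indic//; last exact: measurableI.
  rewrite setIT; transitivity (P A * \prod_(j < r) P (V j @^-1` E j))%E.
    exact: indep.
  rewrite -prodEFin; congr (_ * _)%E.
  apply: eq_bigr => j _; rewrite -fm; have [_ ->] := EP j.
  rewrite (_ : (fun w => _) = (fun w => (\1_(V j @^-1` E j) w)%:E)).
    by rewrite integral_indic ?setIT// -[X in measurable X]setTI; exact: mV.
  by apply/funext => w; rewrite !indicE.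
have mfV j : measurable_fun setT (fun w => f j (V j w)) by exact: measurableT_comp.
under eq_integral do rewrite (bigD1 k)//= mulrCA mulrC.
rewrite [in RHS](bigD1 k)//= mulrC EFinM muleA -(fm k).
have fP : P A = (fine (P A))%:E by rewrite fineK// fin_num_measure.
have m0 j : 0 <= m j.
  by rewrite -lee_fin -fm; apply: integral_ge0 => w _; rewrite lee_fin.
rewrite fP -EFinM; apply: integral_mul_comp => //.
- by move=> w; rewrite mulr_ge0// prodr_ge0.
- apply: measurable_funM => //; under eq_fun do rewrite big_mkcond.
  apply: (@measurable_prod _ _ _ _ _ _
    (fun i x => if i != k then f i (V i x) else 1)) => j _.
  by case: (j != k).
- by rewrite mulr_ge0 ?fine_ge0// prodr_ge0.
move=> E mE.
pose f' j := if j == k then \1_E else f j.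
pose m' j := if j == k then fine (P (V k @^-1` E)) else m j.
have f'k : f' k = \1_E by rewrite /f' eqxx.
have f'j j : j != k -> f' j = f j by rewrite /f' => /negbTE ->.
have mVE : measurable (V k @^-1` E) by rewrite -[X in measurable X]setTI; exact: mV.
transitivity (\int[P]_w (\1_A w * \prod_(j < r) f' j (V j w))%:E)%E.
  apply: eq_integral => w _; congr EFin; rewrite [in RHS](bigD1 k)//= f'k [RHS]mulrCA mulrC.
  by congr (_ * (_ * _)); apply: eq_bigr => j jk; rewrite f'j.
rewrite (IH us f' m').
- rewrite (bigD1 k)//= {1}/m' eqxx (eq_bigr m); last first.
    by move=> j jk; rewrite /m' (negbTE jk).
  rewrite EFinM fineK ?fin_num_measure//.
  by rewrite fP EFinM -muleA; congr (_ * _)%E; rewrite muleC.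
- by move=> j; rewrite /f'; case: ifP.
- by move=> j y; rewrite /f'; case: ifP.
- move=> j; rewrite /f' /m'; case: ifPn => [/eqP ->|_]; last exact: fm.
  rewrite (_ : (fun w => _) = (fun w => (\1_(V k @^-1` E) w)%:E)).
    by rewrite integral_indic ?setIT// fineK// fin_num_measure.
  by apply/funext => w; rewrite !indicE.
- move=> j js; rewrite /f'; case: ifPn => [_|jk]; first by exists E.
  by apply: fE; rewrite inE negb_or jk.
Qed.

End independence.

Section exponential_moments.
Context d (T : measurableType d) (R : realType) (P : probability T R).
Context (F : R -> set (set T)) (r : nat) (B : R -> T -> 'cV[R]_r).
Hypothesis hF : filtration F.
Hypothesis hB : brownian_motion P F B.

(** Formulated through a generated sigma-algebra so that measurability is
    preserved by sums, products and compositions as for any measurable space. *)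
Definition Fmeasurable (t : R) (U : T -> R) :=
  measurable_fun [set: g_sigma_algebraType (F t)]
    (U : g_sigma_algebraType (F t) -> R).

Lemma Fmeasurable_preimage t U E : 0 <= t -> Fmeasurable t U -> measurable E ->
  F t (U @^-1` E).
Proof.
move=> t0 mU mE; have [sF _ _] := hF.
have := mU measurableT _ mE; rewrite setTI.
by rewrite /measurable/= sigma_algebra_id//; exact: sF.
Qed.

Lemma preimage_Fmeasurable t U : 0 <= t ->
  (forall E, measurable E -> F t (U @^-1` E)) -> Fmeasurable t U.
Proof.
move=> t0 mU _ E mE; rewrite setTI; have [sF _ _] := hF.
by apply: sub_sigma_algebra; exact: mU.
Qed.

Lemma Fmeasurable_le s t U : 0 <= s -> s <= t ->
  Fmeasurable s U -> Fmeasurable t U.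
Proof.
move=> s0 st mU; have [_ _ hm] := hF.
apply: preimage_Fmeasurable => [|E mE]; first exact: le_trans st.
by apply: hm st _ _ => //; exact: Fmeasurable_preimage.
Qed.

Lemma Fmeasurable_fun t U : 0 <= t -> Fmeasurable t U -> measurable_fun setT U.
Proof.
move=> t0 mU _ E mE; rewrite setTI; have [_ hm _] := hF.
by apply: (hm t) => //; exact: Fmeasurable_preimage.
Qed.

Lemma measurable_F t A : 0 <= t -> F t A -> measurable A.
Proof. by move=> t0; have [_ hm _] := hF; exact: hm. Qed.

Lemma Fmeasurable_indic t A : 0 <= t -> F t A -> Fmeasurable t \1_A.
Proof. by move=> t0 FA; apply: measurable_indic; exact: sub_sigma_algebra. Qed.

Lemma Fmeasurable_lin (c : 'I_r -> R) s t : 0 <= s -> s <= t ->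
  Fmeasurable t (fun w => \sum_j c j * (B t w - B s w) j ord0).
Proof.
move=> s0 st; have t0 := le_trans s0 st.
apply: measurable_sum => j _; apply: measurable_funM => //.
under eq_fun do rewrite 2!mxE.
have Bm := bm_adapted hB.
have BF u : 0 <= u -> Fmeasurable u (fun w => B u w j ord0).
  by move=> u0; apply: preimage_Fmeasurable => // E mE; exact: Bm.
apply: measurable_funB; first exact: BF.
by apply: Fmeasurable_le st _ => //; exact: BF.
Qed.

(** Given the past, a linear combination of the increments of a Brownian
    motion has the exponential moments of a centred Gaussian variable. Every
    probability estimate of the proof comes from this identity, applied with a
    suitable nonnegative weight U. *)
Lemma bm_expR (th : R) (c : 'I_r -> R) s t U : 0 <= s -> s <= t ->
  (forall w, 0 <= U w) -> Fmeasurable s U ->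
  (\int[P]_w (U w * expR (th * \sum_j c j * (B t w - B s w) j ord0))%:E =
   (\int[P]_w (U w)%:E) *
     (expR (th ^+ 2 * ((\sum_j c j ^+ 2) * (t - s)) / 2))%:E)%E.
Proof.
move=> s0; rewrite le_eqVlt => /predU1P[<- U0 mU|st U0 mU].
  rewrite subrr mulr0 mulr0 mul0r expR0 mule1; apply: eq_integral => w _.
  by rewrite subrr big1 ?mulr0 ?expR0 ?mulr1// => j _; rewrite mxE mulr0.
have t0 : 0 <= t by rewrite (le_trans s0)// ltW.
pose V j w := (B t w - B s w) j ord0.
have mV j : measurable_fun setT (V j).
  have /(Fmeasurable_fun t0) := Fmeasurable_lin (fun i => (i == j)%:R) s0 (ltW st).
  congr measurable_fun; apply/funext => w.
  rewrite (bigD1 j)//= eqxx mul1r big1 ?addr0// => i /negbTE ->.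
  by rewrite mul0r.
pose f j y := expR (th * c j * y).
pose m j := expR ((th * c j) ^+ 2 * Num.sqrt (t - s) ^+ 2 / 2).
have mf j : measurable_fun setT (f j).
  by apply: measurableT_comp => //; exact: measurable_funM.
have fm j : (\int[P]_w (f j (V j w))%:E = (m j)%:E)%E.
  apply: integral_expR_normal => //; first by rewrite sqrtr_gt0 subr_gt0.
  by move=> E mE; exact: (bm_gaussian hB).
have prodf w : \prod_(j < r) f j (V j w) =
    expR (th * \sum_j c j * (B t w - B s w) j ord0).
  rewrite mulr_sumr expR_sum; apply: eq_bigr => j _.
  by rewrite /f mulrA.
have prodm : \prod_(j < r) m j =
    expR (th ^+ 2 * ((\sum_j c j ^+ 2) * (t - s)) / 2).
  rewrite mulr_suml mulr_sumr mulr_suml expR_sum; apply: eq_bigr => j _.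
  by rewrite /m sqr_sqrtr ?subr_ge0 ?ltW// exprMn !mulrA.
have mpf : measurable_fun setT (fun w => \prod_(j < r) f j (V j w)).
  by apply: measurable_prod => j _; exact: measurableT_comp.
have mUT : measurable_fun setT U by exact: Fmeasurable_fun mU.
under eq_integral => w _ do rewrite -prodf mulrC -[X in _ * X]ger0_norm//.
under [in X in _ = X]eq_integral => w _ do rewrite -[X in X%:E]ger0_norm//.
rewrite -prodm muleC; apply: (integral_mul_comp (mu2 := P)) => //.
- by move=> w; apply: prodr_ge0 => j _; exact: expR_ge0.
- by apply: prodr_ge0 => j _; exact: expR_ge0.
move=> E mE; have FA := Fmeasurable_preimage s0 mU mE.
transitivity (\int[P]_w (\1_(U @^-1` E) w * \prod_(j < r) f j (V j w))%:E)%E.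
  by apply: eq_integral => w _; rewrite mulrC !indicE.
rewrite (@integral_prod_family _ _ _ P r V _ _ mV _ f m)//; last 3 first.
- exact: measurable_F FA.
- move=> E' mE'; have := bm_increments hB s0 st FA mE'.
  by have := bm_components hB s0 st mE' => ->.
- by move=> j y; exact: expR_ge0.
by rewrite muleC.
Qed.

End exponential_moments.

(** * Weighted sums of Brownian increments *)

Lemma measurable_gt d (T : measurableType d) (R : realType) (a : R) (f : T -> R) :
  measurable_fun setT f -> measurable [set w | a < f w].
Proof.
move=> mf; rewrite (_ : [set w | _] = f @^-1` `]a, +oo[).
  by rewrite -[X in measurable X]setTI; exact: mf.
by apply/seteqP; split => w /=; rewrite in_itv/= andbT.
Qed.

Lemma measurable_exists_leq d (T : measurableType d) (K : nat) (A : nat -> set T) :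
  (forall k, measurable (A k)) -> measurable [set w | exists2 k, (k <= K)%N & A k w].
Proof.
move=> mA; rewrite (_ : [set w | _] = \bigcup_(k in `I_K.+1) A k).
  by apply: bigcup_measurable => k _; exact: mA.
by apply/seteqP; split=> w /= [k kK Ak]; exists k.
Qed.

Lemma markov_gt d (T : measurableType d) (R : realType)
    (mu : {measure set T -> \bar R}) (a : R) (f : T -> R) :
  0 < a -> measurable_fun setT f -> (forall w, 0 <= f w) ->
  (a%:E * mu [set w | (a < f w)%R]%classic <= \int[mu]_w (f w)%:E)%E.
Proof.
move=> a0 mf f0; have mA : measurable [set w | a < f w] by exact: measurable_gt.
apply: (@le_trans _ _ (\int[mu]_w (a%:E * (\1_[set w | a < f w] w)%:E))%E).
  rewrite ge0_integralZl//; last 2 first.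
  - by apply/measurable_EFinP; exact: measurable_indic.
  - by rewrite lee_fin ltW.
  by rewrite integral_indic// setIT.
apply: ge0_le_integral => //.
- by move=> w _; rewrite -EFinM lee_fin mulr_ge0// ltW.
- by apply: measurable_funeM; apply/measurable_EFinP; exact: measurable_indic.
- exact/measurable_EFinP.
move=> w _; rewrite -EFinM lee_fin indicE.
by case: (boolP (w \in _)) => [/set_mem/= /ltW|_]; rewrite ?mulr1 ?mulr0.
Qed.

Section discrete_process.
Context d (T : measurableType d) (R : realType) (P : probability T R).
Context (F : R -> set (set T)) (r : nat) (B : R -> T -> 'cV[R]_r).
Hypothesis hF : filtration F.
Hypothesis hB : brownian_motion P F B.
Context (u : nat -> R) (c : nat -> 'I_r -> R).
Hypothesis u0 : 0 <= u 0%N.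
Hypothesis u_le : forall k, u k <= u k.+1.

Definition increment k w := \sum_j c k j * (B (u k.+1) w - B (u k) w) j ord0.
Definition walk K w := \sum_(k < K) increment k w.
Definition walk_variance K := \sum_(k < K) (\sum_j c k j ^+ 2) * (u k.+1 - u k).

Lemma u_ge0 k : 0 <= u k.
Proof. by elim: k => [//|k /le_trans]; apply. Qed.

Lemma step_variance_ge0 k : 0 <= (\sum_j c k j ^+ 2) * (u k.+1 - u k).
Proof.
by rewrite mulr_ge0// ?subr_ge0// sumr_ge0// => j _; exact: sqr_ge0.
Qed.

Lemma Fmeasurable_walk K : Fmeasurable F (u K) (walk K).
Proof.
elim: K => [|K IH]; rewrite /walk.
  by under eq_fun do rewrite big_ord0; exact: measurable_cst.
under eq_fun do rewrite big_ord_recr /=.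
apply: measurable_funD; last by apply: (Fmeasurable_lin hF hB) => //; exact: u_ge0.
by apply: (Fmeasurable_le hF _ (u_le K)) => //; exact: u_ge0.
Qed.

(** The increments are integrated out one by one, from the last to the first. *)
Lemma walk_expR (th : R) K U : (forall w, 0 <= U w) -> Fmeasurable F (u 0%N) U ->
  (\int[P]_w (U w * expR (th * walk K w))%:E =
   (\int[P]_w (U w)%:E) * (expR (th ^+ 2 * walk_variance K / 2))%:E)%E.
Proof.
move=> U0 mU; elim: K => [|K IH].
  rewrite /walk_variance big_ord0 mulr0 mul0r expR0 mule1; apply: eq_integral => w _.
  by rewrite /walk big_ord0 mulr0 expR0 mulr1.
under eq_integral do rewrite /walk big_ord_recr /= mulrDr expRD mulrA.
rewrite /walk_variance big_ord_recr /= mulrDr mulrDl expRD EFinM muleA -IH.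
apply: (bm_expR hF hB) => //; first exact: u_ge0.
  by move=> w; rewrite mulr_ge0// expR_ge0.
apply: measurable_funM.
  apply: Fmeasurable_le mU => //; elim: (K) => // n /le_trans; exact.
apply: measurableT_comp => //; apply: measurable_funM => //.
exact: Fmeasurable_walk.
Qed.

Lemma measurable_walk K : measurable_fun setT (walk K).
Proof. by apply: (Fmeasurable_fun hF (u_ge0 K)); exact: Fmeasurable_walk. Qed.

(** Doob's maximal inequality for the exponential of the walk. The exponential
    is frozen when it first exceeds a = exp(th * eps); freezing replaces a
    factor of conditional mean at least 1 by the factor 1, so the frozen
    process still has mean at most exp(th^2 * walk_variance K / 2), and Markov's
    inequality applies to it. *)
Lemma walk_max (th eps : R) K : 0 < th ->
  (P [set w | exists2 k, (k <= K)%N & (eps < walk k w)%R]%classic <=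
   (expR (th ^+ 2 * walk_variance K / 2 - th * eps))%:E)%E.
Proof.
move=> th0; pose a := expR (th * eps); have a0 : 0 < a by exact: expR_gt0.
(* exp(th * walk k), frozen once it exceeds a. *)
pose D := fix D k w : R := if k is k'.+1 then
  (if a < D k' w then D k' w else D k' w * expR (th * increment k' w)) else 1.
have D0 k w : 0 <= D k w.
  by elim: k => [|k IH] //=; case: ifPn => // _; rewrite mulr_ge0// expR_ge0.
have minc k : Fmeasurable F (u k.+1) (increment k).
  by apply: (Fmeasurable_lin hF hB) => //; exact: u_ge0.
have mD k : Fmeasurable F (u k) (D k).
  elim: k => [|k IH]; first exact: measurable_cst.
  have IH' := Fmeasurable_le hF (u_ge0 k) (u_le k) IH.
  apply: measurable_fun_ifT => //.
    by apply: measurable_fun_ltr => //; exact: measurable_cst.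
  apply: measurable_funM => //; apply: measurableT_comp => //.
  by apply: measurable_funM => //; exact: minc.
have mDT k : measurable_fun setT (D k) by exact: (Fmeasurable_fun hF (u_ge0 k)).
have ID k : (\int[P]_w (D k w)%:E <= (expR (th ^+ 2 * walk_variance k / 2))%:E)%E.
  elim: k => [|k IH].
    rewrite /= /walk_variance big_ord0 mulr0 mul0r expR0.
    by rewrite integral_cst//= probability_setT mul1e.
  pose U w : R := if a < D k w then 0 else D k w.
  pose U' w : R := if a < D k w then D k w else 0.
  have mU : Fmeasurable F (u k) U.
    apply: measurable_fun_ifT; last 2 first.
    - exact: measurable_cst.
    - exact: mD.
    by apply: measurable_fun_ltr; [exact: measurable_cst|exact: mD].
  have mU' : Fmeasurable F (u k) U'.
    apply: measurable_fun_ifT; last 2 first.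
    - exact: mD.
    - exact: measurable_cst.
    by apply: measurable_fun_ltr; [exact: measurable_cst|exact: mD].
  have U0 w : 0 <= U w by rewrite /U; case: ifP.
  have U'0 w : 0 <= U' w by rewrite /U'; case: ifP.
  have mUT := Fmeasurable_fun hF (u_ge0 k) mU.
  have mU'T := Fmeasurable_fun hF (u_ge0 k) mU'.
  have minT := Fmeasurable_fun hF (u_ge0 k.+1) (minc k).
  have meT : measurable_fun setT (fun w => U w * expR (th * increment k w)).
    apply: measurable_funM => //; apply: measurableT_comp => //.
    exact: measurable_funM.
  have DE : (\int[P]_w (D k.+1 w)%:E = \int[P]_w (U' w)%:E +
      (\int[P]_w (U w)%:E) *
      (expR (th ^+ 2 * ((\sum_j c k j ^+ 2) * (u k.+1 - u k)) / 2))%:E)%E.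
    rewrite -(bm_expR hF hB)//; last exact: u_ge0.
    rewrite -ge0_integralD//; last 4 first.
    - by move=> w _; rewrite lee_fin.
    - exact/measurable_EFinP.
    - by move=> w _; rewrite lee_fin mulr_ge0// expR_ge0.
    - exact/measurable_EFinP.
    apply: eq_integral => w _; rewrite -EFinD /U /U' /=; congr EFin.
    by case: ifP => _; rewrite ?mul0r ?addr0 ?add0r.
  have DU : (\int[P]_w (D k w)%:E = \int[P]_w (U' w)%:E + \int[P]_w (U w)%:E)%E.
    rewrite -ge0_integralD//; last 4 first.
    - by move=> w _; rewrite lee_fin.
    - exact/measurable_EFinP.
    - by move=> w _; rewrite lee_fin.
    - exact/measurable_EFinP.
    apply: eq_integral => w _; rewrite -EFinD /U /U' /=; congr EFin.
    by case: ifP => _; rewrite ?addr0 ?add0r.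
  rewrite DE {DE}; set g' := expR (_ / 2).
  have -> : expR (th ^+ 2 * walk_variance k.+1 / 2) = expR (th ^+ 2 * walk_variance k / 2) * g'.
    by rewrite -expRD /walk_variance big_ord_recr /= -mulrDl -mulrDr.
  rewrite EFinM.
  apply: (@le_trans _ _ ((\int[P]_w (D k w)%:E) * g'%:E)%E); last first.
    by rewrite lee_wpmul2r// lee_fin expR_ge0.
  have IU : (0 <= \int[P]_w (U w)%:E)%E.
    by apply: integral_ge0 => w _; rewrite lee_fin.
  have IU' : (0 <= \int[P]_w (U' w)%:E)%E.
    by apply: integral_ge0 => w _; rewrite lee_fin.
  rewrite DU; move: IU IU'.
  move: (\int[P]_w (U w)%:E)%E (\int[P]_w (U' w)%:E)%E => x y x0 y0.
  rewrite ge0_muleDl//.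
  rewrite leeD2r// lee_pemulr//.
  rewrite lee_fin -expR0 ler_expR divr_ge0// mulr_ge0 ?sqr_ge0//.
  exact: step_variance_ge0.
(* Either D is frozen above a, or the walk has not exceeded eps so far. *)
have DX k w : a < D k w \/
    D k w = expR (th * walk k w) /\ forall l, (l <= k)%N -> walk l w <= eps.
  have aE l : (a < expR (th * walk l w)) = (eps < walk l w).
    by rewrite /a ltr_expR ltr_pM2l.
  elim: k => [|k [IH|[IH IHl]]].
  - rewrite /=; have := aE 0%N; rewrite {1}/walk big_ord0 mulr0 expR0.
    move=> a1; have [lt|ge] := ltP a 1; first by left.
    right; split; first by rewrite /walk big_ord0 mulr0 expR0.
    by move=> l; rewrite leqn0 => /eqP ->; rewrite leNgt -a1 -leNgt.
  - by left => /=; rewrite IH.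
  have wE : expR (th * walk k.+1 w) = D k w * expR (th * increment k w).
    by rewrite /walk big_ord_recr /= mulrDr expRD IH.
  have ak : (a < D k w) = false by rewrite IH aE ltNge IHl.
  rewrite /= ak -wE aE; have [lt|ge] := ltP eps; first by left.
  by right; split=> // l; rewrite leq_eqVlt ltnS => /predU1P[->//|/IHl].
have mset : measurable [set w | a < D K w] by exact: measurable_gt.
have mwalk : measurable [set w | exists2 k, (k <= K)%N & eps < walk k w].
  apply: (measurable_exists_leq K (A := fun k => [set w | eps < walk k w])) => k.
  by apply: measurable_gt; exact: measurable_walk.
apply: (@le_trans _ _ (P [set w | a < D K w])).
  apply: le_measure; rewrite ?inE// => w /= [k kK ek].
  have [//|[_ /(_ _ kK)]] := DX K w.
  by rewrite leNgt ek.
rewrite expRD expRN -/a EFinM lee_pdivlMr//.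
apply: le_trans (ID K).
rewrite muleC; exact: markov_gt.
Qed.

(** A lower bound for the tail given an event A of the past, by the second
    moment method of Paley and Zygmund applied to Z = exp(th * walk K): its
    mean is g and its second moment g^4, so Z exceeds g / 2 with probability
    at least of order g^-2; and for th large enough this forces the walk above
    eps. *)
Lemma walk_gt (eps : R) K (A : set T) : 0 < eps -> 0 < walk_variance K -> F (u 0%N) A ->
  (P A * (expR (- (8 * eps ^+ 2 / walk_variance K + 8)) / 4)%:E <=
   P (A `&` [set w | (eps < walk K w)%R]%classic))%E.
Proof.
move=> e0 q0 FA; have mA := measurable_F hF u0 FA.
set q := walk_variance K in q0 *.
have [s s0 qE] : exists2 s : R, 0 < s & q = s ^+ 2.
  by exists (Num.sqrt q); rewrite ?sqrtr_gt0// sqr_sqrtr// ltW.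
(* With s^2 the variance of the walk, th^2 * s^2 / 2 exceeds th * eps by 2 eps
   / s + 2, and 1 of it pays for the factor 2 in Z > g / 2. *)
pose th := 2 * (eps / s ^+ 2 + s^-1).
have th0 : 0 < th.
  by rewrite mulr_gt0// addr_gt0 ?invr_gt0// divr_gt0// exprn_gt0.
pose g := expR (th ^+ 2 * q / 2); have g0 : 0 < g by exact: expR_gt0.
have mXK : measurable_fun setT (walk K) by exact: measurable_walk.
pose Z t w := \1_A w * expR (t * walk K w).
have mZ t : measurable_fun setT (Z t).
  apply: measurable_funM; first exact: measurable_indic.
  by apply: measurableT_comp => //; exact: measurable_funM.
have Z0 t w : 0 <= Z t w by rewrite mulr_ge0// expR_ge0.
have FI : Fmeasurable F (u 0%N) \1_A by exact: Fmeasurable_indic.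
have IA : (\int[P]_w (\1_A w)%:E = P A)%E by rewrite integral_indic// setIT.
have IZ t : (\int[P]_w (Z t w)%:E = P A * (expR (t ^+ 2 * q / 2))%:E)%E.
  by rewrite walk_expR// IA.
have sub w : g / 2 < expR (th * walk K w) -> eps < walk K w.
  move=> gZ; rewrite ltNge; apply/negP => Xe; move: gZ; apply/negP.
  rewrite -leNgt ler_pdivlMr//.
  have e2 : (2 : R) <= expR 1 by have := expR_ge1Dx (1 : R).
  apply: (@le_trans _ _ (expR (th * eps) * expR 1)).
    by apply: ler_pM => //; rewrite ?expR_ge0// ler_expR ler_pM2l.
  rewrite -expRD ler_expR.
  have -> : th ^+ 2 * q / 2 = th * eps + 2 * (eps / s) + 2.
    by rewrite /th qE; field; rewrite gt_eqF.
  have : 0 <= eps / s by rewrite divr_ge0// ltW.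
  by lra.
(* The weight in the inequality y <= al / 2 * y^2 + 1 / (2 * al), which
   replaces Cauchy-Schwarz; this one makes the quadratic term equal to a
   quarter of P A * g. *)
pose al := (2 * g ^+ 3)^-1; have al0 : 0 < al.
  by rewrite invr_gt0 mulr_gt0// exprn_gt0.
pose G := A `&` [set w | eps < walk K w].
have mG : measurable G by apply: measurableI => //; exact: measurable_gt.
have pw w : Z th w <= g / 2 * \1_A w + (al / 2 * Z (2 * th) w + (2 * al)^-1 * \1_G w).
  rewrite /Z /G indicI /=; have [wA|wA] := boolP (w \in A); last first.
    by rewrite indicE (negbTE wA) !mul0r !mulr0 !add0r.
  rewrite [\1_A w]indicE wA !mul1r mulr1 indicE.
  have -> : expR (2 * th * walk K w) = expR (th * walk K w) ^+ 2.
    by rewrite expr2 -expRD; congr expR; ring.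
  have y0 := expR_gt0 (th * walk K w).
  have [lt|ge] := ltP (g / 2) (expR (th * walk K w)); last first.
    apply: (le_trans ge); rewrite lerDl addr_ge0// mulr_ge0//.
    - by rewrite divr_ge0// ltW.
    - by rewrite invr_ge0 mulr_ge0// ltW.
  rewrite mem_set; last exact: sub.
  rewrite mulr1; move: (expR _) y0 {lt} => y y0.
  apply: (@le_trans _ _ (al / 2 * y ^+ 2 + (2 * al)^-1)); last first.
    by rewrite lerDr divr_ge0// ltW.
  rewrite -subr_ge0.
  have -> : al / 2 * y ^+ 2 + (2 * al)^-1 - y = (al * y - 1) ^+ 2 / (2 * al).
    by field; rewrite gt_eqF.
  by rewrite divr_ge0 ?sqr_ge0// mulr_ge0// ltW.
have : (\int[P]_w (Z th w)%:E <= (g / 2)%:E * P A +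
    ((al / 2)%:E * \int[P]_w (Z (2 * th) w)%:E + ((2 * al)^-1)%:E * P G))%E.
  have c1 : 0 <= g / 2 by rewrite divr_ge0// ltW.
  have c2 : 0 <= al / 2 by rewrite divr_ge0// ltW.
  have c3 : 0 <= (2 * al)^-1 by rewrite invr_ge0 mulr_ge0// ltW.
  have mi (B' : set T) : measurable B' -> measurable_fun setT (fun w => (\1_B' w)%:E : \bar R).
    by move=> mB; apply/measurable_EFinP; exact: measurable_indic.
  have -> : P G = (\int[P]_w (\1_G w)%:E)%E by rewrite integral_indic// setIT.
  rewrite -IA -!ge0_integralZl//; try (by move=> w _; rewrite lee_fin);
    try exact: mi; try exact/measurable_EFinP.
  have mZe t : measurable_fun setT (fun w => (Z t w)%:E).
    exact/measurable_EFinP.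
  rewrite -!ge0_integralD//; try (by move=> w _; rewrite ?adde_ge0// mule_ge0// lee_fin);
    try (by do ?apply: emeasurable_funD => //; apply: measurable_funeM => //; exact: mi).
  apply: ge0_le_integral => //.
  - by move=> w _; rewrite lee_fin.
  - apply: emeasurable_funD; first by apply: measurable_funeM; exact: mi.
    apply: emeasurable_funD; first by apply: measurable_funeM.
    by apply: measurable_funeM; exact: mi.
  - by move=> w _; rewrite -!EFinM -!EFinD lee_fin.
rewrite !IZ -/G -/g.
have -> : expR ((2 * th) ^+ 2 * q / 2) = g ^+ 4.
  by rewrite /g -expRM_natl; congr expR; rewrite -mulr_natl; ring.
have fA : P A \is a fin_num by exact: fin_num_measure.
have fG : P G \is a fin_num by exact: fin_num_measure.
rewrite -(fineK fA) -(fineK fG) -!EFinM -!EFinD !lee_fin.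
set p := fine (P A); set p' := fine (P G) => H.
have p0 : 0 <= p by exact: fine_ge0.
have E1 : al / 2 * (p * g ^+ 4) = p * g / 4.
  by rewrite /al; field; rewrite gt_eqF.
have E2 : (2 * al)^-1 = g ^+ 3 by rewrite /al; field; rewrite gt_eqF.
rewrite E1 E2 in H.
have H2 : p / (4 * g ^+ 2) <= p'.
  rewrite ler_pdivrMr; last by rewrite mulr_gt0// exprn_gt0.
  rewrite -(ler_pM2r g0); apply: (@le_trans _ _ (4 * (g ^+ 3 * p'))); first by lra.
  by rewrite (_ : p' * _ * g = 4 * (g ^+ 3 * p'))//; ring.
apply: (le_trans _ H2); rewrite ler_wpM2l// invfM mulrC ler_pM2l ?invr_gt0//.
rewrite /g -expRM_natl -expRN ler_expR lerN2.
have -> : 2 * (th ^+ 2 * q / 2) = 4 * (eps / s + 1) ^+ 2.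
  by rewrite /th qE; field; rewrite gt_eqF.
have -> : 8 * eps ^+ 2 / q = 8 * (eps / s) ^+ 2.
  by rewrite qE; field; rewrite gt_eqF.
move: (eps / _) => x.
rewrite -subr_ge0 (_ : _ - _ = 4 * (x - 1) ^+ 2); last by ring.
by rewrite mulr_ge0// sqr_ge0.
Qed.

End discrete_process.

Section walk_tail.
Context d (T : measurableType d) (R : realType) (P : probability T R).
Context (F : R -> set (set T)) (r : nat) (B : R -> T -> 'cV[R]_r).
Hypothesis hF : filtration F.
Hypothesis hB : brownian_motion P F B.
Context (u : nat -> R) (c : nat -> 'I_r -> R).
Hypothesis u0 : 0 <= u 0%N.
Hypothesis u_le : forall k, u k <= u k.+1.

Lemma measurable_walk_norm K (del : R) :
  measurable [set w | exists2 k, (k <= K)%N & del < `|walk B u c k w|].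
Proof.
apply: (measurable_exists_leq K (A := fun k => [set w | del < `|walk B u c k w|])) => k.
by apply: measurable_gt; apply: measurableT_comp => //; exact: (measurable_walk hF hB).
Qed.

(** The maximal inequality for the walk and its opposite, at the optimal
    parameter th = del / V. *)
Lemma walk_tail (V del : R) K : walk_variance u c K <= V -> 0 < V -> 0 < del ->
  (P [set w | exists2 k, (k <= K)%N & (del < `|walk B u c k w|)%R]%classic <=
   (2 * expR (- (del ^+ 2 / (2 * V))))%:E)%E.
Proof.
move=> qV V0 del0; pose c' k j := - c k j.
have walkN k w : walk B u c' k w = - walk B u c k w.
  rewrite /walk -sumrN; apply: eq_bigr => l _; rewrite /increment -sumrN.
  by apply: eq_bigr => j _; rewrite mulNr.
have quadN : walk_variance u c' K = walk_variance u c K.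
  apply: eq_bigr => l _; congr (_ * _); apply: eq_bigr => j _.
  by rewrite sqrrN.
have mW c2 : measurable [set w | exists2 k, (k <= K)%N & del < walk B u c2 k w].
  apply: (measurable_exists_leq K (A := fun k => [set w | del < walk B u c2 k w])) => k.
  by apply: measurable_gt; exact: (measurable_walk hF hB).
have th0 : 0 < del / V by rewrite divr_gt0.
have bd c2 : walk_variance u c2 K <= V ->
    (P [set w | exists2 k, (k <= K)%N & (del < walk B u c2 k w)%R]%classic <=
     (expR (- (del ^+ 2 / (2 * V))))%:E)%E.
  move=> q2; apply: (le_trans (walk_max hF hB c2 u0 u_le del K th0)).
  rewrite lee_fin ler_expR.
  apply: (@le_trans _ _ ((del / V) ^+ 2 * V / 2 - del / V * del)).
    by rewrite lerD2r ler_pM2r// ler_pM2l// exprn_gt0.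
  by rewrite le_eqVlt; apply/orP; left; apply/eqP; field; rewrite gt_eqF.
rewrite mulr_natl mulr2n EFinD.
apply: le_trans (leeD (bd c qV) (bd c' _)); last by rewrite quadN.
apply: le_trans (measureU2 _ (mW c) (mW c')).
apply: le_measure; rewrite ?inE//.
- exact: measurable_walk_norm.
- exact: measurableU.
move=> w /= [k kK]; rewrite ltr_normr => /orP[dw|dw]; [left|right]; exists k => //.
by rewrite walkN.
Qed.

End walk_tail.

(** * Step integrands on a common refinement *)

Section refinement.
Context (R : realType) (d r : nat).

Section chain.
Variables (u : nat -> R) (K : nat).
Hypothesis u_le : forall k, u k <= u k.+1.

Lemma chain_le k l : (k <= l)%N -> u k <= u l.
Proof.
elim: l => [|l IH]; first by rewrite leqn0 => /eqP ->.
by rewrite leq_eqVlt ltnS => /predU1P[->//|/IH/le_trans]; apply.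
Qed.

Lemma chain_cell j l s : u l < s -> s <= u l.+1 -> (s <= u j) = (u l.+1 <= u j).
Proof.
move=> ls sl; have [jl|lj] := leqP j l.
  have jl' := chain_le jl.
  by rewrite !leNgt (le_lt_trans jl' ls) (le_lt_trans jl' (lt_le_trans ls sl)).
by rewrite (chain_le lj) (le_trans sl (chain_le lj)).
Qed.

Variables (a : R) (phi : step_integrand d r a).
Hypothesis covers :
  forall k, (k <= step_size phi)%N -> exists2 l, (l <= K)%N & step_knot phi k = u l.

(** Knots lie on the grid u, so no knot separates two points of one of its
    cells. *)
Lemma step_fun_cell l s : u l < s -> s <= u l.+1 ->
  step_fun phi s = step_fun phi (u l.+1).
Proof.
move=> ls sl; apply: eq_bigr => k _; congr (_ *: _); rewrite !indicE; congr (_%:R).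
have cell j : (j <= step_size phi)%N ->
    (s <= step_knot phi j) = (u l.+1 <= step_knot phi j).
  by move=> /covers[m _ ->]; exact: chain_cell.
congr nat_of_bool; apply/idP/idP; rewrite !inE/= !in_itv/= !ltNge !cell//;
  exact: ltnW.
Qed.

Lemma step_integral_cells (T : Type) (B : R -> T -> 'cV[R]_r) w :
  step_integral B phi w =
  \sum_(l < K) step_fun phi (u l.+1) *m (B (u l.+1) w - B (u l) w).
Proof.
rewrite /step_integral; under [RHS]eq_bigr do rewrite /step_fun mulmx_suml.
rewrite exchange_big /=; apply: eq_bigr => k _.
under eq_bigr do rewrite -scalemxAl scalemxAr.
rewrite -mulmx_sumr; congr (_ *m _).
have [p pK pE] := covers (ltnW (ltn_ord k)); have [q qK qE] := covers (ltn_ord k).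
have upq : u p <= u q by rewrite -pE -qE; exact: step_knot_le.
pose g l := B (u l) w.
have gE i j : u i = u j -> g i = g j by rewrite /g => ->.
(* With repeated grid points the indices found for two ordered knots may come
   in the wrong order; then the knots coincide and the indices can be
   exchanged. *)
wlog pq : p pK pE upq / (p <= q)%N => [H|].
  have [|qp] := leqP p q; first exact: H.
  apply: (H q qK) => //; rewrite pE; apply/le_anti.
  by rewrite upq (chain_le (ltnW qp)).
rewrite pE qE -/(g p) -/(g q) -telescope_sumr//.
rewrite -(big_mkord xpredT (fun l => \1_`]u p, u q] (u l.+1) *: (g l.+1 - g l))).
rewrite [RHS](big_cat_nat (n := p))//=.
rewrite [X in _ = _ + X](big_cat_nat (n := q))//=.
rewrite [X in _ = X + _]big_nat_cond [X in _ = X + _]big1 ?add0r; last first.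
  move=> l /andP[/andP[_ lp] _]; rewrite indicE memNset ?scale0r//=.
  by rewrite in_itv/= ltNge (chain_le lp).
rewrite [X in _ = _ + X]big_nat_cond [X in _ = _ + X]big1 ?addr0; last first.
  move=> l /andP[/andP[ql lK] _]; rewrite indicE.
  case: (boolP (_ \in _)) => [/set_mem/=|_]; last by rewrite scale0r.
  rewrite in_itv/= => /andP[_ le]; rewrite (gE l.+1 l) ?subrr ?scaler0//.
  by apply/le_anti; rewrite u_le andbT (le_trans le)// chain_le.
apply: eq_big_nat => l /andP[pl lq]; rewrite indicE.
case: (boolP (_ \in _)) => [_|]; first by rewrite scale1r.
rewrite notin_setE/= in_itv/= (chain_le lq) andbT => /negP; rewrite -leNgt => le.
rewrite scale0r (gE l.+1 l) ?subrr//.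
by apply/le_anti; rewrite u_le andbT (le_trans le)// chain_le.
Qed.

End chain.

(** Values are taken at right end points because the cells are open on the
    left. *)
Lemma integral_cells (u : nat -> R) (g : R -> R) K :
  (forall k, u k <= u k.+1) -> (forall s, 0 <= g s) -> measurable_fun setT g ->
  (forall l s, (l < K)%N -> u l < s -> s <= u l.+1 -> g s = g (u l.+1)) ->
  (\int[lebesgue_measure]_(s in `[u 0%N, u K]) (g s)%:E =
   (\sum_(l < K) g (u l.+1) * (u l.+1 - u l))%:E)%E.
Proof.
move=> u_le g0 mg; elim: K => [_|K IH gc].
  by rewrite big_ord0 set_itv1 integral_set1.
have mgE D : measurable_fun D (fun s => (g s)%:E).
  by apply/measurable_EFinP; apply: measurable_funTS.
have le0K : u 0%N <= u K by exact: chain_le.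
rewrite (_ : `[u 0%N, u K.+1]%classic = `[u 0%N, u K] `|` `]u K, u K.+1]); last first.
  by rewrite -itv_bndbnd_setU// bnd_simp.
rewrite ge0_integral_setU//=; last 3 first.
- exact: mgE.
- by move=> s _; rewrite lee_fin.
- rewrite disj_set2E; apply/eqP/seteqP; split=> // s /=; rewrite !in_itv/=.
  by move=> [/andP[_ sK] /andP[]]; rewrite ltNge sK.
rewrite IH; last by move=> l s lK; apply: gc; exact: ltnW.
rewrite big_ord_recr /= EFinD; congr (_ + _)%E.
transitivity (\int[lebesgue_measure]_(s in `]u K, u K.+1]) (g (u K.+1))%:E)%E.
  by apply: eq_integral => s; rewrite inE/= in_itv/= => /andP[? ?]; rewrite (gc K).
rewrite integral_cst//= EFinM; congr (_ * _)%E.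
by rewrite lebesgue_measure_itv/= lte_fin; case: ltP => [//|ge];
  rewrite (le_anti (introT andP (conj (u_le K) ge))) subrr.
Qed.

(** The grid is the sorted list of all knots of both integrands. *)
Lemma common_refinement (a : R) (phi psi : step_integrand d r a) :
  exists u : nat -> R, exists K : nat, [/\ u 0%N = 0, u K = a,
    forall k, u k <= u k.+1,
    forall k, (k <= step_size phi)%N -> exists2 l, (l <= K)%N & step_knot phi k = u l &
    forall k, (k <= step_size psi)%N -> exists2 l, (l <= K)%N & step_knot psi k = u l].
Proof.
pose knots (x : step_integrand d r a) := [seq step_knot x k | k <- iota 0 (step_size x).+1].
pose us := sort <=%R (knots phi ++ knots psi).
have knotsP (x : step_integrand d r a) k : (k <= step_size x)%N -> step_knot x k \in knots x.
  by move=> kx; apply/mapP; exists k => //; rewrite mem_iota.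
have bnd t : t \in us -> 0 <= t /\ t <= a.
  rewrite mem_sort mem_cat => /orP[] /mapP[k]; rewrite mem_iota add0n ltnS => /= kx ->.
    by rewrite -{1}(step_knot_first phi) -[X in _ /\ _ <= X](step_knot_last phi);
       split; exact: step_knot_le.
  by rewrite -{1}(step_knot_first psi) -[X in _ /\ _ <= X](step_knot_last psi);
     split; exact: step_knot_le.
have srt : sorted <=%R us by apply: sort_sorted; exact: le_total.
have us0 : 0 \in us.
  by rewrite mem_sort mem_cat -(step_knot_first phi) knotsP.
have usa : a \in us.
  by rewrite mem_sort mem_cat -{1}(step_knot_last phi) knotsP.
have sz : (0 < size us)%N by case: (us) us0.
(* The default value a keeps u monotone beyond the end of the list. *)
pose u l := nth a us l; pose K := (size us).-1.
have u_le k : u k <= u k.+1.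
  have [ks|ks] := ltnP k.+1 (size us).
    by apply: (sorted_leq_nth le_trans lexx a srt) => //; rewrite inE// ltnW.
  rewrite {2}/u nth_default//; have [ks'|ks'] := ltnP k (size us).
    by have [] := bnd _ (mem_nth a ks').
  by rewrite /u nth_default.
have cov t : t \in us -> exists2 l, (l <= K)%N & t = u l.
  move=> tus; exists (index t us); last by rewrite /u nth_index.
  by rewrite /K -ltnS prednK// index_mem.
exists u, K; split => //.
- apply/le_anti; have [i iK iE] := cov _ us0.
  rewrite {1}iE (chain_le u_le (leq0n i)) /=.
  by have [] := bnd _ (mem_nth a sz).
- apply/le_anti; have [i iK iE] := cov _ usa.
  rewrite {2}iE (chain_le u_le iK) andbT.
  by have /(mem_nth a)/bnd[] : (K < size us)%N by rewrite /K prednK.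
- by move=> k kphi; apply: cov; rewrite mem_sort mem_cat knotsP.
- by move=> k kphi; apply: cov; rewrite mem_sort mem_cat knotsP ?orbT.
Qed.

End refinement.

Lemma frobenius_sqr (R : realType) (d r : nat) (A : 'M[R]_(d, r)) :
  frobenius A ^+ 2 = \sum_(i < d) \sum_(j < r) A i j ^+ 2.
Proof.
rewrite /frobenius sqr_sqrtr//.
by apply: sumr_ge0 => i _; apply: sumr_ge0 => j _; exact: sqr_ge0.
Qed.

Lemma row_sqr_le_frobenius (R : realType) (d r : nat) (A : 'M[R]_(d, r)) i :
  \sum_(j < r) A i j ^+ 2 <= frobenius A ^+ 2.
Proof.
rewrite frobenius_sqr (bigD1 i)//= lerDl.
by apply: sumr_ge0 => k _; apply: sumr_ge0 => j _; exact: sqr_ge0.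
Qed.

Lemma frobeniusD_sqr (R : realType) (d r : nat) (A A' : 'M[R]_(d, r)) :
  frobenius (A + A') ^+ 2 <= 2 * frobenius A ^+ 2 + 2 * frobenius A' ^+ 2.
Proof.
rewrite !frobenius_sqr !mulr_sumr -big_split/=; apply: ler_sum => i _.
rewrite !mulr_sumr -big_split/=; apply: ler_sum => j _; rewrite mxE.
by rewrite -subr_ge0 (_ : _ - _ = (A i j - A' i j) ^+ 2) ?sqr_ge0//; ring.
Qed.

Lemma frobeniusN_sqr (R : realType) (d r : nat) (A : 'M[R]_(d, r)) :
  frobenius (- A) ^+ 2 = frobenius A ^+ 2.
Proof.
rewrite !frobenius_sqr; apply: eq_bigr => i _; apply: eq_bigr => j _.
by rewrite mxE sqrrN.
Qed.

Lemma measurable_step_fun (R : realType) (d r : nat) (a : R)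
  (phi : step_integrand d r a) i j : measurable_fun setT (fun s => step_fun phi s i j).
Proof.
under eq_fun do rewrite /step_fun summxE.
apply: measurable_sum => k.
under eq_fun do rewrite mxE.
by apply: measurable_funM => //; exact: measurable_indic.
Qed.

Lemma measurable_frobenius_sqr (R : realType) (d r : nat) (G : R -> 'M[R]_(d, r)) :
  (forall i j, measurable_fun setT (fun s => G s i j)) ->
  measurable_fun setT (fun s => frobenius (G s) ^+ 2).
Proof.
move=> mG; under eq_fun do rewrite frobenius_sqr.
apply: measurable_sum => i; apply: measurable_sum => j.
exact: measurable_funX.
Qed.

Section step_integral_tail.
Context d' (T : measurableType d') (R : realType) (P : probability T R).
Context (F : R -> set (set T)) (d r : nat) (B : R -> T -> 'cV[R]_r).
Hypothesis hF : filtration F.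
Hypothesis hB : brownian_motion P F B.

(** On a common refinement the difference of two step integrals is a weighted
    sum of Brownian increments, and its variance is at most the squared L^2
    distance of the integrands. Tails of stochastic integrals are thus
    controlled by distances of integrands. *)
Lemma step_integral_tail (a : R) (phi psi : step_integrand d r a) (V del : R) i :
  (\int[lebesgue_measure]_(s in `[0%R, a])
     (frobenius (step_fun phi s - step_fun psi s) ^+ 2)%:E <= V%:E)%E ->
  0 < V -> 0 < del ->
  let A := [set w | del <
    `|(step_integral B phi w - step_integral B psi w) i ord0|] in
  measurable A /\ (P A <= (2 * expR (- (del ^+ 2 / (2 * V))))%:E)%E.
Proof.
move=> IV V0 del0 A.
have [u [K [u0 uK u_le cphi cpsi]]] := common_refinement phi psi.
have u0' : 0 <= u 0%N by rewrite u0.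
pose c l j := (step_fun phi (u l.+1) - step_fun psi (u l.+1)) i j.
have E w : (step_integral B phi w - step_integral B psi w) i ord0 = walk B u c K w.
  rewrite (step_integral_cells u_le cphi) (step_integral_cells u_le cpsi).
  rewrite -sumrB summxE; apply: eq_bigr => l _.
  by rewrite -mulmxBl mxE; apply: eq_bigr => j _.
have mA : measurable A.
  apply: measurable_gt; apply: measurableT_comp => //; under eq_fun do rewrite E.
  exact: (measurable_walk hF hB).
split=> //; have qV : walk_variance u c K <= V.
  have itvE : `[0, a]%classic = `[u 0%N, u K]%classic by rewrite u0 uK.
  rewrite -lee_fin; apply: le_trans IV; rewrite itvE.
  have mf : measurable_fun setT (fun s : R =>
      frobenius (step_fun phi s - step_fun psi s) ^+ 2).
    apply: measurable_frobenius_sqr => k j; under eq_fun do rewrite 2!mxE.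
    by apply: measurable_funB; exact: measurable_step_fun.
  rewrite (@integral_cells _ u (fun s => frobenius (step_fun phi s - step_fun psi s) ^+ 2))//.
  - rewrite lee_fin; apply: ler_sum => l _; rewrite ler_wpM2r ?subr_ge0//.
    exact: row_sqr_le_frobenius.
  - by move=> s; rewrite sqr_ge0.
  - move=> l s lK ls sl; rewrite (step_fun_cell u_le cphi ls sl).
    by rewrite (step_fun_cell u_le cpsi ls sl).
apply: le_trans (walk_tail hF hB u0' u_le qV V0 del0).
apply: le_measure; rewrite ?inE//; first exact: (measurable_walk_norm hF hB).
by move=> w; rewrite /A/= E => lt; exists K.
Qed.

End step_integral_tail.

(** * Riemann sums approximate the stochastic integral *)

(** Times below 0 are unconstrained. Freezing a path at its value at time 0
    yields a function on the whole line, to which uniform continuity and the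
    fundamental theorem of calculus apply without boundary cases. *)
Lemma continuous_clamp (R : realType) (V : topologicalType) (f : R -> V) :
  {within `[0, +oo[, continuous f} -> continuous (fun t : R => f (Num.max 0 t)).
Proof.
move=> /subspace_continuousP cf t.
have c0 : `[0, +oo[%classic (Num.max 0 t).
  by rewrite /= in_itv/= andbT le_max lexx.
apply: (@cvg_comp _ _ _ (Num.max 0) f _ (within `[0, +oo[ (nbhs (Num.max 0 t)))).
  have cm : Num.max 0 (x : R) @[x --> t] --> Num.max 0 t.
    by apply: (@continuous_max R _ (fun=> 0) id t); [exact: cvg_cst|exact: cvg_id].
  move=> U /= wU.
  apply: (@filterS _ (nbhs t)) (cm _ wU) => x /=; apply.
  by rewrite in_itv/= andbT le_max lexx.
exact: cf.
Qed.

(** Only one of the two points is confined to the interval, so that a grid may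
    overshoot it. *)
Lemma uniformly_continuous_itv (R : realType) (f : R -> R) (a b e : R) :
  continuous f -> 0 < e ->
  \forall del \near (0 : R)^'+, forall x y, a <= x -> x <= b ->
    `|x - y| <= del -> `|f x - f y| < e.
Proof.
move=> cf e0.
have /compact_near_coveringP cov := @segment_compact R a b.
have := cov _ ((0 : R)^'+) (fun del x => forall y, `|x - y| <= del -> `|f x - f y| < e) _.
have H x : `[a, b]%classic x -> \forall x' \near x & del \near (0:R)^'+,
    forall y, `|x' - y| <= del -> `|f x' - f y| < e.
  move=> _; have e20 : 0 < e / 2 by rewrite divr_gt0.
  have /cvgrPdist_lt/(_ _ e20) := cf x; rewrite -/(nbhs _ _) => /nbhs_ballP[et /= et0 fx].
  exists (ball x (et / 2), `]0, et / 2[%classic) => /=.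
    split; first by apply: nbhsx_ballx; rewrite divr_gt0.
    by near=> z; rewrite /= in_itv/=; apply/andP; split;
      near: z; [exact: nbhs_right_gt|apply: nbhs_right_lt; rewrite divr_gt0].
  move=> [x' del] /= [xx']; rewrite in_itv/= => /andP[_ delt] y x'y.
  have x'1 : ball x et x' by apply: le_ball xx'; rewrite ler_pdivrMr// mulr_natr mulr2n lerDl ltW.
  have y1 : ball x et y.
    rewrite /ball/= (splitr et) (le_lt_trans (ler_distD x' _ _))//.
    by rewrite ltrD// (le_lt_trans x'y).
  rewrite (splitr e) (le_lt_trans (ler_distD (f x) _ _))// ltrD//.
    by rewrite distrC; exact: fx.
  exact: fx.
move=> /(_ _ H); apply: filterS => del sub x y ax xb.
by apply: sub; rewrite /= in_itv/= ax xb.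
Unshelve. all: by end_near. Qed.

Section grid.
Context (R : realType) (h : R).
Hypothesis h0 : 0 < h.

Definition grid (m k : nat) : R := k%:R * (h / 2 ^+ m).

Lemma mesh_gt0 m : 0 < h / 2 ^+ m.
Proof. by rewrite divr_gt0// exprn_gt0. Qed.

Lemma grid_ge0 m k : 0 <= grid m k.
Proof. by rewrite mulr_ge0// ltW// mesh_gt0. Qed.

Lemma gridS m k : grid m k.+1 - grid m k = h / 2 ^+ m.
Proof. by rewrite /grid -mulrBl -natrB// subSnn mul1r. Qed.

Lemma grid_le m k : grid m k <= grid m k.+1.
Proof. by rewrite -subr_ge0 gridS ltW// mesh_gt0. Qed.

Lemma grid_refine m p k : grid m k = grid (m + p) (k * 2 ^ p).
Proof.
rewrite /grid natrM natrX exprD; field.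
by rewrite !expf_neq0.
Qed.

Lemma mesh_small (del : R) : 0 < del -> \forall m \near \oo, h / 2 ^+ m <= del.
Proof.
move=> del0; have hd : 0 < del / h by rewrite divr_gt0.
have := @near_infty_natSinv_expn_lt R (PosNum hd); apply: filterS => m /=.
by rewrite ltr_pdivlMr// => /ltW; rewrite mulrAC mul1r.
Qed.

Lemma grid_osc (f : R -> R) (t e : R) : continuous f -> 0 < e ->
  \forall m \near \oo, forall x y, 0 <= x -> x <= t ->
    `|x - y| <= h / 2 ^+ m -> `|f x - f y| < e.
Proof.
move=> cf e0; have H := uniformly_continuous_itv 0 t cf e0.
have [del [del0 Q]] := filter_ex (filterI (nbhs_right_gt (0 : R)) H).
apply: filterS (mesh_small del0) => m md x y x0 xt xy.
by apply: Q => //; exact: le_trans md.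
Qed.

End grid.

Section riemann.
Context (R : realType) (d r : nat) (sigma : R -> 'M[R]_(d, r)) (h : R).
Hypothesis h0 : 0 < h.
Hypothesis sigma_cont : {within `[0, +oo[, continuous sigma}.

Definition clamped t : 'M[R]_(d, r) := sigma (Num.max 0 t).

Lemma clampedE t : 0 <= t -> clamped t = sigma t.
Proof. by rewrite /clamped => /max_idPr ->. Qed.

Lemma clamped_cont i j : continuous (fun t => clamped t i j).
Proof.
move=> t; apply: (@continuous_comp _ _ _ clamped (fun A : 'M[R]_(d, r) => A i j)).
  exact: continuous_clamp.
exact: coord_continuous.
Qed.

Lemma measurable_clamped i j : measurable_fun setT (fun t => clamped t i j).
Proof. by apply: continuous_measurable_fun; exact: clamped_cont. Qed.

Lemma clamped_osc (t e : R) : 0 < e ->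
  \forall m \near \oo, forall x y, 0 <= x -> x <= t -> `|x - y| <= h / 2 ^+ m ->
    frobenius (clamped x - clamped y) ^+ 2 <= e.
Proof.
(* e1 <= 1 gives e1^2 <= e1, and d * r + 1 is positive even if r = 0. *)
move=> e0; pose N := (d * r).+1%:R : R; pose e1 := Num.min 1 (e / N).
have N0 : 0 < N by rewrite ltr0n.
have e10 : 0 < e1 by rewrite lt_min ltr01 divr_gt0.
have e11 : e1 <= 1 by rewrite /e1 ge_min lexx.
have H : \forall m \near \oo, forall i j x y, 0 <= x -> x <= t ->
    `|x - y| <= h / 2 ^+ m -> `|clamped x i j - clamped y i j| < e1.
  apply: filter_forall => i; apply: filter_forall => j.
  by apply: grid_osc => //; exact: clamped_cont.
apply: filterS H => m H x y x0 xt xy; rewrite frobenius_sqr.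
apply: (@le_trans _ _ (\sum_(i < d) \sum_(j < r) e1)).
  apply: ler_sum => i _; apply: ler_sum => j _.
  rewrite -real_normK ?num_real// !mxE.
  have lt := H i j x y x0 xt xy.
  rewrite (le_trans (_ : _ <= e1 ^+ 2))//.
    by rewrite ler_sqr ?nnegrE ?normr_ge0 ?ltW.
  by rewrite expr2 ler_piMl// ltW.
rewrite sumr_const card_ord sumr_const card_ord -mulrnA mulnC.
apply: (@le_trans _ _ (e1 * N)).
  by rewrite -mulr_natr ler_pM2l// ler_nat.
by rewrite -ler_pdivlMr// /e1 ge_min lexx orbT.
Qed.

Lemma grid_mono m (k l : nat) : (k <= l)%N -> grid h m k <= grid h m l.
Proof. by apply: chain_le => n; exact: grid_le. Qed.

Lemma grid0 m : grid h m 0 = 0.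
Proof. by rewrite /grid mul0r. Qed.

Definition riemann_step t m K (E : grid h m K = t) : step_integrand d r t :=
  StepIntegrand (fun k => sigma (grid h m k)) (grid0 m) E (@grid_mono m).

Lemma riemann_step_cell t m K (E : grid h m K = t) l s : (l < K)%N ->
  grid h m l < s -> s <= grid h m l.+1 ->
  step_fun (riemann_step E) s = sigma (grid h m l).
Proof.
move=> lK ls sl; rewrite /step_fun /= (bigD1 (Ordinal lK))//=.
rewrite indicE mem_set/=; last by rewrite in_itv/= ls sl.
rewrite scale1r big1 ?addr0// => k kl; rewrite indicE memNset ?scale0r//=.
rewrite in_itv/= => /andP[ks sk].
have gle := @grid_mono m.
have : (k < l)%N || (l < k)%N by rewrite -neq_ltn.
case/orP => kl'.
  by have := lt_le_trans ls (le_trans sk (gle _ _ kl')); rewrite ltxx.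
by have := lt_le_trans ks (le_trans sl (gle _ _ kl')); rewrite ltxx.
Qed.

Lemma find_cell m K s : 0 < s -> s <= grid h m K ->
  exists2 l, (l < K)%N & grid h m l < s /\ s <= grid h m l.+1.
Proof.
move=> s0; elim: K => [|K IH] sK.
  by have := lt_le_trans s0 sK; rewrite grid0 ltxx.
have [sK'|Ks] := leP s (grid h m K); last by exists K.
by have [l lK H] := IH sK'; exists l => //; exact: ltnW.
Qed.

Lemma integral_riemann_step t e : 0 <= t -> 0 < e ->
  \forall m \near \oo, forall K (E : grid h m K = t),
  (\int[lebesgue_measure]_(s in `[0%R, t])
     (frobenius (step_fun (riemann_step E) s - clamped s) ^+ 2)%:E <= e%:E)%E.
Proof.
move=> t0 e0; have e10 : 0 < e / (t + 1) by rewrite divr_gt0// ltr_wpDl.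
apply: filterS (clamped_osc t e10) => m H K E.
have mg : measurable_fun setT (fun s : R =>
    frobenius (step_fun (riemann_step E) s - clamped s) ^+ 2).
  apply: measurable_frobenius_sqr => i j; under eq_fun do rewrite 2!mxE.
  apply: measurable_funB; first exact: measurable_step_fun.
  exact: measurable_clamped.
have mgE D : measurable_fun D (fun s : R =>
    (frobenius (step_fun (riemann_step E) s - clamped s) ^+ 2)%:E).
  by apply/measurable_EFinP; apply: measurable_funTS.
rewrite -integral_itv_obnd_cbnd//.
apply: (@le_trans _ _ (\int[lebesgue_measure]_(s in `]0%R, t]) (e / (t + 1))%:E)%E).
  apply: ge0_le_integral => //.
  - by move=> s _; rewrite lee_fin sqr_ge0.
  - exact: mgE.
  move=> s; rewrite /= in_itv/= => /andP[s0 st]; rewrite lee_fin.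
  have [l lK [ls sl]] : exists2 l, (l < K)%N & grid h m l < s /\ s <= grid h m l.+1.
    by apply: find_cell => //; rewrite E.
  rewrite (riemann_step_cell E lK ls sl) -clampedE; last exact: grid_ge0.
  apply: H; first exact: grid_ge0.
    by rewrite (le_trans (ltW ls)).
  rewrite distrC ger0_norm; last by rewrite subr_ge0 ltW.
  by rewrite -(gridS h m l) lerD2r.
rewrite integral_cst//= lebesgue_measure_itv/= lte_fin.
case: ifPn => _; last by rewrite mule0 lee_fin ltW.
rewrite oppr0 adde0 -EFinM lee_fin mulrAC ler_pdivrMr ?ltr_wpDl//.
by rewrite ler_pM2l// lerDl.
Qed.

End riemann.

Lemma enorm_sqr (R : realType) (d : nat) (v : 'cV[R]_d) :
  enorm v ^+ 2 = \sum_(i < d) v i ord0 ^+ 2.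
Proof. by rewrite /enorm sqr_sqrtr// sumr_ge0// => i _; exact: sqr_ge0. Qed.

Lemma coord_le_enorm (R : realType) (d : nat) (v : 'cV[R]_d) i :
  `|v i ord0| <= enorm v.
Proof.
rewrite -(@ler_pXn2r _ 2)// ?nnegrE ?normr_ge0 ?sqrtr_ge0//.
rewrite enorm_sqr real_normK ?num_real// (bigD1 i)//= lerDl.
by apply: sumr_ge0 => j _; exact: sqr_ge0.
Qed.

Section ito_riemann.
Context d' (T : measurableType d') (R : realType) (P : probability T R).
Context (F : R -> set (set T)) (d r : nat) (B : R -> T -> 'cV[R]_r).
Context (sigma : R -> 'M[R]_(d, r)) (h : R).
Hypothesis hF : filtration F.
Hypothesis hB : brownian_motion P F B.
Hypothesis h0 : 0 < h.
Hypothesis sigma_cont : {within `[0, +oo[, continuous sigma}.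

Definition rcoef m (i : 'I_d) k (j : 'I_r) := sigma (grid h m k) i j.
(** A coordinate of the stochastic integral of the Riemann step integrand, as
    a function of the upper limit; unlike step_integral it is one process for
    all times of the grid. *)
Definition rwalk i m k w := walk B (grid h m) (rcoef m i) k w.

Lemma riemann_step_integral t m K (E : grid h m K = t) w i :
  step_integral B (riemann_step sigma h0 E) w i ord0 = rwalk i m K w.
Proof.
by rewrite /step_integral summxE; apply: eq_bigr => k _; rewrite mxE.
Qed.

Lemma measurable_rwalk i m k : measurable_fun setT (rwalk i m k).
Proof.
apply: (measurable_walk hF hB); first exact: grid_ge0.
by move=> l; exact: grid_le.
Qed.

Lemma measurable_step_integral a (phi : step_integrand d r a) i :
  measurable_fun setT (fun w => step_integral B phi w i ord0).
Proof.
under eq_fun do rewrite /step_integral summxE.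
apply: measurable_sum => k; under eq_fun do rewrite mxE.
have k0 l : 0 <= step_knot phi l.
  by rewrite -(step_knot_first phi); exact: step_knot_le.
apply: (Fmeasurable_fun hF (k0 k.+1)).
by apply: (Fmeasurable_lin hF hB); rewrite ?k0// step_knot_le.
Qed.

(** The approximating step integrands in the definition of the integral depend
    on the time t. Both they and the Riemann integrands converge to sigma in
    L^2, so their integrals are close in probability by step_integral_tail,
    and the Riemann integrals converge to the stochastic integral at every t.
    This provides one approximation, compatible between different times. *)
Lemma ito_riemann t Mt (del eta : R) i : 0 <= t ->
  is_ito_integral P B sigma t Mt -> 0 < del -> 0 < eta ->
  \forall m \near \oo, forall K, grid h m K = t ->
    (P [set w | (del < `|Mt w i ord0 - rwalk i m K w|)%R]%classic <= eta%:E)%E.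
Proof.
move=> t0 [mM [phi [phis phiM]]] del0 eta0.
have del20 : 0 < del / 2 by rewrite divr_gt0.
(* With this V the bound of step_integral_tail is at most eta / 2, by exp(- x)
   <= 1 / x with x = 4 / eta. *)
pose V := eta * del ^+ 2 / 32.
have V0 : 0 < V by rewrite divr_gt0// mulr_gt0// exprn_gt0.
have tailV : 2 * expR (- ((del / 2) ^+ 2 / (2 * V))) <= eta / 2.
  set x := _ / (2 * V); have x0 : 0 < x.
    by rewrite divr_gt0 ?mulr_gt0// exprn_gt0.
  have xE : x = 4 / eta by rewrite /x /V; field; rewrite !gt_eqF.
  have : x <= expR x by apply: le_trans (expR_ge1Dx x); rewrite lerDr.
  rewrite expRN => xex; apply: (@le_trans _ _ (2 * x^-1)).
    by rewrite ler_pM2l// lef_pV2// posrE// expR_gt0.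
  by rewrite xE invf_div le_eqVlt; apply/orP; left; apply/eqP; field.
have V40 : 0 < V / 4 by rewrite divr_gt0.
apply: filterS (integral_riemann_step h0 sigma_cont t0 V40) => m Hm K E.
pose psi := riemann_step sigma h0 E.
have eta1 : 0 < (del / 2) ^+ 2 * (eta / 2).
  by rewrite mulr_gt0 ?divr_gt0// exprn_gt0// divr_gt0.
have small (x : nat -> \bar R) e : 0 < e -> x n @[n --> \oo] --> 0%E ->
    \forall n \near \oo, (x n < e%:E)%E.
  move=> e0 cx; have : nbhs (0%E : \bar R) [set y | (y < e%:E)%E].
    exact: (@nbhs_open_ereal_lt R 0 (fun=> e)).
  exact: cx.
have [n [n1 n2]] := filter_ex (filterI (small _ _ V40 phis) (small _ _ eta1 phiM)).
have mstep x : measurable_fun setT (fun s : R =>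
    frobenius (@step_fun R d r t x s - clamped sigma s) ^+ 2).
  apply: measurable_frobenius_sqr => k j; under eq_fun do rewrite 2!mxE.
  apply: measurable_funB; first exact: measurable_step_fun.
  exact: measurable_clamped.
have mstepE x D : measurable_fun D (fun s : R =>
    (frobenius (@step_fun R d r t x s - clamped sigma s) ^+ 2)%:E).
  by apply/measurable_EFinP; apply: measurable_funTS; exact: mstep.
have mstep2 : measurable_fun setT (fun s : R =>
    frobenius (step_fun (phi n) s - step_fun psi s) ^+ 2).
  apply: measurable_frobenius_sqr => k j; under eq_fun do rewrite 2!mxE.
  by apply: measurable_funB; exact: measurable_step_fun.
have I1 : (\int[lebesgue_measure]_(s in `[0%R, t])
     (frobenius (step_fun (phi n) s - step_fun psi s) ^+ 2)%:E <= V%:E)%E.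
  apply: (@le_trans _ _ (\int[lebesgue_measure]_(s in `[0%R, t])
    (2%:E * (frobenius (step_fun (phi n) s - clamped sigma s) ^+ 2)%:E +
     2%:E * (frobenius (step_fun psi s - clamped sigma s) ^+ 2)%:E))%E).
    apply: ge0_le_integral => //.
    - by move=> s _; rewrite lee_fin sqr_ge0.
    - by apply/measurable_EFinP; apply: measurable_funTS.
    - by apply: emeasurable_funD; apply: measurable_funeM; exact: mstepE.
    move=> s _; rewrite -!EFinM -EFinD lee_fin.
    rewrite -[X in frobenius X](subrKA (clamped sigma s)).
    apply: le_trans (frobeniusD_sqr _ _) _; rewrite lerD2l ler_pM2l//.
    by rewrite -frobeniusN_sqr opprB.
  rewrite ge0_integralD//=; last 4 first.
  - by move=> s _; rewrite mule_ge0// lee_fin sqr_ge0.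
  - by apply: measurable_funeM; exact: mstepE.
  - by move=> s _; rewrite mule_ge0// lee_fin sqr_ge0.
  - by apply: measurable_funeM; exact: mstepE.
  rewrite !ge0_integralZl//=; try (by move=> s _; rewrite lee_fin sqr_ge0);
    try exact: mstepE.
  have -> : V%:E = (2%:E * (V / 4)%:E + 2%:E * (V / 4)%:E)%E.
    by rewrite -!EFinM -EFinD; congr EFin; field.
  apply: leeD; (apply: lee_wpmul2l; first by rewrite lee_fin); last exact: Hm.
  apply: le_trans (ltW n1); rewrite le_eqVlt; apply/orP; left; apply/eqP.
  apply: eq_integral => s; rewrite inE/= in_itv/= => /andP[s0 _].
  by rewrite clampedE.
have [mA PA] := step_integral_tail hF hB i I1 V0 del20.
have mX : measurable_fun setT (fun w => enorm (step_integral B (phi n) w - Mt w) ^+ 2).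
  under eq_fun do rewrite enorm_sqr; apply: measurable_sum => k.
  apply: measurable_funX; under eq_fun do rewrite 2!mxE.
  apply: measurable_funB; last exact: mM.
  exact: measurable_step_integral.
pose A2 := [set w | (del / 2) ^+ 2 < enorm (step_integral B (phi n) w - Mt w) ^+ 2].
have mA2 : measurable A2 by exact: measurable_gt.
have PA2 : (P A2 <= (eta / 2)%:E)%E.
  have c0 : 0 < (del / 2) ^+ 2 by rewrite exprn_gt0.
  rewrite -(@lee_pmul2l _ ((del / 2) ^+ 2)%:E)// -EFinM.
  apply: le_trans (ltW n2); rewrite unlock.
  by apply: markov_gt => // w; exact: sqr_ge0.
have -> : eta%:E = ((eta / 2)%:E + (eta / 2)%:E)%E.
  by rewrite -EFinD; congr EFin; field.
apply: (@le_trans _ _ (P ([set w | (del / 2 <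
    `|(step_integral B (phi n) w - step_integral B psi w) i ord0|)%R]%classic `|` A2))).
  apply: le_measure; rewrite ?inE//.
  - apply: measurable_gt; apply: measurableT_comp => //.
    apply: measurable_funB; [exact: mM|exact: measurable_rwalk].
  - exact: measurableU.
  move=> w /= dw; rewrite !mxE riemann_step_integral.
  have [lt|ge] := ltP (del / 2) `|step_integral B (phi n) w i ord0 - rwalk i m K w|.
    by left.
  right; rewrite /A2/= ltr_pXn2r// ?nnegrE ?sqrtr_ge0// ?ltW//.
  apply: lt_le_trans (coord_le_enorm _ i); rewrite !mxE distrC.
  rewrite -(ltrD2r (del / 2)) -splitr (lt_le_trans dw)//.
  by rewrite (le_trans (ler_distD (step_integral B (phi n) w i ord0) _ _))// lerD2l.
apply: le_trans (measureU2 _ mA mA2) _.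
by apply: leeD => //; apply: le_trans PA _; rewrite lee_fin.
Qed.

End ito_riemann.

(** * Energy of a block *)

Lemma riemann_sandwich (R : realType) (u : nat -> R) (f : R -> R) (e : R) K :
  (forall k, u k <= u k.+1) -> (forall s, 0 <= f s) -> measurable_fun setT f ->
  (forall l s, (l < K)%N -> u l < s -> s <= u l.+1 -> `|f s - f (u l)| <= e) ->
  let S := \sum_(l < K) f (u l) * (u l.+1 - u l) in
  let I := (\int[lebesgue_measure]_(s in `[u 0%N, u K]) (f s)%:E)%E in
  ((S - e * (u K - u 0%N))%:E <= I)%E /\ (I <= (S + e * (u K - u 0%N))%:E)%E.
Proof.
move=> u_le f0 mf; elim: K => [_|K IH fc].
  by rewrite /= big_ord0 set_itv1 integral_set1 subrr mulr0 subrr addr0.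
have mfE D : measurable_fun D (fun s => (f s)%:E).
  by apply/measurable_EFinP; apply: measurable_funTS.
have le0K : u 0%N <= u K by exact: chain_le.
rewrite /= (_ : `[u 0%N, u K.+1]%classic = `[u 0%N, u K] `|` `]u K, u K.+1]); last first.
  by rewrite -itv_bndbnd_setU// bnd_simp.
rewrite ge0_integral_setU//=; last 3 first.
- exact: mfE.
- by move=> s _; rewrite lee_fin.
- rewrite disj_set2E; apply/eqP/seteqP; split=> // s /=; rewrite !in_itv/=.
  by move=> [/andP[_ sK] /andP[]]; rewrite ltNge sK.
have [IH1 IH2] := IH (fun l s lK => fc l s (ltnW lK)).
have leb : lebesgue_measure (`]u K, u K.+1] : set R) = (u K.+1 - u K)%:E.
  by rewrite lebesgue_measure_itv/= lte_fin; case: ltP => [//|ge];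
    rewrite (le_anti (introT andP (conj (u_le K) ge))) subrr.
have fb s : `]u K, u K.+1]%classic s -> f (u K) - e <= f s /\ f s <= f (u K) + e.
  rewrite /= in_itv/= => /andP[Ks sK]; have := fc K s (leqnn _) Ks sK.
  by rewrite ler_norml => /andP[? ?]; split; lra.
have up : (\int[lebesgue_measure]_(s in `]u K, u K.+1]) (f s)%:E <=
    ((f (u K) + e) * (u K.+1 - u K))%:E)%E.
  rewrite EFinM -leb -integral_cst//=.
  apply: ge0_le_integral => //.
  - by move=> s _; rewrite lee_fin.
  - exact: mfE.
  - by move=> s /fb[_]; rewrite lee_fin.
have lo : (((f (u K) - e) * (u K.+1 - u K))%:E <=
    \int[lebesgue_measure]_(s in `]u K, u K.+1]) (f s)%:E)%E.
  have [fe|fe] := leP 0 (f (u K) - e).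
    rewrite EFinM -leb -integral_cst//=.
    apply: ge0_le_integral => //.
    - exact: mfE.
    - by move=> s /fb[]; rewrite lee_fin.
  apply: (@le_trans _ _ 0%E).
    by rewrite lee_fin mulr_le0_ge0 ?subr_ge0// ltW.
  by apply: integral_ge0 => s _; rewrite lee_fin.
rewrite big_ord_recr/=; split.
  apply: le_trans (leeD IH1 lo); rewrite -EFinD lee_fin.
  by rewrite le_eqVlt; apply/orP; left; apply/eqP; ring.
apply: le_trans (leeD IH2 up) _; rewrite -EFinD lee_fin.
by rewrite le_eqVlt; apply/orP; left; apply/eqP; ring.
Qed.

Lemma continuous_sum (R : realType) (I : Type) (s : seq I) (f : I -> R -> R) :
  (forall i, continuous (f i)) -> continuous (fun t => \sum_(i <- s) f i t).
Proof.
move=> cf t; elim: s => [|i s IH].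
  by under eq_fun do rewrite big_nil; exact: cvg_cst.
under eq_fun do rewrite big_cons.
by apply: cvgD => //; exact: cf.
Qed.

Section block_energy.
Context (R : realType) (d r : nat) (sigma : R -> 'M[R]_(d, r)) (h : R).
Hypothesis h0 : 0 < h.
Hypothesis sigma_cont : {within `[0, +oo[, continuous sigma}.

(** The points of the global grid that lie in the block [n h, (n + 1) h]. *)
Definition bgrid m n k := grid h m (n * 2 ^ m + k).

Definition riemann_energy m n :=
  \sum_(k < 2 ^ m) frobenius (sigma (bgrid m n k)) ^+ 2 * (bgrid m n k.+1 - bgrid m n k).

Lemma bgridE m n k : bgrid m n k = n%:R * h + grid h m k.
Proof.
rewrite /bgrid /grid natrD mulrDl natrM natrX; congr (_ + _); field.
by rewrite expf_neq0.
Qed.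

Lemma bgrid0 m n : bgrid m n 0 = n%:R * h.
Proof. by rewrite bgridE /grid mul0r addr0. Qed.

Lemma bgrid_last m n : bgrid m n (2 ^ m) = n.+1%:R * h.
Proof.
rewrite bgridE /grid natrX -[n.+1%:R]natr1 mulrDl mul1r; congr (_ + _); field.
by rewrite expf_neq0.
Qed.

Lemma bgrid_refine m p n k : (m <= p)%N ->
  bgrid m n k = bgrid p n (k * 2 ^ (p - m)).
Proof.
move=> mp; rewrite /bgrid (grid_refine h m (p - m)) subnKC// mulnDl -mulnA -expnD.
by rewrite subnKC.
Qed.

Lemma bgrid_le m n k : bgrid m n k <= bgrid m n k.+1.
Proof. by rewrite /bgrid addnS; exact: grid_le. Qed.

Lemma bgrid_ge0 m n k : 0 <= bgrid m n k.
Proof. exact: grid_ge0. Qed.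

Lemma frobenius_clamped_cont : continuous (fun t => frobenius (clamped sigma t) ^+ 2).
Proof.
rewrite (_ : (fun t => _) =
  (fun t => \sum_(i < d) \sum_(j < r) clamped sigma t i j ^+ 2)); last first.
  by apply/funext => t; rewrite frobenius_sqr.
apply: continuous_sum => i; apply: continuous_sum => j t.
apply: (@cvg_comp _ _ _ (fun t => clamped sigma t i j) (fun x => x ^+ 2)).
  exact: clamped_cont.
exact: exprn_continuous.
Qed.

Lemma energy_ge0 n : 0 <= energy sigma h n.
Proof. by apply: Rintegral_ge0 => s _; exact: sqr_ge0. Qed.

Lemma riemann_energy_cvg n (e : R) : 0 < e ->
  \forall m \near \oo, `|riemann_energy m n - energy sigma h n| <= e.
Proof.
move=> e0; have eh0 : 0 < e / h by rewrite divr_gt0.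
apply: filterS (@grid_osc R h h0 _ (n.+1%:R * h) _ frobenius_clamped_cont eh0) => // m osc.
have fc l s : (l < 2 ^ m)%N -> bgrid m n l < s -> s <= bgrid m n l.+1 ->
    `|frobenius (clamped sigma s) ^+ 2 - frobenius (clamped sigma (bgrid m n l)) ^+ 2| <= e / h.
  move=> lm ls sl; rewrite distrC; apply/ltW; apply: osc; first exact: bgrid_ge0.
    by rewrite -(bgrid_last m); apply: chain_le => [k|]; [exact: bgrid_le|exact: ltnW].
  rewrite distrC ger0_norm; last by rewrite subr_ge0 ltW.
  by rewrite -(gridS h m (n * 2 ^ m + l)) lerD2r -addnS.
have mf : measurable_fun setT (fun t : R => frobenius (clamped sigma t) ^+ 2).
  by apply: continuous_measurable_fun; exact: frobenius_clamped_cont.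
have [lo up] := riemann_sandwich (bgrid_le m n) (fun s => sqr_ge0 _) mf fc.
have EI : (\int[lebesgue_measure]_(s in `[bgrid m n 0, bgrid m n (2 ^ m)])
    (frobenius (clamped sigma s) ^+ 2)%:E = (energy sigma h n)%:E)%E.
  rewrite /energy /Rintegral fineK.
    rewrite bgrid0 bgrid_last; apply: eq_integral => s; rewrite inE/= in_itv/=.
    by move=> /andP[ns _]; rewrite clampedE// (le_trans _ ns)// mulr_ge0// ltW.
  rewrite ge0_fin_numE; last by apply: integral_ge0 => s _; rewrite lee_fin sqr_ge0.
  apply: le_lt_trans (le_lt_trans up (ltry _)).
  rewrite bgrid0 bgrid_last le_eqVlt; apply/orP; left; apply/eqP.
  apply: eq_integral => s; rewrite inE/= in_itv/=.
  by move=> /andP[ns _]; rewrite clampedE// (le_trans _ ns)// mulr_ge0// ltW.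
have SE : \sum_(l < 2 ^ m) frobenius (clamped sigma (bgrid m n l)) ^+ 2 *
    (bgrid m n l.+1 - bgrid m n l) = riemann_energy m n.
  by apply: eq_bigr => l _; rewrite clampedE//; exact: bgrid_ge0.
have hE : e / h * (bgrid m n (2 ^ m) - bgrid m n 0) = e.
  by rewrite bgrid0 bgrid_last -[n.+1%:R]natr1; field; rewrite gt_eqF.
move: lo up; rewrite EI SE hE !lee_fin => lo up.
by rewrite ler_norml; apply/andP; split; lra.
Qed.

End block_energy.

(** * Oscillation of the stochastic integral in a block *)

Lemma measure_bigsetU_le d (T : measurableType d) (R : realType)
    (mu : {measure set T -> \bar R}) (I : Type) (s : seq I) (A : I -> set T) :
  (forall i, measurable (A i)) ->
  (mu (\big[setU/set0]_(i <- s) A i) <= \sum_(i <- s) mu (A i))%E.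
Proof.
move=> mA; elim: s => [|i s IH]; first by rewrite !big_nil measure0.
rewrite !big_cons; apply: le_trans (measureU2 _ _ _) _ => //.
  exact: bigsetU_measurable.
by apply: leeD.
Qed.

Section block_bounds.
Context d' (T : measurableType d') (R : realType) (P : probability T R).
Context (F : R -> set (set T)) (d r : nat) (B : R -> T -> 'cV[R]_r).
Context (sigma : R -> 'M[R]_(d, r)) (h : R) (M : R -> T -> 'cV[R]_d).
Hypothesis hF : filtration F.
Hypothesis hB : brownian_motion P F B.
Hypothesis h0 : 0 < h.
Hypothesis sigma_cont : {within `[0, +oo[, continuous sigma}.
Hypothesis hM : forall t, 0 <= t -> is_ito_integral P B sigma t (M t).

Lemma measurable_M t i : 0 <= t -> measurable_fun setT (fun w => M t w i ord0).
Proof. by move=> /hM[]. Qed.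

Definition bcoef m n (i : 'I_d) k (j : 'I_r) := sigma (bgrid h m n k) i j.
Definition bwalk i m n k w := walk B (bgrid h m n) (bcoef m n i) k w.

Lemma bwalkE i m n k w :
  bwalk i m n k w = rwalk B sigma h i m (n * 2 ^ m + k) w - rwalk B sigma h i m (n * 2 ^ m) w.
Proof.
rewrite /bwalk /rwalk /walk; elim: k => [|k IH].
  by rewrite big_ord0 addn0 subrr.
rewrite addnS !big_ord_recr/= IH addrAC; congr (_ + _).
by rewrite /increment /bcoef /rcoef /bgrid addnS.
Qed.

Lemma walk_variance_le i m n :
  walk_variance (bgrid h m n) (bcoef m n i) (2 ^ m) <= riemann_energy sigma h m n.
Proof.
apply: ler_sum => k _; rewrite ler_wpM2r ?subr_ge0 ?bgrid_le//.
exact: row_sqr_le_frobenius.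
Qed.

Definition dev m n k i w :=
  `|M (bgrid h m n k) w i ord0 - M (bgrid h m n 0) w i ord0|.

Definition level_set eps n m i := [set w | exists2 k, (k <= 2 ^ m)%N & eps < dev m n k i w].

Lemma measurable_level_set eps n m i : measurable (level_set eps n m i).
Proof.
apply: (measurable_exists_leq (2 ^ m) (A := fun k => [set w | eps < dev m n k i w])) => k.
apply: measurable_gt; apply: measurableT_comp => //.
by apply: measurable_funB; apply: measurable_M; exact: bgrid_ge0.
Qed.

(** At finitely many points M is within eps / 4 of a fine Riemann integral,
    outside an event of arbitrarily small probability eta; so the maximal
    inequality for walks passes to M, with half of eps. The bound J lies
    strictly above the energy because the variances of the Riemann integrals
    are at most Riemann sums of the energy, which may exceed it, and because
    the energy may vanish. *)
Lemma level_set_le (eps J : R) n m0 i : 0 < eps -> energy sigma h n < J ->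
  (P (level_set eps n m0 i) <= (2 * expR (- ((eps / 2) ^+ 2 / (2 * J))))%:E)%E.
Proof.
move=> eps0 EJ; have J0 : 0 < J by apply: le_lt_trans EJ; exact: energy_ge0.
have eps20 : 0 < eps / 2 by rewrite divr_gt0.
have eps40 : 0 < eps / 4 by rewrite divr_gt0.
apply/lee_addgt0Pr => eta eta0; pose N := (2 ^ m0).+1.
have eN0 : 0 < eta / N%:R by rewrite divr_gt0// ltr0n.
have near1 : \forall m \near \oo, forall k : 'I_N, forall K, grid h m K = bgrid h m0 n k ->
    (P [set w | (eps / 4 < `|M (bgrid h m0 n k) w i ord0 - rwalk B sigma h i m K w|)%R]%classic
      <= (eta / N%:R)%:E)%E.
  apply: filter_forall => k; apply: (ito_riemann hF hB h0 sigma_cont) => //.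
    exact: bgrid_ge0.
  by apply: hM; exact: bgrid_ge0.
have EJ0 : 0 < J - energy sigma h n by rewrite subr_gt0.
have near2 := riemann_energy_cvg h0 sigma_cont n EJ0.
have near3 : \forall m \near \oo, (m0 <= m)%N by exact: nbhs_infty_ge.
have [m [Hm [qm m0m]]] := filter_ex (filterI near1 (filterI near2 near3)).
have qJ : riemann_energy sigma h m n <= J.
  by move: qm; rewrite ler_norml => /andP[_]; rewrite lerD2r.
pose K k := (n * 2 ^ m + k * 2 ^ (m - m0))%N.
have KE k : grid h m (K k) = bgrid h m0 n k.
  by rewrite (bgrid_refine h n k m0m).
pose A k := [set w | eps / 4 < `|M (bgrid h m0 n k) w i ord0 - rwalk B sigma h i m (K k) w|].
have mA k : measurable (A k).
  apply: measurable_gt; apply: measurableT_comp => //.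
  apply: measurable_funB; first by apply: measurable_M; exact: bgrid_ge0.
  exact: (measurable_rwalk sigma hF hB h0).
pose W := [set w | exists2 k, (k <= 2 ^ m)%N & eps / 2 < `|bwalk i m n k w|].
have u0 : 0 <= bgrid h m n 0 by exact: bgrid_ge0.
have u_le := bgrid_le h0 m n.
have mW : measurable W by exact: (measurable_walk_norm hF hB).
have PW : (P W <= (2 * expR (- ((eps / 2) ^+ 2 / (2 * J))))%:E)%E.
  apply: (walk_tail hF hB u0 u_le) => //.
  by apply: le_trans (walk_variance_le _ _ _) qJ.
have mU : measurable (\big[setU/set0]_(k < N) A k).
  by apply: bigsetU_measurable => k _.
apply: (@le_trans _ _ (P (W `|` \big[setU/set0]_(k < N) A k))).
  apply: le_measure; rewrite ?inE//.
  - exact: measurable_level_set.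
  - exact: measurableU.
  move=> w [k kN dk]; have [//|wA] := pselect ((\big[setU/set0]_(k < N) A k) w).
    by right.
  left; exists (k * 2 ^ (m - m0))%N.
    by rewrite -{2}(subnKC m0m) expnD leq_mul2r kN orbT.
  have small l : (l < N)%N ->
      `|M (bgrid h m0 n l) w i ord0 - rwalk B sigma h i m (K l) w| <= eps / 4.
    move=> lN; rewrite leNgt; apply/negP => gt; apply: wA.
    by rewrite -bigcup_mkord; exists l.
  have s1 := small k kN; have s2 := small 0%N isT.
  rewrite bwalkE; move: dk s1 s2; rewrite /dev /K mul0n addn0.
  rewrite ltr_normr !ler_norml ltr_normr.
  move=> /orP[dk|dk] /andP[? ?] /andP[? ?]; apply/orP; [left|right]; lra.
apply: le_trans (measureU2 _ mW mU) _; apply: leeD => //.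
apply: le_trans (Boole_inequality _ _) _ => //.
apply: (@le_trans _ _ (\sum_(k < N) (eta / N%:R)%:E)%E).
  by apply: lee_sum => k _; apply: Hm.
rewrite sumEFin sumr_const card_ord -[X in (X)%:E]mulr_natr lee_fin divfK//.
by rewrite pnatr_eq0.
Qed.

(** Some coordinate of M deviates by more than eps, at some dyadic point of
    block n, from its value at the beginning of the block. Being countable,
    the dyadic points give a measurable event; for a solution, M is almost
    surely continuous and they see the whole block. *)
Definition bad eps n := [set w | exists m, exists i, level_set eps n m i w].

Lemma badE eps n : bad eps n = \bigcup_m \big[setU/set0]_(i < d) level_set eps n m i.
Proof.
apply/seteqP; split => w /=.
  by move=> [m [i wi]]; exists m => //; rewrite -bigcup_seq; exists i => //=;
    rewrite mem_index_enum.
by move=> [m _]; rewrite -bigcup_seq => -[i _ wi]; exists m, i.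
Qed.

Lemma measurable_bad eps n : measurable (bad eps n).
Proof.
rewrite badE; apply: bigcupT_measurable => m.
by apply: bigsetU_measurable => i _; exact: measurable_level_set.
Qed.

(** The level sets increase with the dyadic level, so the bound for one level
    passes to their union. *)
Lemma bad_le (eps J : R) n : 0 < eps -> energy sigma h n < J ->
  (P (bad eps n) <= (d%:R * (2 * expR (- ((eps / 2) ^+ 2 / (2 * J)))))%:E)%E.
Proof.
move=> eps0 EJ; pose A m := \big[setU/set0]_(i < d) level_set eps n m i.
have mA m : measurable (A m).
  by apply: bigsetU_measurable => i _; exact: measurable_level_set.
have ndA : nondecreasing_seq A.
  move=> m m' mm'; apply/subsetPset => w; rewrite /A -!bigcup_seq => -[i ii [k kk dk]].
  exists i => //; exists (k * 2 ^ (m' - m))%N.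
    by rewrite -{2}(subnKC mm') expnD leq_mul2r kk orbT.
  have E l : bgrid h m n l = bgrid h m' n (l * 2 ^ (m' - m)).
    exact: bgrid_refine.
  by move: dk; rewrite /dev !E mul0n.
have cA := @nondecreasing_cvg_mu _ _ _ P A mA _ ndA.
rewrite badE -(cvg_lim _ (cA _))//; last exact: bigcupT_measurable.
apply: lime_le.
  by apply/cvg_ex; eexists; apply: cA; exact: bigcupT_measurable.
apply: nearW => m /=; apply: le_trans (measure_bigsetU_le _ _ _) _.
  by move=> i; exact: measurable_level_set.
apply: (@le_trans _ _ (\sum_(i < d) (2 * expR (- ((eps / 2) ^+ 2 / (2 * J))))%:E)%E).
  by apply: lee_sum => i _; exact: level_set_le.
by rewrite sumEFin sumr_const card_ord [X in (_ <= X%:E)%E]mulr_natl.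
Qed.

End block_bounds.

(** * Summable sequences of probabilities *)

Lemma exists_natSinv_le (R : realType) (e : R) : 0 < e ->
  exists k : nat, k.+1%:R^-1 <= e.
Proof.
move=> e0; have [k ke] := filter_ex (@near_infty_natSinv_lt R (PosNum e0)).
by exists k; exact: ltW.
Qed.

Section bounded_sums.
Context (R : realType).
Implicit Types a b : nat -> R.

(** Summability, for the nonnegative sequences that occur here. *)
Definition bounded_sums a := exists S, forall N, \sum_(n < N) a n <= S.

Lemma bounded_sums_le a b n0 : (forall n, 0 <= b n) ->
  (forall n, (n0 <= n)%N -> a n <= b n) -> bounded_sums b -> bounded_sums a.
Proof.
move=> b0 ab [S bS]; exists (\sum_(n < n0) `|a n| + S) => N.
rewrite -(big_mkord xpredT a) -(big_mkord xpredT (fun n => `|a n|)).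
have S0 : 0 <= S by have := bS 0%N; rewrite big_ord0.
have [Nn|nN] := leqP N n0.
  rewrite [X in _ <= X + _](big_cat_nat (n := N))//= -addrA ler_wpDr//.
    by rewrite addr_ge0// sumr_ge0.
  by apply: ler_sum => i _; exact: ler_norm.
rewrite (big_cat_nat (n := n0))//=; last exact: ltnW.
apply: lerD; first by apply: ler_sum => i _; exact: ler_norm.
apply: (@le_trans _ _ (\sum_(n0 <= n < N) b n)).
  by apply: ler_sum_nat => i /andP[ni _]; exact: ab.
apply: le_trans (bS N); rewrite -(big_mkord xpredT b).
rewrite [leRHS](big_cat_nat (n := n0))//=; last exact: ltnW.
by rewrite lerDr sumr_ge0.
Qed.

Lemma bounded_sumsD a b : bounded_sums a -> bounded_sums b ->
  bounded_sums (fun n => a n + b n).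
Proof.
by move=> [S aS] [S' bS]; exists (S + S') => N; rewrite big_split lerD.
Qed.

Lemma bounded_sumsZ a c : 0 <= c -> bounded_sums a -> bounded_sums (fun n => c * a n).
Proof. by move=> c0 [S aS]; exists (c * S) => N; rewrite -mulr_sumr ler_wpM2l. Qed.

Lemma bounded_sums_geometric q : 0 <= q -> q < 1 -> bounded_sums (fun n => q ^+ n).
Proof.
move=> q0 q1; exists (1 - q)^-1 => N; have q1' : 0 < 1 - q by rewrite subr_gt0.
rewrite -[leRHS]mul1r ler_pdivlMr// mulrC -[X in X * _]opprB mulNr -subrX1 opprB.
by rewrite gerBl exprn_ge0.
Qed.

Lemma bounded_sums_cvg0 a e : (forall n, 0 <= a n) -> bounded_sums a -> 0 < e ->
  \forall n \near \oo, a n < e.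
Proof.
move=> a0 [S aS] e0.
have nd : nondecreasing_seq (series a) by apply: nondecreasing_series.
have cs : cvgn (series a).
  apply: nondecreasing_is_cvgn => //; exists S => _ [N _ <-].
  by rewrite /series/= big_mkord.
have := cvg_series_cvg_0 cs; move=> /cvgrPdist_lt/(_ _ e0); apply: filterS => n.
by rewrite sub0r normrN ger0_norm.
Qed.

Lemma bounded_sums_lty a m : (forall n, 0 <= a n) -> bounded_sums a ->
  (\sum_(m <= n <oo) (a n)%:E < +oo)%E.
Proof.
move=> a0 [S aS]; apply: (@le_lt_trans _ _ S%:E); last exact: ltry.
apply: lime_le; first by apply: is_cvg_nneseries => n _ _; rewrite lee_fin.
apply: nearW => N; rewrite sumEFin lee_fin; apply: le_trans (aS N).
rewrite -(big_mkord xpredT a); have [mN|Nm] := leqP m N.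
  by rewrite [leRHS](big_cat_nat (n := m))//= lerDr sumr_ge0.
by rewrite [leLHS]big_geq ?sumr_ge0// ltnW.
Qed.

Lemma lty_bounded_sums a m : (forall n, 0 <= a n) ->
  (\sum_(m <= n <oo) (a n)%:E < +oo)%E -> bounded_sums a.
Proof.
move=> a0 lt; pose b n := if (n < m)%N then 0 else a n.
apply: (@bounded_sums_le a b m) => [n|n|].
- by rewrite /b; case: ifP.
- by rewrite /b ltnNge => ->.
exists (fine (\sum_(m <= n <oo) (a n)%:E)%E) => N.
rewrite -lee_fin fineK; last first.
  by rewrite ge0_fin_numE// nneseries_ge0// => n _ _; rewrite lee_fin.
apply: le_trans (@nneseries_lim_ge _ _ xpredT m N _); last by move=> n _ _; rewrite lee_fin.
rewrite sumEFin lee_fin -(big_mkord xpredT b).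
have [mN|Nm] := leqP m N.
  rewrite (big_cat_nat (n := m))//= [X in X + _]big_nat_cond [X in X + _]big1 ?add0r.
    apply: ler_sum_nat => i /andP[mi _].
    by rewrite /b ltnNge mi.
  by move=> i /andP[/andP[_ im] _]; rewrite /b im.
rewrite big_nat_cond big1 ?sumr_ge0// => i /andP[/andP[_ iN] _].
by rewrite /b (ltn_trans iN).
Qed.

End bounded_sums.

Section probability_limits.
Context d (T : measurableType d) (R : realType) (P : probability T R).

Lemma borel_cantelli1 (A : nat -> set T) : (forall n, measurable (A n)) ->
  bounded_sums (fun n => fine (P (A n))) ->
  {ae P, forall w, \forall n \near \oo, ~ A n w}.
Proof.
move=> mA bA.
have lt : (\sum_(n <oo) P (A n) < +oo)%E.
  rewrite (@eq_eseriesr _ _ (fun n => (fine (P (A n)))%:E)) => [|n _].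
    by apply: bounded_sums_lty => // n; exact: fine_ge0.
  by rewrite fineK// fin_num_measure.
have P0 := lim_sup_set_cvg0 mA lt.
exists (lim_sup_set A); split => //.
  by apply: bigcap_measurable => // k _; apply: bigcup_measurable.
move=> w /= nw n _; apply: contrapT => nA; apply: nw.
by exists n => // k /= nk Ak; apply: nA; exists k.
Qed.

(** Splitting the probabilities at the threshold rho^j bounds the mean
    frequency among the first 2^j events by a geometric sequence in j;
    Markov's inequality and the Borel-Cantelli lemma then apply along the
    powers of 2. *)
Lemma ae_frequency0 (A : nat -> set T) m : (forall n, measurable (A n)) ->
  bounded_sums (fun n => fine (P (A n)) ^+ m.+1) ->
  {ae P, forall w, forall e : R, 0 < e ->
    \forall N \near \oo, \sum_(n < N) \1_(A n) w <= e * N%:R}.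
Proof.
move=> mA [S bS]; pose p n := fine (P (A n)).
have p0 n : 0 <= p n by exact: fine_ge0.
have pE n : P (A n) = (p n)%:E by rewrite /p fineK// fin_num_measure.
have S0 : 0 <= S by have := bS 0%N; rewrite big_ord0.
pose f j w : R := (\sum_(n < 2 ^ j) \1_(A n) w) / 2 ^+ j.
have mf j : measurable_fun setT (f j).
  apply: measurable_funM => //; apply: measurable_sum => n.
  exact: measurable_indic.
have f0 j w : 0 <= f j w.
  by rewrite divr_ge0 ?exprn_ge0// sumr_ge0// => n _; rewrite indicE.
(* Any rho < 1 with rho^m > 1 / 2 will do, so that q < 1 below; this one
   satisfies it by Bernoulli's inequality. *)
pose rho : R := 1 - (2 * m.+1%:R)^-1.
have m10 : 0 < 2 * m.+1%:R :> R by rewrite mulr_gt0// ltr0n.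
have inv1 : (2 * m.+1%:R)^-1 <= 2^-1 :> R.
  by rewrite lef_pV2 ?posrE// ler_peMr// ler1n.
have rho1 : rho < 1 by rewrite /rho gtrBl invr_gt0.
have rho0 : 0 < rho.
  by rewrite /rho subr_gt0 (le_lt_trans inv1)// invf_lt1// ltr1n.
have rhom : 2^-1 < rho ^+ m.
  have H k : (k <= m.+1)%N -> 1 - k%:R * (2 * m.+1%:R)^-1 <= rho ^+ k.
    elim: k => [_|k IH km]; first by rewrite mul0r subr0 expr0.
    rewrite exprS; apply: le_trans (ler_wpM2l (ltW rho0) (IH (ltnW km))).
    rewrite /rho -natr1; set x := _^-1.
    have : 0 <= k%:R * x ^+ 2 by rewrite mulr_ge0// sqr_ge0.
    by rewrite expr2 => ?; lra.
  apply: lt_le_trans (H m (leqnSn m)).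
  rewrite invfM mulrCA -[X in _ < 1 - 2^-1 * X]/(m%:R / m.+1%:R).
  have : m%:R / m.+1%:R < 1 :> R by rewrite ltr_pdivrMr ?ltr0n// mul1r ltr_nat.
  by move: (m%:R / m.+1%:R) => x ?; lra.
pose q := (2 * rho ^+ m)^-1.
have q0 : 0 <= q by rewrite invr_ge0 mulr_ge0// exprn_ge0// ltW.
have q1 : q < 1.
  rewrite invf_lt1 ?mulr_gt0 ?exprn_gt0//.
  by rewrite -(@ltr_pM2l _ 2) in rhom => //; rewrite divff in rhom.
have Ef j : (\int[P]_w (f j w)%:E <= (rho ^+ j + S * q ^+ j)%:E)%E.
  have -> : (\int[P]_w (f j w)%:E = ((\sum_(n < 2 ^ j) p n) / 2 ^+ j)%:E)%E.
    under eq_integral do rewrite EFinM muleC -sumEFin.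
    rewrite ge0_integralZl//; last 2 first.
    - apply: emeasurable_sum => n; apply/measurable_EFinP.
      exact: measurable_indic.
    - by move=> w _; apply: sume_ge0 => n _; rewrite lee_fin indicE.
    rewrite ge0_integral_sum//; last first.
      by move=> n; apply/measurable_EFinP; exact: measurable_indic.
    rewrite mulrC EFinM -sumEFin; congr (_ * _)%E; apply: eq_bigr => n _.
    by rewrite integral_indic// setIT; exact: pE.
  rewrite lee_fin ler_pdivrMr ?exprn_gt0//.
  have le n : p n <= rho ^+ j + p n ^+ m.+1 * (rho ^+ j ^+ m)^-1.
    have rj0 : 0 < rho ^+ j by rewrite exprn_gt0.
    have [le|lt] := leP (p n) (rho ^+ j).
      by rewrite (le_trans le)// lerDl divr_ge0 ?exprn_ge0// ltW.
    apply: (@le_trans _ _ (p n ^+ m.+1 / rho ^+ j ^+ m)); last by rewrite lerDr ltW.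
    rewrite ler_pdivlMr ?exprn_gt0// exprS ler_wpM2l//.
    by apply: lerXn2r; rewrite ?nnegrE//; exact: ltW.
  apply: (@le_trans _ _ (\sum_(n < 2 ^ j) (rho ^+ j + p n ^+ m.+1 * (rho ^+ j ^+ m)^-1))).
    by apply: ler_sum.
  rewrite big_split/= sumr_const card_ord -mulr_suml mulrDl.
  rewrite -[X in X + _ <= _]mulr_natr natrX lerD2l.
  have -> : S * q ^+ j * 2 ^+ j = S * (rho ^+ j ^+ m)^-1.
    rewrite /q exprVn exprMn invfM -!mulrA; congr (_ * _).
    by rewrite mulrC -mulrA divff ?expf_neq0// mulr1 -!exprM mulnC.
  apply: ler_wpM2r; last exact: bS.
  by rewrite invr_ge0 !exprn_ge0// ltW.
have main (e : R) : 0 < e -> {ae P, forall w, \forall j \near \oo, f j w <= e}.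
  move=> e0; pose D j := [set w | e < f j w].
  have mD j : measurable (D j) by exact: measurable_gt.
  have PD j : fine (P (D j)) <= e^-1 * (rho ^+ j + S * q ^+ j).
    rewrite -lee_fin fineK ?fin_num_measure// -(@lee_pmul2l _ e%:E)//.
    apply: le_trans (markov_gt P e0 (mf j) (f0 j)) _.
    by rewrite -EFinM mulrA divff ?gt_eqF// mul1r.
  have bD : bounded_sums (fun j => fine (P (D j))).
    apply: (@bounded_sums_le _ _ (fun j => e^-1 * (rho ^+ j + S * q ^+ j)) 0) => //.
      move=> j; rewrite mulr_ge0 ?invr_ge0 ?ltW//.
      by rewrite ltr_wpDr ?mulr_ge0 ?exprn_ge0 ?exprn_gt0.
    apply: bounded_sumsZ; first by rewrite invr_ge0 ltW.
    apply: bounded_sumsD; first by apply: bounded_sums_geometric => //; exact: ltW.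
    by apply: bounded_sumsZ => //; exact: bounded_sums_geometric.
  apply: filterS (borel_cantelli1 mD bD) => w; apply: filterS => j.
  by move=> /negP; rewrite -leNgt.
have : {ae P, forall w, forall k : nat, \forall j \near \oo, f j w <= k.+1%:R^-1}.
  by apply: ae_foralln => k; apply: main; rewrite invr_gt0 ltr0n.
apply: filterS => w H e e0.
have [k ke] : exists k : nat, k.+1%:R^-1 <= e / 2 by apply: exists_natSinv_le; rewrite divr_gt0.
(* Passing from N to the next power of 2 at most doubles the frequency. *)
have [j0 _ Hj] := H k.
exists (2 ^ j0)%N => // N /= jN.
have N0 : (0 < N)%N by apply: leq_trans jN; rewrite expn_gt0.
have /andP[lo hi] := trunc_log_bounds (isT : (1 < 2)%N) N0.
set j := trunc_log 2 N in lo hi.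
have j0j : (j0 <= j.+1)%N.
  by rewrite ltnW// -(@ltn_exp2l 2)// (leq_ltn_trans jN).
have := Hj j.+1 j0j; rewrite /f ler_pdivrMr ?exprn_gt0// => le.
apply: (@le_trans _ _ (\sum_(n < 2 ^ j.+1) \1_(A n) w)).
  rewrite -(big_mkord xpredT (fun n => \1_(A n) w)).
  rewrite -(big_mkord xpredT (fun n => \1_(A n) w)).
  rewrite [leRHS](big_cat_nat (n := N))//=; last exact: ltnW.
  by rewrite lerDl sumr_ge0// => i _; rewrite indicE.
apply: (le_trans le); apply: (@le_trans _ _ (e / 2 * 2 ^+ j.+1)).
  by rewrite ler_wpM2r// exprn_ge0.
rewrite exprS mulrA divfK// ler_pM2l//.
by rewrite -natrX ler_nat.
Qed.

End probability_limits.

(** * Gaussian tails of the energies and the series *)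

Section gaussian_tails.
Context (R : realType).

(** At zero energy the value is the limit of the Gaussian tail, as in the
    series S'. *)
Definition gtail (I C : R) : R := if 0 < I then expR (- (C / I)) else 0.

Lemma gtail_ge0 I C : 0 <= gtail I C.
Proof. by rewrite /gtail; case: ifP => // _; exact: expR_ge0. Qed.

Lemma gtail_le I C C' : C <= C' -> gtail I C' <= gtail I C.
Proof.
by move=> CC; rewrite /gtail; case: ifPn => // I0; rewrite ler_expR lerN2 ler_pM2r// invr_gt0.
Qed.

Lemma expRN_le_inv (x : R) : 0 < x -> expR (- x) <= x^-1.
Proof.
move=> x0; rewrite expRN lef_pV2 ?posrE ?expR_gt0//.
by apply: le_trans (expR_ge1Dx x); rewrite lerDr.
Qed.

Context (d r : nat) (sigma : R -> 'M[R]_(d, r)) (h : R).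
Let I n := energy sigma h n.
Let term e n := Num.sqrt (I n) * expR (- (e ^+ 2 / (2 * I n))).

Let term_ge0 e n : 0 <= term e n.
Proof. by rewrite mulr_ge0// expR_ge0. Qed.

(** With x = e / sqrt(I n), the factor sqrt(I n) = e / x of a term is absorbed
    by raising the exponent from x^2 / 2 to 2 * x^2, as x <= exp(3 * x^2 / 2). *)
Lemma S'_lty_gtail e : 0 < e -> (S' sigma h e < +oo)%E ->
  bounded_sums (fun n => gtail (I n) (2 * e ^+ 2)).
Proof.
move=> e0 /(lty_bounded_sums (term_ge0 e)) bt.
apply: (@bounded_sums_le _ _ (fun n => e^-1 * term e n) 0).
- by move=> n; rewrite mulr_ge0// invr_ge0 ltW.
- move=> n _; rewrite /gtail; case: ifPn => [I0|_]; last first.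
    by rewrite mulr_ge0// invr_ge0 ltW.
  have [s s0 sE] : exists2 s : R, 0 < s & I n = s ^+ 2.
    by exists (Num.sqrt (I n)); rewrite ?sqrtr_gt0// sqr_sqrtr// ltW.
  rewrite /term sE sqrtr_sqr gtr0_norm//.
  have -> : 2 * e ^+ 2 / s ^+ 2 = e ^+ 2 / (2 * s ^+ 2) + 3 / 2 * (e / s) ^+ 2.
    by field; rewrite gt_eqF.
  rewrite opprD expRD [leLHS]mulrC [leRHS]mulrA ler_pM2r ?expR_gt0//.
  have x0 : 0 < e / s by rewrite divr_gt0.
  have -> : e^-1 * s = (e / s)^-1 by rewrite invf_div mulrC.
  move: (e / s) x0 => x x0; rewrite expRN lef_pV2 ?posrE ?expR_gt0//.
  apply: le_trans (expR_ge1Dx _); rewrite -subr_ge0.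
  have -> : 1 + 3 / 2 * x ^+ 2 - x = (x - 1 / 2) ^+ 2 + x ^+ 2 / 2 + 3 / 4 by field.
  by rewrite !addr_ge0 ?sqr_ge0// divr_ge0 ?sqr_ge0.
- by apply: bounded_sumsZ => //; rewrite invr_ge0 ltW.
Qed.

(** The tails tend to 0, hence the energies are eventually at most 1, and so
    is the factor sqrt(I n). *)
Lemma gtail_S'_lty e : 0 < e ->
  bounded_sums (fun n => gtail (I n) (e ^+ 2 / 2)) -> (S' sigma h e < +oo)%E.
Proof.
move=> e0 bt; apply: bounded_sums_lty; first exact: term_ge0.
have [n0 _ Hn] := bounded_sums_cvg0 (fun n => gtail_ge0 (I n) (e ^+ 2 / 2)) bt
  (expR_gt0 (- (e ^+ 2 / 2))).
apply: (@bounded_sums_le _ _ _ n0 (fun n => gtail_ge0 (I n) (e ^+ 2 / 2))) bt.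
move=> n /Hn; rewrite /= -/(term e n) /gtail; case: ifPn => [I0|I0 _]; last first.
  by rewrite /term ler0_sqrtr ?mul0r// leNgt.
rewrite ltr_expR ltrN2 => lt.
have e20 : 0 < e ^+ 2 / 2 by rewrite divr_gt0// exprn_gt0.
have I1 : I n <= 1.
  move: lt; rewrite -[X in X < _]mulr1 ltr_pM2l// => /ltW.
  by rewrite invf_ge1.
rewrite /term [e ^+ 2 / (2 * I n)](_ : _ = e ^+ 2 / 2 / I n); last first.
  by field; rewrite gt_eqF.
rewrite -[leRHS]mul1r ler_pM2r ?expR_gt0//.
by rewrite -sqrtr1 ler_wsqrtr.
Qed.

End gaussian_tails.

Section bad_blocks.
Context d' (T : measurableType d') (R : realType) (P : probability T R).
Context (F : R -> set (set T)) (d r : nat) (B : R -> T -> 'cV[R]_r).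
Context (sigma : R -> 'M[R]_(d, r)) (h : R) (M : R -> T -> 'cV[R]_d).
Hypothesis hF : filtration F.
Hypothesis hB : brownian_motion P F B.
Hypothesis h0 : 0 < h.
Hypothesis sigma_cont : {within `[0, +oo[, continuous sigma}.
Hypothesis hM : forall t, 0 <= t -> is_ito_integral P B sigma t (M t).

(** A larger eps and a higher power both multiply the exponent of the Gaussian
    tail: for large eps the probabilities of bad blocks are summable, and for
    every eps some power of them is. *)
Lemma bad_pow (eps C : R) m : 0 < eps -> C <= m.+1%:R * (eps ^+ 2 / 16) ->
  bounded_sums (fun n => gtail (energy sigma h n) C) ->
  bounded_sums (fun n => fine (P (bad h M eps n)) ^+ m.+1).
Proof.
move=> eps0 Cm bt; pose c := eps ^+ 2 / 16.
have c0 : 0 < c by rewrite divr_gt0// exprn_gt0.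
pose D : R := d%:R * 2; have D0 : 0 <= D by rewrite mulr_ge0.
apply: (@bounded_sums_le _ _ (fun n => D ^+ m.+1 *
    (gtail (energy sigma h n) C + 2^-1 ^+ n)) 0).
- by move=> n; rewrite mulr_ge0 ?exprn_ge0// addr_ge0 ?gtail_ge0.
(* The bound on bad blocks holds for any J > I; take J = I + k with k of order
   2^-n. If k <= I then J <= 2 * I, otherwise J <= 2 * k and the bound is
   summable by itself. *)
- move=> n _; set I := energy sigma h n; pose k := c / 2 ^+ n.+1.
  have k0 : 0 < k by rewrite divr_gt0// exprn_gt0.
  have I0 : 0 <= I by exact: energy_ge0.
  have IJ : I < I + k by rewrite ltrDl.
  have J0 : 0 < I + k by exact: le_lt_trans IJ.
  have mb : measurable (bad h M eps n) by exact: (measurable_bad h0 hM).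
  have pb : fine (P (bad h M eps n)) <= D * expR (- ((eps / 2) ^+ 2 / (2 * (I + k)))).
    rewrite -lee_fin fineK ?fin_num_measure// /D -mulrA.
    exact: (bad_le hF hB h0 sigma_cont hM eps0 IJ).
  apply: (@le_trans _ _ ((D * expR (- ((eps / 2) ^+ 2 / (2 * (I + k))))) ^+ m.+1)).
    by apply: lerXn2r; rewrite ?nnegrE ?fine_ge0// mulr_ge0// expR_ge0.
  rewrite exprMn ler_wpM2l ?exprn_ge0//.
  have [kI|Ik] := leP k I.
    have I0' : 0 < I by exact: lt_le_trans kI.
    rewrite ler_wpDr//.
    apply: le_trans (gtail_le I Cm); rewrite /gtail I0' -expRM_natl ler_expR mulrN lerN2.
    rewrite -mulrA ler_pM2l ?ltr0n//.
    have -> : (eps / 2) ^+ 2 / (2 * (I + k)) = eps ^+ 2 / 16 * (2 / (I + k)).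
      by field; rewrite gt_eqF.
    rewrite ler_pM2l// ler_pdivlMr// mulrC ler_pdivrMr//.
    by rewrite mulr_natl mulr2n lerD2l.
  rewrite ler_wpDl ?gtail_ge0//.
  have le1 : expR (- ((eps / 2) ^+ 2 / (2 * (I + k)))) <= 2^-1 ^+ n.
    apply: (@le_trans _ _ (expR (- (2 ^+ n.+1)))).
      rewrite ler_expR lerN2.
      have -> : (eps / 2) ^+ 2 / (2 * (I + k)) = c * 2 / (I + k).
        by rewrite /c; field; rewrite gt_eqF.
      rewrite ler_pdivlMr//; apply: (@le_trans _ _ (2 ^+ n.+1 * (2 * k))).
        by rewrite ler_wpM2l ?exprn_ge0// mulr_natl mulr2n lerD2r ltW.
      by rewrite /k le_eqVlt; apply/orP; left; apply/eqP; field; rewrite expf_neq0.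
    apply: le_trans (expRN_le_inv _) _; first by rewrite exprn_gt0.
    rewrite -exprVn exprS ler_piMl ?exprn_ge0// invf_le1//.
    by rewrite ler1n.
  have x0 := expR_ge0 (- ((eps / 2) ^+ 2 / (2 * (I + k)))).
  apply: le_trans le1; rewrite exprS ler_piMr//.
  rewrite exprn_ile1// -expR0 ler_expR oppr_le0 divr_ge0 ?sqr_ge0//.
  by rewrite mulr_ge0// ltW.
- apply: bounded_sumsZ; first exact: exprn_ge0.
  apply: bounded_sumsD => //; apply: bounded_sums_geometric => //.
  by rewrite invf_lt1// ltr1n.
Qed.

End bad_blocks.

(** * Infinitely many large increments *)

Section borel_cantelli2.
Context d (T : measurableType d) (R : realType) (P : probability T R).

(** H n stands for the events known before step n. The hypothesis HG bounds
    from below the conditional probability of G n given that past, so the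
    probability that none of G n0, G n0.+1, ... occurs is at most the product
    of the 1 - p n, hence at most exp(- sum p n) for every partial sum. *)
Lemma borel_cantelli2 (H : nat -> set (set T)) (G : nat -> set T) (p : nat -> R) :
  (forall n, H n `<=` measurable) -> (forall n, H n setT) ->
  (forall n, measurable (G n)) ->
  (forall n A, H n A -> H n.+1 (A `\` G n)) ->
  (forall n A, H n A -> (P A * (p n)%:E <= P (A `&` G n))%E) ->
  (forall n, 0 <= p n) -> ~ bounded_sums p ->
  {ae P, forall w, forall n0, exists2 n, (n0 <= n)%N & G n w}.
Proof.
move=> mH HT mG HD HG p0 np; apply: ae_foralln => n0.
(* None of the N events from n0 on occurs. *)
pose E := fix E N := if N is N'.+1 then E N' `\` G (n0 + N')%N else setT.
have HE N : H (n0 + N)%N (E N).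
  by elim: N => [|N IH]; [exact: HT|rewrite addnS; exact: HD].
have mE N : measurable (E N) by exact: mH (HE N).
have EP N : fine (P (E N)) <= expR (- \sum_(n0 <= n < n0 + N) p n).
  elim: N => [|N IH].
    by rewrite addn0 big_geq// oppr0 expR0 /= probability_setT.
  rewrite addnS big_nat_recr ?leq_addr//= opprD expRD.
  have mI : measurable (E N `&` G (n0 + N)%N) by exact: measurableI.
  have mDf : measurable (E N `\` G (n0 + N)%N) by exact: measurableD.
  have eD : fine (P (E N)) =
      fine (P (E N `\` G (n0 + N)%N)) + fine (P (E N `&` G (n0 + N)%N)).
    rewrite -fineD; [|exact: fin_num_measure|exact: fin_num_measure].
    by congr fine; exact: measureDI.
  have le : fine (P (E N)) * p (n0 + N)%N <= fine (P (E N `&` G (n0 + N)%N)).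
    by rewrite -lee_fin EFinM !fineK ?fin_num_measure//; exact: HG.
  have x0 : 0 <= fine (P (E N `\` G (n0 + N)%N)) by exact: fine_ge0.
  have y0 : 0 <= fine (P (E N `&` G (n0 + N)%N)) by exact: fine_ge0.
  have pn0 := p0 (n0 + N)%N.
  rewrite eD in IH le.
  move: (fine _) (fine _) (p _) x0 y0 pn0 IH le => x y pn y0 x0 pn0 IH' le.
  apply: (@le_trans _ _ ((y + x) * (1 - pn))); first by lra.
  have e1 : 1 - pn <= expR (- pn) by rewrite expR_ge1Dx.
  apply: (@le_trans _ _ ((y + x) * expR (- pn))).
    by rewrite ler_wpM2l// addr_ge0.
  by rewrite ler_wpM2r// expR_ge0.
exists (\bigcap_N E N); split.
- by apply: bigcapT_measurable.
- apply/eqP; rewrite eq_le measure_ge0 andbT; apply/lee_addgt0Pr => e e0.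
  rewrite add0e; have [N HN] : exists N, expR (- \sum_(n0 <= n < n0 + N) p n) <= e.
    apply: contrapT => /forallNP nN; apply: np.
    exists (\sum_(n < n0) p n + e^-1) => N.
    rewrite -(big_mkord xpredT p) -(big_mkord xpredT p).
    apply: (@le_trans _ _ (\sum_(0 <= n < n0 + N) p n)).
      rewrite addnC [leRHS](big_cat_nat (n := N))//= ?leq_addr// lerDl sumr_ge0//.
    rewrite (big_cat_nat (n := n0))//= ?leq_addr// lerD2l.
    have /negP := nN N; rewrite -ltNge => lt.
    set S := \sum_(_ <= _ < _) _ in lt *.
    have [S0|S0] := leP S 0; first by rewrite (le_trans S0)// invr_ge0 ltW.
    have := lt_le_trans lt (expRN_le_inv S0); rewrite -ltf_pV2 ?posrE ?invr_gt0//.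
    by rewrite invrK => /ltW.
  apply: (@le_trans _ _ (P (E N))).
    apply: le_measure; rewrite ?inE//; first exact: bigcapT_measurable.
    exact: bigcap_inf.
  by rewrite -[P (E N)]fineK ?fin_num_measure// lee_fin (le_trans (EP N)).
- move=> w /= nw N _; elim: N => [//|N IH]; split => // Gw.
  by apply: nw; exists (n0 + N)%N => //; exact: leq_addr.
Qed.

End borel_cantelli2.

Section large_increments.
Context d' (T : measurableType d') (R : realType) (P : probability T R).
Context (F : R -> set (set T)) (d r : nat) (B : R -> T -> 'cV[R]_r).
Context (sigma : R -> 'M[R]_(d, r)) (h : R) (M : R -> T -> 'cV[R]_d).
Hypothesis d_gt0 : (0 < d)%N.
Hypothesis hF : filtration F.
Hypothesis hB : brownian_motion P F B.
Hypothesis h0 : 0 < h.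
Hypothesis sigma_cont : {within `[0, +oo[, continuous sigma}.
Hypothesis hM : forall t, 0 <= t -> is_ito_integral P B sigma t (M t).

(** Pigeonhole over the d rows of sigma, whose squared norms add up to the
    squared Frobenius norm. *)
Lemma best_row m n : exists i,
  riemann_energy sigma h m n / d%:R <=
  walk_variance (bgrid h m n) (bcoef sigma h m n i) (2 ^ m).
Proof.
apply: contrapT => /forallNP H.
have : riemann_energy sigma h m n < riemann_energy sigma h m n.
  have {1}-> : riemann_energy sigma h m n =
      \sum_(i < d) walk_variance (bgrid h m n) (bcoef sigma h m n i) (2 ^ m).
    rewrite /walk_variance exchange_big/=; apply: eq_bigr => k _.
    by rewrite frobenius_sqr mulr_suml.
  rewrite [ltRHS](_ : _ = \sum_(i < d) (riemann_energy sigma h m n / d%:R)); last first.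
    rewrite sumr_const card_ord -[RHS]mulr_natr divfK// pnatr_eq0.
    by rewrite -lt0n.
  apply: ltr_sum => [|i _]; last by rewrite ltNge; apply/negP/H.
  by apply/hasP; exists (Ordinal d_gt0) => //; rewrite mem_index_enum.
by rewrite ltxx.
Qed.

(** A mesh may be chosen for each block separately, fine enough for its
    Riemann integral to match the increment of M up to a small probability and
    for one of its coordinates to carry a fixed share of the energy. *)
Lemma good_level (eps eta : R) n : 0 < eps -> 0 < eta ->
  exists m, exists i,
  energy sigma h n / (2 * d%:R) <=
    walk_variance (bgrid h m n) (bcoef sigma h m n i) (2 ^ m) /\
  (P [set w | (eps < `|(M (n.+1%:R * h) w i ord0 - M (n%:R * h) w i ord0) -
      bwalk B sigma h i m n (2 ^ m) w|)%R]%classic <= eta%:E)%E.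
Proof.
move=> eps0 eta0; have eps20 : 0 < eps / 2 by rewrite divr_gt0.
have eta20 : 0 < eta / 2 by rewrite divr_gt0.
have t0 k : 0 <= k%:R * h by rewrite mulr_ge0// ltW.
have near1 k : \forall m \near \oo, forall i K, grid h m K = k%:R * h ->
    (P [set w | (eps / 2 < `|M (k%:R * h) w i ord0 - rwalk B sigma h i m K w|)%R]%classic
      <= (eta / 2)%:E)%E.
  apply: filter_forall => i; apply: (ito_riemann hF hB h0 sigma_cont) => //.
  by apply: hM.
have I0 : 0 <= energy sigma h n by exact: energy_ge0.
have near2 : \forall m \near \oo, energy sigma h n / 2 <= riemann_energy sigma h m n.
  have [I0'|I0'] := leP (energy sigma h n) 0.
    apply: nearW => m; rewrite (le_trans (_ : _ <= 0))//.
      by rewrite ler_pdivrMr// mul0r.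
    apply: sumr_ge0 => k _; rewrite mulr_ge0 ?sqr_ge0// subr_ge0.
    exact: bgrid_le.
  have I2 : 0 < energy sigma h n / 2 by rewrite divr_gt0.
  apply: filterS (riemann_energy_cvg h0 sigma_cont n I2) => m.
  by rewrite ler_norml => /andP[? _]; lra.
have [m [m1 [m2 m3]]] := filter_ex (filterI (near1 n) (filterI (near1 n.+1) near2)).
have [i Hi] := best_row m n; exists m, i; split.
  apply: le_trans Hi; rewrite invfM mulrA ler_pM2r//.
  by rewrite invr_gt0 ltr0n.
have E1 : grid h m (n * 2 ^ m) = n%:R * h by rewrite -(bgrid0 h m) /bgrid addn0.
have E2 : grid h m (n * 2 ^ m + 2 ^ m) = n.+1%:R * h by rewrite -(bgrid_last h m).
have mA k K : measurable [set w | eps / 2 < `|M (k%:R * h) w i ord0 - rwalk B sigma h i m K w|].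
  apply: measurable_gt; apply: measurableT_comp => //; apply: measurable_funB.
    exact: (measurable_M hM).
  exact: (measurable_rwalk sigma hF hB h0).
have -> : eta%:E = ((eta / 2)%:E + (eta / 2)%:E)%E by rewrite -EFinD; congr EFin; field.
apply: le_trans (leeD (m1 i _ E1) (m2 i _ E2)).
apply: le_trans (measureU2 _ (mA _ _) (mA _ _)).
apply: le_measure; rewrite ?inE.
- apply: measurable_gt; apply: measurableT_comp => //.
  apply: measurable_funB; first by apply: measurable_funB; exact: (measurable_M hM).
  by apply: (measurable_walk hF hB) => [|k]; [exact: bgrid_ge0|exact: bgrid_le].
- exact: measurableU.
move=> w /=; rewrite bwalkE => dw.
have [lt|ge] := ltP (eps / 2) `|M (n%:R * h) w i ord0 - rwalk B sigma h i m (n * 2 ^ m) w|.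
  by left.
right; move: ge dw; rewrite ler_norml !ltr_normr => /andP[? ?] /orP[?|?].
  by apply/orP; left; lra.
by apply/orP; right; lra.
Qed.

(** The Riemann increments are large infinitely often by the conditional
    Borel-Cantelli lemma: they are measurable at the end of their block, and
    walk_gt bounds their tails from below given the past. They differ from the
    increments of M by more than eps / 2 only finitely often. The constant 16
    d comes from 8 * eps^2 / walk_variance, as the coordinate chosen in a block has
    walk_variance at least energy / (2 * d). *)
Lemma large_increments (eps : R) : 0 < eps ->
  ~ bounded_sums (fun n => gtail (energy sigma h n) (16 * d%:R * eps ^+ 2)) ->
  {ae P, forall w, forall n0, exists n, exists i, (n0 <= n)%N /\
     eps / 2 < `|M (n.+1%:R * h) w i ord0 - M (n%:R * h) w i ord0|}.
Proof.
move=> eps0 nb; have eps20 : 0 < eps / 2 by rewrite divr_gt0.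
have e20 n : 0 < 2^-1 ^+ n :> R by rewrite exprn_gt0.
have /choice[m Hm] := fun n => good_level n eps20 (e20 n).
have {Hm}/choice[i Hi] := Hm.
have q_ge n : energy sigma h n / (2 * d%:R) <=
    walk_variance (bgrid h (m n) n) (bcoef sigma h (m n) n (i n)) (2 ^ m n) by have [] := Hi n.
pose D n := [set w | eps / 2 < `|(M (n.+1%:R * h) w (i n) ord0 - M (n%:R * h) w (i n) ord0) -
      bwalk B sigma h (i n) (m n) n (2 ^ m n) w|].
have t0 k : 0 <= k%:R * h by rewrite mulr_ge0// ltW.
have mbw n : measurable_fun setT (bwalk B sigma h (i n) (m n) n (2 ^ m n)).
  by apply: (measurable_walk hF hB) => [|k]; [exact: bgrid_ge0|exact: bgrid_le].
have mD n : measurable (D n).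
  apply: measurable_gt; apply: measurableT_comp => //.
  apply: measurable_funB; last exact: mbw.
  by apply: measurable_funB; exact: (measurable_M hM).
have bD : bounded_sums (fun n => fine (P (D n))).
  apply: (@bounded_sums_le _ _ (fun n => 2^-1 ^+ n) 0); first by move=> n; exact: ltW.
    move=> n _; rewrite -lee_fin fineK ?fin_num_measure//.
    by have [] := Hi n.
  by apply: bounded_sums_geometric => //; rewrite invf_lt1// ltr1n.
pose G n := [set w | eps < bwalk B sigma h (i n) (m n) n (2 ^ m n) w].
(* The constant factor in walk_gt. *)
pose c : R := expR (- 8) / 4; have c0 : 0 < c by rewrite divr_gt0// expR_gt0.
pose p n := c * gtail (energy sigma h n) (16 * d%:R * eps ^+ 2).
have FGm n : Fmeasurable F (n.+1%:R * h) (bwalk B sigma h (i n) (m n) n (2 ^ m n)).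
  rewrite -(bgrid_last h (m n) n); apply: (Fmeasurable_walk hF hB).
    exact: bgrid_ge0.
  exact: bgrid_le.
have FG n : F (n.+1%:R * h) (G n).
  have -> : G n = bwalk B sigma h (i n) (m n) n (2 ^ m n) @^-1` `]eps, +oo[.
    by apply/seteqP; split => w /=; rewrite in_itv/= andbT.
  exact: (Fmeasurable_preimage hF).
have [hsig hmeas hmon] := hF.
have H : {ae P, forall w, forall n0, exists2 n, (n0 <= n)%N & G n w}.
  apply: (@borel_cantelli2 _ _ _ P (fun n => F (n%:R * h)) G p) => //.
  - by move=> n; exact: hmeas.
  - move=> n; have [s0 sC _] := hsig _ (t0 n).
    by rewrite -(setD0 setT); exact: sC.
  - by move=> n; apply: measurable_gt.
  - move=> n A FA; have FA' : F (n.+1%:R * h) A.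
      by apply: hmon FA => //; rewrite ler_pM2r// ler_nat.
    have sF : sigma_algebra setT (F (n.+1%:R * h)) by exact: hsig.
    rewrite -(sigma_algebra_id sF).
    apply: (@measurableD _ (g_sigma_algebraType (F (n.+1%:R * h))));
      exact: sub_sigma_algebra.
  - move=> n A FA; rewrite /p /gtail; case: ifPn => [I0|_]; last first.
      by rewrite mulr0 mule0.
    have q0 : 0 < walk_variance (bgrid h (m n) n) (bcoef sigma h (m n) n (i n)) (2 ^ m n).
      apply: lt_le_trans (q_ge n); rewrite divr_gt0// mulr_gt0// ltr0n//.
    have u0 : 0 <= bgrid h (m n) n 0 by exact: bgrid_ge0.
    have FA0 : F (bgrid h (m n) n 0) A by rewrite bgrid0.
    apply: le_trans (walk_gt hF hB u0 (bgrid_le h0 (m n) n) eps0 q0 FA0).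
    rewrite lee_wpmul2l// lee_fin /c mulrAC -expRD ler_pM2r ?invr_gt0// ler_expR.
    rewrite [leRHS]opprD [leRHS]addrC lerD2l lerN2.
    rewrite ler_pdivrMr// -ler_pdivrMl.
      apply: le_trans (q_ge n); rewrite le_eqVlt; apply/orP; left; apply/eqP.
      by field; rewrite !gt_eqF// ltr0n.
    by rewrite divr_gt0// !mulr_gt0 ?ltr0n// exprn_gt0.
  - by move=> n; rewrite mulr_ge0 ?gtail_ge0// ltW.
  move=> bp; apply: nb; apply: (@bounded_sums_le _ _ (fun n => c^-1 * p n) 0).
  - by move=> n; rewrite /p mulrA mulVf ?gt_eqF// mul1r gtail_ge0.
  - by move=> n _; rewrite /p [leRHS]mulrA mulVf ?gt_eqF// mul1r.
  by apply: bounded_sumsZ => //; rewrite invr_ge0 ltW.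
apply: filterS2 H (borel_cantelli1 mD bD) => w H [n1 _ nD] n0.
have [n nn Gn] := H (maxn n0 n1); exists n, (i n); split.
  by rewrite (leq_trans _ nn)// leq_maxl.
have /nD/negP : (n1 <= n)%N by rewrite (leq_trans _ nn)// leq_maxr.
rewrite -leNgt ler_norml => /andP[le1 le2]; rewrite ltr_normr; apply/orP; left.
move: Gn; rewrite /G/= => Gn; lra.
Qed.

End large_increments.

(** * Pathwise consequences of the equation *)

Lemma primitive (R : realType) (y : R -> R) : continuous y ->
  exists J : R -> R, (forall t : R, 0 <= t -> is_derive t 1 J (y t)) /\
    (forall t, 0 <= t -> \int[lebesgue_measure]_(s in `[0, t]) y s = J t - J 0).
Proof.
(* Starting at - 1 makes J differentiable on a neighbourhood of 0. *)
move=> cy; pose J t := \int[lebesgue_measure]_(s in `[-1, t]) y s.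
have iy a b : lebesgue_measure.-integrable `[a, b] (EFin \o y).
  apply: continuous_compact_integrable; first exact: segment_compact.
  exact: continuous_subspaceT.
exists J; split => t t0.
  have tu : t < t + 1 by rewrite ltrDl.
  have t1 : -1 < t by apply: lt_le_trans t0; rewrite ltrN10.
  have [dJ JE] := continuous_FTC1_closed tu (iy _ _) t1 (cy t).
  by apply: DeriveDef; [exact: dJ|rewrite -derive1E; exact: JE].
rewrite /J Rintegral_itvB//; last by rewrite bnd_simp lerN10.
by rewrite Rintegral_itv_obnd_cbnd//; apply: integrableS (iy 0 t) => //;
  apply: subset_itvr; rewrite bnd_simp.
Qed.

Lemma derive_le0_le (R : realType) (f df : R -> R) (a b : R) : a <= b ->
  (forall t : R, a <= t -> t <= b -> is_derive t 1 f (df t)) ->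
  (forall t, a <= t -> t <= b -> df t <= 0) -> f b <= f a.
Proof.
move=> ab dfE df0.
have der x : x \in `]a, b[ -> derivable f x 1.
  by rewrite in_itv/= => /andP[ax xb]; have [] := dfE x (ltW ax) (ltW xb).
apply: (@ler0_derive1_le_cc _ f a b) => //.
- move=> x xab; rewrite derive1E; move: xab; rewrite in_itv/= => /andP[ax xb].
  by have [_ ->] := dfE x (ltW ax) (ltW xb); rewrite df0// ltW.
- apply: derivable_within_continuous => x; rewrite in_itv/= => /andP[ax xb].
  by have [] := dfE x ax xb.
- by rewrite in_itv/= ab lexx.
- by rewrite in_itv/= ab lexx.
Qed.

Section pathwise.
Context (R : realType) (y m : R -> R) (c0 h : R).
Hypothesis h0 : 0 < h.
Hypothesis cy : continuous y.
Hypothesis yE : forall t, 0 <= t ->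
  y t = c0 - \int[lebesgue_measure]_(s in `[0, t]) y s + m t.

Let q := expR (- h).

Lemma decay_lt1 : q < 1.
Proof. by rewrite -expR0 ltr_expR oppr_lt0. Qed.

(** Without noise (del = 0) this is the decay of solutions of z' = - z. In
    general z + J stays within del of its initial value, and exp(t) * (z a + J
    a - J t - del) is nonincreasing since its derivative is exp(t) times z a +
    J a - J t - del - z t. *)
Lemma forced_decay_ub (z J : R -> R) (a b del : R) : 0 <= a -> a <= b -> 0 <= del ->
  (forall t : R, 0 <= t -> is_derive t 1 J (z t)) ->
  (forall t, a <= t -> t <= b -> `|z t - z a + (J t - J a)| <= del) ->
  z b <= expR (- (b - a)) * `|z a| + 2 * del.
Proof.
move=> a0 ab del0 dJ H.
pose f t := expR t * (z a + J a - J t - del).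
have df (t : R) : a <= t -> t <= b ->
    is_derive t 1 f (expR t * (- z t) + (z a + J a - J t - del) * expR t).
  move=> at' tb; have dJt := dJ t (le_trans a0 at').
  have dg : is_derive t 1 (fun t => z a + J a - J t - del) (- z t).
    rewrite (_ : (fun t => _) = (fun t => (z a + J a - del) - J t)); last first.
      by apply/funext => x; ring.
    by rewrite -[X in is_derive _ _ _ X]sub0r; apply: is_deriveB.
  have -> : f = expR * (fun t => z a + J a - J t - del) by [].
  exact: is_deriveM.
have : f b <= f a.
  apply: (derive_le0_le ab df) => t at' tb.
  rewrite [X in _ + X]mulrC -mulrDr pmulr_rle0 ?expR_gt0//.
  by have := H t at' tb; rewrite ler_norml => /andP[? ?]; lra.
rewrite /f addrK => le.
have le2 : z a + J a - J b - del <= expR (- (b - a)) * (z a - del).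
  rewrite opprB expRD expRN mulrAC -(ler_pM2l (expR_gt0 b)) (le_trans le)//.
  rewrite le_eqVlt; apply/orP; left; apply/eqP; field.
  by rewrite gt_eqF// expR_gt0.
have := H b ab (lexx b); rewrite ler_norml => /andP[_ le3].
have e0 := expR_ge0 (- (b - a)).
have le4 : expR (- (b - a)) * (z a - del) <= expR (- (b - a)) * `|z a|.
  by rewrite ler_wpM2l// (le_trans _ (ler_norm _))// gerBl.
by lra.
Qed.

Lemma noise_increment J a b : (forall t, 0 <= t ->
    \int[lebesgue_measure]_(s in `[0, t]) y s = J t - J 0) ->
  0 <= a -> a <= b -> m b - m a = y b - y a + (J b - J a).
Proof.
move=> JE a0 ab; have b0 := le_trans a0 ab.
by rewrite (yE a0) (yE b0) (JE _ a0) (JE _ b0); ring.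
Qed.

(** The previous bound for y and for - y, with J a primitive of y, since y + J
    differs from the noise by a constant. *)
Lemma forced_decay (a b del : R) : 0 <= a -> a <= b ->
  (forall t, a <= t -> t <= b -> `|m t - m a| <= del) ->
  `|y b| <= expR (- (b - a)) * `|y a| + 2 * del.
Proof.
move=> a0 ab H; have [J [dJ JE]] := primitive cy.
have del0 : 0 <= del by apply: le_trans (H a (lexx a) ab); exact: normr_ge0.
have H' t : a <= t -> t <= b -> `|y t - y a + (J t - J a)| <= del.
  by move=> at' tb; rewrite -(noise_increment JE)//; exact: H.
rewrite ler_norml; apply/andP; split; last first.
  exact: (forced_decay_ub a0 ab del0 dJ).
rewrite lerNl -[`|y a|]normrN.
apply: (@forced_decay_ub (fun t => - y t) (fun t => - J t)) => //.
  by move=> t t0; have dJt := dJ t t0; exact: is_deriveN.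
move=> t at' tb.
have -> : - y t - - y a + (- J t - - J a) = - (y t - y a + (J t - J a)) by ring.
by rewrite normrN H'.
Qed.

(** Conversely the noise is y plus its own integral, so it cannot move much
    while y is small. *)
Lemma increment_le (a b k : R) : 0 <= a -> a <= b ->
  (forall t, a <= t -> t <= b -> `|y t| <= k) ->
  `|m b - m a| <= (2 + (b - a)) * k.
Proof.
move=> a0 ab H; have [J [dJ JE]] := primitive cy.
rewrite (noise_increment JE)// mulrDl.
have -> : 2 * k = k + k by ring.
apply: le_trans (ler_normD _ _) _; apply: lerD.
  apply: le_trans (ler_normB _ _) _.
  by apply: lerD; apply: H.
have lin (t : R) (c : R) : is_derive t 1 (fun t => c * t) c.
  rewrite -[X in is_derive _ _ _ X]mulr1; exact: is_deriveZ.
have d1 : - k * b - J b <= - k * a - J a.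
  apply: (@derive_le0_le _ (fun t => - k * t - J t) (fun t => - k - y t) a b ab).
    move=> t at' tb; have dJt := dJ t (le_trans a0 at').
    exact: (is_deriveB (lin t (- k)) dJt).
  by move=> t at' tb; have := H t at' tb; rewrite ler_norml => /andP[? _]; lra.
have d2 : J b - k * b <= J a - k * a.
  apply: (@derive_le0_le _ (fun t => J t - k * t) (fun t => y t - k) a b ab).
    move=> t at' tb; have dJt := dJ t (le_trans a0 at').
    exact: (is_deriveB dJt (lin t k)).
  by move=> t at' tb; have := H t at' tb; rewrite ler_norml => /andP[_ ?]; lra.
by rewrite ler_norml; apply/andP; split; lra.
Qed.

Definition dev_le n (k : R) := forall t : R, n%:R * h <= t -> t <= n.+1%:R * h ->
  `|m t - m (n%:R * h)| <= k.

Let t0 n : 0 <= n%:R * h.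
Proof. by rewrite mulr_ge0// ltW. Qed.

Let tS n : n%:R * h <= n.+1%:R * h.
Proof. by rewrite ler_pM2r// ler_nat. Qed.

Let tSB n : n.+1%:R * h - n%:R * h = h.
Proof. by rewrite -mulrBl -natrB// subSnn mul1r. Qed.

Lemma dev_ge0 n k : dev_le n k -> 0 <= k.
Proof. by move=> H; apply: le_trans (H _ (lexx _) (tS n)). Qed.

Lemma block_le n k t : dev_le n k -> n%:R * h <= t -> t <= n.+1%:R * h ->
  `|y t| <= `|y (n%:R * h)| + 2 * k.
Proof.
move=> H nt tn; apply: le_trans (forced_decay (t0 n) nt _) _.
  by move=> s ns st; apply: H => //; exact: le_trans tn.
by rewrite lerD2r ler_piMl// -[leRHS]expR0 ler_expR oppr_le0 subr_ge0.
Qed.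

Lemma block_step n k : dev_le n k ->
  `|y (n.+1%:R * h)| <= q * `|y (n%:R * h)| + 2 * k.
Proof. by move=> H; have := forced_decay (t0 n) (tS n) H; rewrite tSB. Qed.

Lemma block_of t : 0 <= t -> exists n, n%:R * h <= t /\ t <= n.+1%:R * h.
Proof.
move=> tt0; exists (Num.truncn (t / h)).
have /andP[lo hi] := truncn_itv (divr_ge0 tt0 (ltW h0)).
by rewrite -ler_pdivlMr// lo -ler_pdivrMr// ltW.
Qed.

(** Over a block the value of y is multiplied by q < 1 and moved by at most 2
    k; the effect of the noise sums up as a geometric series. *)
Lemma decay_iter n1 k n : (forall n, (n1 <= n)%N -> dev_le n k) ->
  `|y ((n1 + n)%:R * h)| <= q ^+ n * `|y (n1%:R * h)| + 2 * k / (1 - q).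
Proof.
move=> H; have q1 : 0 < 1 - q by rewrite subr_gt0 decay_lt1.
have k0 := dev_ge0 (H n1 (leqnn _)).
elim: n => [|n IH].
  by rewrite addn0 expr0 mul1r lerDl divr_ge0 ?mulr_ge0// ltW.
rewrite addnS; apply: le_trans (block_step (H _ (leq_addr _ _))) _.
apply: (@le_trans _ _ (q * (q ^+ n * `|y (n1%:R * h)| + 2 * k / (1 - q)) + 2 * k)).
  by rewrite lerD2r ler_pM2l ?expR_gt0.
rewrite exprS le_eqVlt; apply/orP; left; apply/eqP; field.
by rewrite gt_eqF.
Qed.

Lemma eventually_le n1 k : 0 < k -> (forall n, (n1 <= n)%N -> dev_le n k) ->
  exists2 A, 0 <= A & forall t, A <= t -> `|y t| <= (2 / (1 - q) + 3) * k.
Proof.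
move=> k0 H; have q1 : 0 < 1 - q by rewrite subr_gt0 decay_lt1.
pose A := `|y (n1%:R * h)| + 1; have A0 : 0 < A by rewrite ltr_wpDl.
have [n2 _ Hn] := bounded_sums_cvg0 (fun n => exprn_ge0 n (expR_ge0 (- h)))
  (bounded_sums_geometric (expR_ge0 (- h)) decay_lt1) (divr_gt0 k0 A0).
exists ((n1 + n2).+1%:R * h) => [|t At]; first exact: t0.
have [n [nt tn]] := block_of (le_trans (t0 _) At).
have n12 : (n1 + n2 <= n)%N.
  by rewrite -ltnS -(ler_nat R) -(ler_pM2r h0); exact: le_trans tn.
have n1n : (n1 <= n)%N := leq_trans (leq_addr _ _) n12.
apply: le_trans (block_le (H n n1n) nt tn) _.
have := decay_iter (n - n1) H; rewrite subnKC// => le.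
have qA : expR (- h) ^+ (n - n1) < k / A by apply: Hn; rewrite /= leq_subRL.
have le2 : q ^+ (n - n1) * `|y (n1%:R * h)| <= k.
  rewrite -/q ltr_pdivlMr// in qA.
  by apply: le_trans (ltW qA); rewrite ler_wpM2l ?exprn_ge0 ?expR_ge0// lerDl.
have -> : (2 / (1 - q) + 3) * k = k + 2 * k / (1 - q) + 2 * k.
  by field; rewrite gt_eqF.
by rewrite lerD2r (le_trans le)// lerD2r.
Qed.

Lemma bounded_path n1 k : 0 < k -> (forall n, (n1 <= n)%N -> dev_le n k) ->
  exists2 Y, 0 < Y & forall t, 0 <= t -> `|y t| <= Y.
Proof.
move=> k0 H; have [A A0 HA] := eventually_le k0 H.
have cny : {within `[0, A], continuous (fun t => `|y t|)}.
  apply: continuous_subspaceT => t.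
  by apply: (@continuous_comp _ _ _ y Num.norm); [exact: cy|exact: norm_continuous].
have [c _ Hc] := EVT_max A0 cny.
exists (`|y c| + `|(2 / (1 - q) + 3) * k| + 1).
  by rewrite ltr_wpDl// addr_ge0.
move=> t tt0; have [At|tA] := leP A t.
  apply: (le_trans (HA t At)); apply: (le_trans (ler_norm _)).
  by rewrite -addrA addrCA lerDl addr_ge0.
have := Hc t; rewrite in_itv/= tt0 (ltW tA) => /(_ isT) le.
by apply: (le_trans le); rewrite -addrA lerDl addr_ge0.
Qed.

(** Let b mark the blocks where the noise deviates by more than eta. As y is
    bounded, the deviation is bounded on these, hence on average it is about
    eta when they have frequency 0. Summing the contraction of block_step over
    blocks shows that |y| at the block ends is small on average as well, and
    with it the integral of y^2 over the blocks, y being bounded. *)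
Lemma time_average n1 k : 0 < k -> (forall n, (n1 <= n)%N -> dev_le n k) ->
  (forall eta : R, 0 < eta -> exists2 b : nat -> bool,
     forall n, ~~ b n -> dev_le n eta &
     forall e : R, 0 < e -> \forall N \near \oo, \sum_(n < N) (b n)%:R <= e * N%:R) ->
  t^-1 * (\int[lebesgue_measure]_(s in `[0, t]) y s ^+ 2) @[t --> +oo] --> 0.
Proof.
move=> k0 Hk Hb; have q1 : 0 < 1 - q by rewrite subr_gt0 decay_lt1.
have [Y Y0 HY] := bounded_path k0 Hk.
pose K := (2 + h) * Y; have K0 : 0 < K by rewrite mulr_gt0// addr_gt0.
have devK n : dev_le n K.
  move=> t nt tn; apply: le_trans (increment_le (k := Y) (t0 n) nt _) _.
    by move=> s ns _; apply: HY; exact: le_trans ns.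
  by rewrite ler_pM2r// lerD2l; have := tSB n; lra.
have cy2 : continuous (fun t => y t ^+ 2).
  by move=> t; apply: (@continuous_comp _ _ _ y (fun x => x ^+ 2));
    [exact: cy|exact: exprn_continuous].
have [J [dJ JE]] := primitive cy2.
have ndJ a b : 0 <= a -> a <= b -> J a <= J b.
  move=> a0 ab; rewrite -lerN2.
  apply: (@derive_le0_le _ (fun t => - J t) (fun t => - y t ^+ 2) a b ab).
    by move=> t at' tb; have dJt := dJ t (le_trans a0 at'); exact: is_deriveN.
  by move=> t _ _; rewrite oppr_le0 sqr_ge0.
have blockJ n del : dev_le n del ->
    J (n.+1%:R * h) - J (n%:R * h) <= h * Y * (`|y (n%:R * h)| + 2 * del).
  move=> dl; pose c := Y * (`|y (n%:R * h)| + 2 * del).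
  have : J (n.+1%:R * h) - c * (n.+1%:R * h) <= J (n%:R * h) - c * (n%:R * h).
    apply: (@derive_le0_le _ (fun t => J t - c * t) (fun t => y t ^+ 2 - c) _ _ (tS n)).
      move=> t nt tn; have dJt := dJ t (le_trans (t0 n) nt).
      have lin : is_derive t 1 (fun t => c * t) c.
        by rewrite -[X in is_derive _ _ _ X]mulr1; exact: is_deriveZ.
      exact: (is_deriveB dJt lin).
    move=> t nt tn; rewrite subr_le0 -real_normK ?num_real// expr2.
    apply: ler_pM => //; first by apply: HY; exact: le_trans nt.
    exact: block_le dl nt tn.
  have -> : h * Y * (`|y (n%:R * h)| + 2 * del) = c * (n.+1%:R * h - n%:R * h).
    by rewrite tSB /c; ring.
  by rewrite mulrBr; lra.
apply/cvgrPdist_le => e e0.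
pose D := h * Y * (2 / (1 - q) + 2) * (1 + K).
have D0 : 0 <= D.
  rewrite !mulr_ge0 ?(ltW h0) ?(ltW Y0)//; last by rewrite addr_ge0// ltW.
  by rewrite addr_ge0// divr_ge0// ltW.
(* J grows on average by at most D * eta per block, and (n + 1) * h <= 2 * t
   for t in block n; this eta makes the growth up to time t at most e / 2 * t. *)
pose eta := e * h / (4 * (D + 1)).
have D1 : 0 < D + 1 by rewrite ltr_wpDl.
have eta0 : 0 < eta by rewrite divr_gt0 ?mulr_gt0.
have [b Hdev Hfreq] := Hb eta eta0.
pose del n := eta + K * (b n)%:R.
have devdel n : dev_le n (del n).
  rewrite /del; case: (boolP (b n)) => [bn|/Hdev dn].
    move=> t nt tn; apply: le_trans (devK n t nt tn) _.
    by rewrite mulr1 lerDr ltW.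
  by rewrite mulr0 addr0.
pose a n := `|y (n%:R * h)|.
have sumJ N : J (N%:R * h) - J 0 <= h * Y * (\sum_(n < N) (a n + 2 * del n)).
  elim: N => [|N IH]; first by rewrite mul0r subrr big_ord0 mulr0.
  rewrite big_ord_recr/= mulrDr -(subrKA (J (N%:R * h))) addrC.
  by apply: lerD => //; exact: blockJ.
have suma N : (1 - q) * (\sum_(n < N) a n) + a N <= a 0%N + 2 * \sum_(n < N) del n.
  elim: N => [|N IH]; first by rewrite !big_ord0 !mulr0 add0r addr0.
  rewrite !big_ord_recr/= (mulrDr (1 - q)) (mulrDr 2).
  have := block_step (devdel N); rewrite -/(a N) -/(a N.+1).
  by lra.
pose c1 := h * Y * (a 0%N / (1 - q)).
have c10 : 0 <= c1.
  by rewrite !mulr_ge0 ?(ltW h0) ?(ltW Y0) ?normr_ge0// invr_ge0 ltW.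
have [N0 _ HN] := Hfreq eta eta0.
have bound N : (N0 <= N)%N -> J (N%:R * h) - J 0 <= c1 + D * eta * N%:R.
  move=> /HN/= freq; apply: (le_trans (sumJ N)).
  have sd : \sum_(n < N) del n <= (1 + K) * eta * N%:R.
    rewrite big_split/= sumr_const card_ord -mulr_sumr -[eta *+ N]mulr_natr.
    have -> : (1 + K) * eta * N%:R = eta * N%:R + K * (eta * N%:R) by ring.
    by rewrite lerD2l ler_pM2l.
  have sa : \sum_(n < N) a n <= (a 0%N + 2 * \sum_(n < N) del n) / (1 - q).
    rewrite ler_pdivlMr// mulrC; apply: le_trans (suma N).
    by rewrite lerDl normr_ge0.
  have -> : c1 + D * eta * N%:R = h * Y * ((a 0%N + 2 * ((1 + K) * eta * N%:R)) / (1 - q)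
      + 2 * ((1 + K) * eta * N%:R)).
    by rewrite /c1 /D; field; rewrite gt_eqF.
  rewrite ler_pM2l ?mulr_gt0// big_split/= -mulr_sumr; apply: lerD.
    by apply: (le_trans sa); rewrite ler_pM2r ?invr_gt0// lerD2l ler_pM2l.
  by rewrite ler_pM2l.
near=> t.
have th : h <= t by near: t; apply: nbhs_pinfty_ge; exact: num_real.
have tN : N0%:R * h <= t by near: t; apply: nbhs_pinfty_ge; exact: num_real.
have tc : 2 * c1 / e <= t by near: t; apply: nbhs_pinfty_ge; exact: num_real.
have tt0 : 0 < t := lt_le_trans h0 th.
have [n [nt tn]] := block_of (ltW tt0).
rewrite sub0r normrN JE ?(ltW tt0)// ger0_norm; last first.
  by rewrite mulr_ge0 ?invr_ge0 ?(ltW tt0)// subr_ge0 ndJ// ltW.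
rewrite mulrC ler_pdivrMr//.
apply: (@le_trans _ _ (c1 + D * eta * n.+1%:R)).
  apply: le_trans (bound n.+1 _); first by rewrite lerD2r ndJ// ltW.
  by rewrite -(ler_nat R) -(ler_pM2r h0); exact: le_trans tn.
have nt2 : n.+1%:R * h <= 2 * t.
  by have := tSB n; lra.
have c1t : c1 <= e / 2 * t.
  move: tc; rewrite ler_pdivrMr// => tc; lra.
have : D * eta * n.+1%:R <= e / 2 * t.
  have -> : D * eta * n.+1%:R = e / 4 * (D / (D + 1)) * (n.+1%:R * h).
    by rewrite /eta; field; rewrite gt_eqF.
  apply: (@le_trans _ _ (e / 4 * (n.+1%:R * h))).
    rewrite ler_wpM2r ?t0// ler_piMr ?divr_ge0 ?(ltW e0)//.
    by rewrite ler_pdivrMr// mul1r lerDl.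
  have e4 : 0 < e / 4 by rewrite divr_gt0.
  have : e / 4 * (n.+1%:R * h) <= e / 4 * (2 * t) by rewrite ler_pM2l.
  by lra.
by lra.
Unshelve. all: by end_near. Qed.

End pathwise.

(** * Behaviour at infinity *)

Section limits_at_infinity.
Context (R : realType).
Implicit Types f : R -> R.

Lemma limsup_infty_ge f (c : R) : (forall A, exists2 t, A <= t & c <= f t) ->
  (c%:E <= limsup_infty f)%E.
Proof.
move=> H; apply: le_ereal_inf_tmp => _ [V [A [_ AV]] <-].
have [t At ct] := H (A + 1).
apply: (@le_trans _ _ (f t)%:E); first by rewrite lee_fin.
apply: ereal_sup_ubound; exists t => //; apply: AV.
by apply: lt_le_trans At; rewrite ltrDl.
Qed.

Lemma limsup_infty_le f (c : R) : (\forall t \near +oo, f t <= c) ->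
  (limsup_infty f <= c%:E)%E.
Proof.
move=> H; apply: (@le_trans _ _ (ereal_sup [set (f t)%:E | t in [set t | f t <= c]])).
  by apply: ereal_inf_lbound; exists [set t | f t <= c].
by apply: ge_ereal_sup => _ [t /= tc <-]; rewrite lee_fin.
Qed.

Lemma limsup_infty_eqy f : (forall c : R, forall A, exists2 t, A <= t & c <= f t) ->
  limsup_infty f = +oo%E.
Proof. by move=> H; apply/eqyP => c c0; apply: limsup_infty_ge; exact: H. Qed.

Lemma liminf_infty_eq0 f : (forall t, 0 <= f t) ->
  (forall e : R, 0 < e -> forall A, exists2 t, A <= t & f t <= e) ->
  liminf_infty f = 0%E.
Proof.
move=> f0 H; rewrite /liminf_infty /limf_einf.
suff -> : limf_esup (\- (fun t => (f t)%:E))%E (pinfty_nbhs R) = 0%E by rewrite oppe0.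
rewrite -[LHS]/(limsup_infty (fun t => - f t)).
apply/eqP; rewrite eq_le; apply/andP; split.
  by apply: limsup_infty_le; apply: nearW => t; rewrite oppr_le0.
apply/lee_addgt0Pr => e e0; rewrite -leeBlDr// sub0e -EFinN.
by apply: limsup_infty_ge => A; have [t At te] := H e e0 A; exists t; rewrite ?lerN2.
Qed.

End limits_at_infinity.

Lemma Rintegral_sum_itv (R : realType) (I : Type) (s : seq I) (f : I -> R -> R) (a b : R) :
  (forall i, continuous (f i)) ->
  \int[lebesgue_measure]_(t in `[a, b]) (\sum_(i <- s) f i t) =
  \sum_(i <- s) \int[lebesgue_measure]_(t in `[a, b]) f i t.
Proof.
move=> cf; have int g : continuous g -> lebesgue_measure.-integrable `[a, b] (EFin \o g).
  move=> cg; apply: continuous_compact_integrable; first exact: segment_compact.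
  exact: continuous_subspaceT.
elim: s => [|i s IH].
  rewrite big_nil -[RHS](mul0r (\int[lebesgue_measure]_(t in `[a, b]) 0)).
  rewrite -RintegralZl//; last by apply: (int (fun=> 0)); exact: cst_continuous.
  by apply: eq_Rintegral => t _; rewrite big_nil mul0r.
rewrite big_cons -IH -RintegralD//; first last.
- by apply: int; exact: continuous_sum.
- by apply: int; exact: cf.
by apply: eq_Rintegral => t _; rewrite big_cons.
Qed.

(** If g stayed above e, its integral would grow with slope at least e; at
    times t >= 2 * A its average would be at least e / 2. *)
Lemma frequently_small (R : realType) (g : R -> R) : continuous g -> (forall t, 0 <= g t) ->
  t^-1 * (\int[lebesgue_measure]_(s in `[0, t]) g s) @[t --> +oo] --> 0 ->
  forall e : R, 0 < e -> forall A, exists2 t, A <= t & g t <= e.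
Proof.
move=> cg g0 cv e e0 A0; pose A := Num.max A0 1.
have A1 : 1 <= A by rewrite le_max lexx orbT.
suff [t At te] : exists2 t, A <= t & g t <= e.
  by exists t => //; apply: le_trans At; rewrite le_max lexx.
apply: contrapT => nex.
have ge t : A <= t -> e <= g t.
  by move=> At; rewrite leNgt; apply/negP => lt; apply: nex; exists t => //; exact: ltW.
have [J [dJ JE]] := primitive cg.
have A0' : 0 <= A by apply: le_trans A1.
have e20 : 0 < e / 4 by rewrite divr_gt0.
have := cv => /cvgrPdist_lt/(_ _ e20) near1.
have near2 : \forall t \near +oo, 2 * A <= t.
  by apply: nbhs_pinfty_ge; exact: num_real.
have [t [t1 t2]] := filter_ex (filterI near1 near2).
have At : A <= t by lra.
have tt0 : 0 < t by lra.
have JA : J 0 <= J A.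
  rewrite -lerN2; apply: (@derive_le0_le _ (fun t => - J t) (fun t => - g t) 0 A A0').
    by move=> s s0 sA; have dJs := dJ s s0; exact: is_deriveN.
  by move=> s _ _; rewrite oppr_le0.
have Jt : e * t - J t <= e * A - J A.
  apply: (@derive_le0_le _ (fun t => e * t - J t) (fun t => e - g t) A t At).
    move=> s sA st; have dJs := dJ s (le_trans A0' sA).
    have lin : is_derive s 1 (fun t => e * t) e.
      by rewrite -[X in is_derive _ _ _ X]mulr1; exact: is_deriveZ.
    exact: (is_deriveB lin dJs).
  by move=> s As _; rewrite subr_le0 ge.
move: t1; rewrite sub0r normrN JE ?(ltW tt0)// ltNge => /negP; apply.
apply: (le_trans _ (ler_norm _)); rewrite [leRHS]mulrC ler_pdivlMr//.
have : e * (2 * A) <= e * t by rewrite ler_pM2l.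
have : 0 <= e * t by rewrite mulr_ge0 ?ltW.
by lra.
Qed.

(** * Almost sure behaviour of the solution *)

Section solution.
Context d' (T : measurableType d') (R : realType) (P : probability T R).
Context (F : R -> set (set T)) (d r : nat) (B : R -> T -> 'cV[R]_r).
Context (sigma : R -> 'M[R]_(d, r)) (h : R) (Y M : R -> T -> 'cV[R]_d).
Hypothesis d_gt0 : (0 < d)%N.
Hypothesis hF : filtration F.
Hypothesis hB : brownian_motion P F B.
Hypothesis h0 : 0 < h.
Hypothesis sigma_cont : {within `[0, +oo[, continuous sigma}.
Hypothesis hM : forall t, 0 <= t -> is_ito_integral P B sigma t (M t).

Definition solves w := {within `[0, +oo[, continuous (fun t => Y t w)} /\
  forall t, 0 <= t -> forall i : 'I_d, Y t w i ord0 = Y 0 w i ord0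
     - (\int[lebesgue_measure]_(s in `[0, t]) Y s w i ord0) + M t w i ord0.

Hypothesis hY : {ae P, forall w, solves w}.

Let y (w : T) (i : 'I_d) (t : R) : R := Y (Num.max 0 t) w i ord0.
Let m (w : T) (i : 'I_d) (t : R) : R := M t w i ord0.

Let yP t w i : 0 <= t -> y w i t = Y t w i ord0.
Proof. by rewrite /y => /max_idPr ->. Qed.

Let y_cont w i : solves w -> continuous (y w i).
Proof.
move=> [cY _] t.
apply: (@continuous_comp _ _ _ (fun t : R => Y (Num.max 0 t) w) (fun A : 'cV[R]_d => A i ord0)).
  exact: (continuous_clamp cY).
exact: coord_continuous.
Qed.

Let y_eq w i : solves w -> forall t, 0 <= t ->
  y w i t = Y 0 w i ord0 - \int[lebesgue_measure]_(s in `[0, t]) y w i s + m w i t.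
Proof.
move=> [_ YE] t t0; rewrite yP// (YE t t0 i); congr (_ - _ + _).
by apply: eq_Rintegral => s; rewrite inE/= in_itv/= => /andP[s0 _]; rewrite yP.
Qed.

(** The equation makes the noise continuous along almost every path, so that
    its values at dyadic points determine its oscillation. *)
Lemma dev_le_not_bad (w : T) (i : 'I_d) (n : nat) (eps : R) : solves w -> ~ bad h M eps n w ->
  dev_le (m w i) h n eps.
Proof.
move=> sw nb t nt tn; have [J [dJ JE]] := primitive (@y_cont w i sw).
have t0 : 0 <= t by apply: le_trans nt; rewrite mulr_ge0// ltW.
have mE s : 0 <= s -> m w i s = y w i s - Y 0 w i ord0 + (J s - J 0).
  by move=> s0; rewrite (@y_eq w i sw s s0) JE//; ring.
have cm : {for t, continuous (fun s => y w i s - Y 0 w i ord0 + (J s - J 0))}.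
  have cJ : {for t, continuous J}.
    by have [dJt _] := dJ t t0; apply: differentiable_continuous; apply/derivable1_diffP.
  apply: cvgD; first by apply: cvgB; [exact: y_cont|exact: cvg_cst].
  by apply: cvgB; [exact: cJ|exact: cvg_cst].
apply/ler_addgt0Pr => e e0.
have /cvgrPdist_lt/(_ _ e0)/nbhs_ballP[del /= del0 Hdel] := cm.
have del20 : 0 < del / 2 by rewrite divr_gt0.
have [l Hl] := filter_ex (mesh_small h0 del20).
have [k [kl kt]] : exists k, (k <= 2 ^ l)%N /\ `|t - bgrid h l n k| < del.
  have hl : h / 2 ^+ l < del by apply: le_lt_trans Hl _; rewrite ltr_pdivrMr// ltr_pMr// ltr1n.
  have [teq|tneq] := eqVneq t (n%:R * h).
    by exists 0%N; rewrite bgrid0 teq subrr normr0.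
  have s0 : 0 < t - n%:R * h by rewrite subr_gt0 lt_neqAle eq_sym tneq.
  have sK : t - n%:R * h <= grid h l (2 ^ l).
    by have := bgrid_last h l n; rewrite bgridE => E; move: tn; rewrite -E; lra.
  have [k kl [ks sk]] := find_cell s0 sK.
  exists k; split; first exact: ltnW.
  rewrite bgridE opprD addrA ger0_norm; last by rewrite subr_ge0 ltW.
  by have := gridS h l k; lra.
have mk : `|m w i (bgrid h l n k) - m w i (n%:R * h)| <= eps.
  rewrite leNgt; apply/negP => lt; apply: nb; exists l, i; exists k => //.
  by rewrite /dev bgrid0.
have := Hdel (bgrid h l n k) kt; rewrite -!mE//; last exact: bgrid_ge0.
move=> /ltW mt; apply: le_trans (ler_distD (m w i (bgrid h l n k)) _ _) _.
by rewrite addrC; apply: lerD.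
Qed.

Let C0 : R := 2 / (1 - expR (- h)) + 3.

Let C0_gt0 : 0 < C0.
Proof. by rewrite ltr_wpDl// divr_ge0// subr_ge0 ltW// (decay_lt1 h0). Qed.

Lemma ae_not_bad (eps C : R) : 0 < eps -> C <= eps ^+ 2 / 16 ->
  bounded_sums (fun n => gtail (energy sigma h n) C) ->
  {ae P, forall w, exists n1, forall n, (n1 <= n)%N -> ~ bad h M eps n w}.
Proof.
move=> eps0 Ce bt.
have : bounded_sums (fun n => fine (P (bad h M eps n)) ^+ 1).
  by apply: (bad_pow hF hB h0 sigma_cont hM eps0 _ bt); rewrite mul1r.
move=> /(borel_cantelli1 (measurable_bad h0 hM eps)).
by apply: filterS => w [n1 _ H]; exists n1.
Qed.

Lemma ae_eventually_le (eps C : R) : 0 < eps -> C <= eps ^+ 2 / 16 ->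
  bounded_sums (fun n => gtail (energy sigma h n) C) ->
  {ae P, forall w, \forall t \near +oo, forall i, `|Y t w i ord0| <= C0 * eps}.
Proof.
move=> eps0 Ce bt; apply: filterS2 hY (ae_not_bad eps0 Ce bt) => w sw [n1 nb].
apply: filter_forall => i.
have dl n : (n1 <= n)%N -> dev_le (m w i) h n eps.
  by move=> n1n; apply: dev_le_not_bad => //; exact: nb.
have [A A0 HA] := eventually_le h0 (@y_cont w i sw) (@y_eq w i sw) eps0 dl.
have : \forall t \near +oo, A <= t by apply: nbhs_pinfty_ge; exact: num_real.
by apply: filterS => t At; rewrite -yP ?(le_trans A0)// HA.
Qed.

(** By increment_le a block where the noise has a large increment contains a
    time where Y is large. *)
Lemma ae_frequently_ge (eps : R) : 0 < eps ->
  ~ bounded_sums (fun n => gtail (energy sigma h n) (16 * d%:R * eps ^+ 2)) ->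
  {ae P, forall w, forall A, exists2 t, A <= t & eps / (2 * (2 + h)) <= enorm (Y t w)}.
Proof.
move=> eps0 nb; have := large_increments d_gt0 hF hB h0 sigma_cont hM eps0 nb.
apply: filterS2 hY => w sw H A.
have [n0 An] : exists n0 : nat, A <= n0%:R * h.
  exists (Num.truncn (A / h)).+1; rewrite -ler_pdivrMr//.
  by apply/ltW/truncnS_gt.
have [n [i [n0n lt]]] := H n0.
have t0 : 0 <= n%:R * h by rewrite mulr_ge0// ltW.
have tS : n%:R * h <= n.+1%:R * h by rewrite ler_pM2r// ler_nat.
apply: contrapT => nex.
have small t : n%:R * h <= t -> t <= n.+1%:R * h -> `|y w i t| <= eps / (2 * (2 + h)).
  move=> nt tn; rewrite leNgt; apply/negP => gt; apply: nex; exists t.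
    apply: le_trans An (le_trans _ nt).
    by rewrite ler_pM2r// ler_nat.
  apply/ltW; apply: (lt_le_trans gt); rewrite yP ?(le_trans t0)//.
  exact: coord_le_enorm.
have := increment_le (@y_cont w i sw) (@y_eq w i sw) t0 tS small.
rewrite leNgt -[m w i _]/(M _ w i ord0) -[m w i (n%:R * h)]/(M _ w i ord0) => /negP; apply.
apply: le_lt_trans lt; rewrite -mulrBl -natrB// subSnn mul1r.
by rewrite le_eqVlt; apply/orP; left; apply/eqP; field; rewrite gt_eqF// addr_gt0.
Qed.

(** Summability of the tails for a single C suffices: it bounds the path
    through some large level k0, and for every smaller level some power of the
    probabilities of bad blocks is summable, so that these blocks have
    frequency 0. *)
Lemma ae_time_average (C : R) :
  bounded_sums (fun n => gtail (energy sigma h n) C) ->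
  {ae P, forall w, t^-1 * (\int[lebesgue_measure]_(s in `[0, t])
     (enorm (Y s w) ^+ 2)) @[t --> +oo] --> (0 : R)}.
Proof.
move=> bt.
have [k0 k00 Ck0] : exists2 k0 : R, 0 < k0 & C <= k0 ^+ 2 / 16.
  exists (16 * (`|C| + 1)); first by rewrite mulr_gt0// ltr_wpDl.
  apply: (le_trans (ler_norm _)); have := normr_ge0 C.
  set x := `|C| => x0; rewrite ler_pdivlMr//.
  have := mulr_ge0 x0 x0; rewrite expr2; lra.
have freq : {ae P, forall w, forall k : nat, forall e : R, 0 < e ->
    \forall N \near \oo, \sum_(n < N) \1_(bad h M k.+1%:R^-1 n) w <= e * N%:R}.
  apply: ae_foralln => k; have eta0 : 0 < k.+1%:R^-1 :> R by rewrite invr_gt0 ltr0n.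
  pose x : R := k.+1%:R^-1 ^+ 2 / 16; have x0 : 0 < x by rewrite divr_gt0// exprn_gt0.
  have Cm : C <= (Num.truncn (C / x)).+1%:R * x.
    by rewrite -ler_pdivrMr//; apply/ltW/truncnS_gt.
  apply: (@ae_frequency0 _ _ _ _ _ (Num.truncn (C / x))).
    by move=> n; exact: (measurable_bad h0 hM).
  exact: (bad_pow hF hB h0 sigma_cont hM eta0 Cm bt).
have nbad := ae_not_bad k00 Ck0 bt.
apply: filterS3 hY nbad freq => w sw [n1 nb] fr.
have avg i : t^-1 * (\int[lebesgue_measure]_(s in `[0, t]) y w i s ^+ 2) @[t --> +oo] --> 0.
  apply: (time_average (n1 := n1) h0 (@y_cont w i sw) (@y_eq w i sw) k00).
    by move=> n n1n; apply: dev_le_not_bad => //; exact: nb.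
  move=> eta eta0; have [k keta] := exists_natSinv_le eta0.
  exists (fun n => w \in bad h M k.+1%:R^-1 n).
    move=> n /negP nbn; have nbn' : ~ bad h M k.+1%:R^-1 n w.
      by move=> b; apply: nbn; rewrite inE.
    move=> t nt tn; apply: le_trans keta.
    exact: (dev_le_not_bad i sw nbn').
  by move=> e e0; exact: fr.
have cy2 i : continuous (fun t => y w i t ^+ 2).
  by move=> t; apply: (@continuous_comp _ _ _ (y w i) (fun x => x ^+ 2));
    [exact: y_cont|exact: exprn_continuous].
have E t : t^-1 * (\int[lebesgue_measure]_(s in `[0, t]) (enorm (Y s w) ^+ 2)) =
    \sum_(i < d) t^-1 * (\int[lebesgue_measure]_(s in `[0, t]) y w i s ^+ 2).
  rewrite -mulr_sumr -Rintegral_sum_itv//; congr (_ * _).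
  apply: eq_Rintegral => s; rewrite inE/= in_itv/= => /andP[s0 _].
  by rewrite enorm_sqr; apply: eq_bigr => i _; rewrite yP.
under eq_fun do rewrite E.
elim: (index_enum _) => [|i s IH].
  by under eq_fun do rewrite big_nil; exact: cvg_cst.
under eq_fun do rewrite big_cons.
have := cvgD (avg i) IH; rewrite addr0 => H.
exact: H.
Qed.

End solution.

(** * The trichotomy *)

Lemma column_cvg0 (R : realType) (d : nat) (X : R -> 'cV[R]_d) :
  (forall e : R, 0 < e -> \forall t \near +oo, forall i, `|X t i ord0| <= e) ->
  X t @[t --> +oo] --> (0 : 'cV[R]_d).
Proof.
move=> H; apply/cvg_ballP => e e0; have e20 : 0 < e / 2 by rewrite divr_gt0.
apply: filterS (H _ e20) => t Ht; split=> // i j.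
rewrite mxE /ball/= sub0r normrN (ord1 j); apply: le_lt_trans (Ht i) _.
by rewrite ltr_pdivrMr// ltr_pMr// ltr1n.
Qed.

Lemma enorm_le (R : realType) (d : nat) (v : 'cV[R]_d) (k : R) : 0 <= k ->
  (forall i, `|v i ord0| <= k) -> enorm v <= d%:R * k.
Proof.
move=> k0 H; rewrite -(@ler_pXn2r _ 2)// ?nnegrE ?sqrtr_ge0 ?mulr_ge0//.
rewrite enorm_sqr; apply: (@le_trans _ _ (\sum_(i < d) k ^+ 2)).
  by apply: ler_sum => i _; rewrite -[v i ord0 ^+ 2]real_normK ?num_real// ler_pXn2r ?nnegrE.
rewrite sumr_const card_ord -[leLHS]mulr_natl exprMn; apply: ler_wpM2r; first exact: sqr_ge0.
by rewrite -natrX ler_nat -{1}[d]expn1; case: (d) => // n; rewrite leq_pexp2l.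
Qed.

Lemma enorm_frequently_small (R : realType) (d : nat) (X : R -> 'cV[R]_d) :
  {within `[0, +oo[, continuous X} ->
  t^-1 * (\int[lebesgue_measure]_(s in `[0, t]) (enorm (X s) ^+ 2)) @[t --> +oo] --> (0 : R) ->
  forall e : R, 0 < e -> forall A, exists2 t, A <= t & enorm (X t) <= e.
Proof.
move=> cX; pose g (t : R) := \sum_(i < d) X (Num.max 0 t) i ord0 ^+ 2.
have gE (t : R) : 0 <= t -> g t = enorm (X t) ^+ 2.
  by move=> /max_idPr t0; rewrite enorm_sqr /g t0.
have cg : continuous g.
  apply: continuous_sum => i t.
  pose Xi (t : R) : R := X (Num.max 0 t) i ord0.
  apply: (@continuous_comp _ _ _ Xi (fun x => x ^+ 2)).
    apply: (@continuous_comp _ _ _ (fun t : R => X (Num.max 0 t)) (fun A : 'cV[R]_d => A i ord0)).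
      exact: (continuous_clamp cX).
    exact: coord_continuous.
  exact: exprn_continuous.
have IE (t : R) : \int[lebesgue_measure]_(s in `[0, t]) (enorm (X s) ^+ 2) =
    \int[lebesgue_measure]_(s in `[0, t]) g s.
  by apply: eq_Rintegral => s; rewrite inE/= in_itv/= => /andP[s0 _]; rewrite gE.
under eq_fun do rewrite IE; move=> cv e e0 A.
have g0 t : 0 <= g t by apply: sumr_ge0 => i _; exact: sqr_ge0.
have [t At te] := frequently_small cg g0 cv (exprn_gt0 2 e0) (Num.max 0 A).
move: At; rewrite ge_max => /andP[t0 At]; exists t => //.
by rewrite -(@ler_pXn2r _ 2)// ?nnegrE ?sqrtr_ge0 ?(ltW e0)// -gE.
Qed.

Theorem theorem2 (R : realType) (disp : measure_display)
    (T : measurableType disp) (P : probability T R) (F : R -> set (set T))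
    (d r : nat) (B : R -> T -> 'cV[R]_r) (sigma : R -> 'M[R]_(d, r))
    (Y : R -> T -> 'cV[R]_d) (h : R)
    (d_gt0 : (0 < d)%N) (r_gt0 : (0 < r)%N)
    (F_filtration : filtration F)
    (B_brownian : brownian_motion P F B)
    (sigma_continuous : {within `[0, +oo[, continuous sigma})
    (Y_solution : ou_solution P F B sigma Y)
    (h_gt0 : 0 < h) :
  [/\ (forall eps, 0 < eps -> (S' sigma h eps < +oo)%E) ->
      {ae P, forall w, Y t w @[t --> +oo] --> (0 : 'cV[R]_d)},
      (exists eps' : R, [/\ 0 < eps',
         forall eps, eps' < eps -> (S' sigma h eps < +oo)%E &
         forall eps, 0 < eps -> eps < eps' -> S' sigma h eps = +oo%E]) ->
      [/\ exists c1 c2 : R, [/\ 0 < c1, c1 <= c2 &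
            {ae P, forall w,
              (c1%:E <= limsup_infty (fun t => enorm (Y t w)))%E /\
              (limsup_infty (fun t => enorm (Y t w)) <= c2%:E)%E}],
          {ae P, forall w, liminf_infty (fun t => enorm (Y t w)) = 0%E} &
          {ae P, forall w,
            t^-1 * (\int[lebesgue_measure]_(s in `[0, t])
                      (enorm (Y s w) ^+ 2)) @[t --> +oo] --> (0 : R)}] &
      (forall eps, 0 < eps -> S' sigma h eps = +oo%E) ->
      {ae P, forall w, limsup_infty (fun t => enorm (Y t w)) = +oo%E}].
Proof.
have [_ cY _ [M [hM eqY]]] := Y_solution.
have hY : {ae P, forall w, solves Y M w} by apply: filterS2 cY eqY => w.
pose C0 : R := 2 / (1 - expR (- h)) + 3.
have C0_gt0 : 0 < C0.
  by rewrite ltr_wpDl// divr_ge0// subr_ge0 ltW// (decay_lt1 h_gt0).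
have upper (eps : R) : 0 < eps -> (S' sigma h (eps / 8) < +oo)%E ->
    {ae P, forall w, \forall t \near +oo, forall i, `|Y t w i ord0| <= C0 * eps}.
  move=> eps0 fin; have eps80 : 0 < eps / 8 by rewrite divr_gt0.
  apply: (ae_eventually_le F_filtration B_brownian h_gt0 sigma_continuous hM hY eps0 _
    (S'_lty_gtail eps80 fin)).
  by have := sqr_ge0 eps; rewrite expr_div_n expr2; lra.
have lower (eps : R) : 0 < eps -> S' sigma h (8 * d%:R * eps) = +oo%E ->
    {ae P, forall w, forall A, exists2 t, A <= t & eps / (2 * (2 + h)) <= enorm (Y t w)}.
  move=> eps0 inf.
  apply: (ae_frequently_ge d_gt0 F_filtration B_brownian h_gt0 sigma_continuous hM hY eps0) => b.
  have d1 : 1 <= d%:R :> R by rewrite ler1n.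
  have e80 : 0 < 8 * d%:R * eps by rewrite !mulr_gt0// (lt_le_trans ltr01).
  suff : (S' sigma h (8 * d%:R * eps) < +oo)%E by rewrite inf.
  apply: (gtail_S'_lty e80).
  apply: (bounded_sums_le (n0 := 0%N) _ _ b) => n; first exact: gtail_ge0.
  move=> _; apply: gtail_le; have := sqr_ge0 eps.
  rewrite !exprMn; set x := eps ^+ 2 => x0.
  (* 16 * d * eps^2 <= (8 * d * eps)^2 / 2 because d >= 1. *)
  have dd : d%:R <= d%:R ^+ 2 :> R by rewrite expr2 ler_peMr// ler0n.
  have := ler_wpM2r x0 dd; have : 0 <= d%:R * x by rewrite mulr_ge0.
  by lra.
split.
- move=> fin; have H : {ae P, forall w, forall k : nat, \forall t \near +oo,
      forall i, `|Y t w i ord0| <= C0 * k.+1%:R^-1}.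
    apply: ae_foralln => k; apply: upper; first by rewrite invr_gt0.
    by apply: fin; rewrite divr_gt0// invr_gt0.
  apply: filterS H => w Hw; apply: column_cvg0 => e e0.
  have [k ke] := exists_natSinv_le (divr_gt0 e0 C0_gt0).
  apply: filterS (Hw k) => t Ht i; apply: le_trans (Ht i) _.
  by rewrite mulrC -ler_pdivlMr.
- case=> eps' [eps'0 fin inf].
  have fin2 : (S' sigma h (2 * eps') < +oo)%E by apply: fin; rewrite ltr_pMl// ltr1n.
  have avg : {ae P, forall w, t^-1 * (\int[lebesgue_measure]_(s in `[0, t])
       (enorm (Y s w) ^+ 2)) @[t --> +oo] --> (0 : R)}.
    have e20 : 0 < 2 * eps' by rewrite mulr_gt0.
    exact: (ae_time_average F_filtration B_brownian h_gt0 sigma_continuous hM hY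
      (S'_lty_gtail e20 fin2)).
  split=> //; last first.
    apply: filterS2 cY avg => w cYw av; apply: liminf_infty_eq0 => [t|].
      exact: sqrtr_ge0.
    exact: enorm_frequently_small.
  (* c1 and c come from the series at eps' / 2, where it diverges, and at 2
     eps', where it converges. *)
  pose c1 := eps' / (16 * d%:R) / (2 * (2 + h)).
  pose c := d%:R * (C0 * (16 * eps')).
  have dR0 : 0 < d%:R :> R by rewrite ltr0n.
  have c10 : 0 < c1.
    by rewrite !divr_gt0// ?mulr_gt0// addr_gt0.
  exists c1, (Num.max c1 c); split => //; first by rewrite le_max lexx.
  have e160 : 0 < 16 * eps' by rewrite mulr_gt0.
  have ed0 : 0 < eps' / (16 * d%:R) by rewrite divr_gt0// mulr_gt0.
  have up : {ae P, forall w, \forall t \near +oo, forall i, `|Y t w i ord0| <= C0 * (16 * eps')}.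
    by apply: upper => //; have -> : 16 * eps' / 8 = 2 * eps' by field.
  have lo : {ae P, forall w, forall A, exists2 t, A <= t & c1 <= enorm (Y t w)}.
    apply: lower => //; apply: inf.
      by rewrite mulr_gt0// mulr_gt0.
    have -> : 8 * d%:R * (eps' / (16 * d%:R)) = eps' / 2 by field; rewrite gt_eqF.
    by rewrite ltr_pdivrMr// ltr_pMr// ltr1n.
  apply: filterS2 up lo => w upw low; split; first exact: limsup_infty_ge.
  apply: limsup_infty_le; apply: filterS upw => t Ht.
  rewrite le_max; apply/orP; right; apply: enorm_le => //.
  by rewrite ltW// mulr_gt0.
move=> inf; have H : {ae P, forall w, forall k : nat, forall A, exists2 t, A <= t &
    k%:R + 1 <= enorm (Y t w)}.
  apply: ae_foralln => k; pose e := (k%:R + 1) * (2 * (2 + h)).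
  have e0 : 0 < e by rewrite mulr_gt0// ?mulr_gt0 ?addr_gt0// ltr_wpDl.
  have -> : k%:R + 1 = e / (2 * (2 + h)).
    by rewrite /e mulfK// gt_eqF// mulr_gt0// addr_gt0.
  by apply: lower => //; apply: inf; rewrite mulr_gt0// mulr_gt0// ltr0n.
apply: filterS H => w Hw; apply: limsup_infty_eqy => c A.
have [t At ct] := Hw (Num.truncn c) A; exists t => //; apply: le_trans ct.
by rewrite natr1; apply/ltW/truncnS_gt.
Qed.
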